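(* There exists a constant $0<L<\infty$ such that $$\lim_{t\to\infty}t^{-2\pi}\log\mathbb{P}\{-\beta_1\ge\log t\}=-L,$$ where $\beta_1$ is the renormalized self-intersection local time at time $1$ of planar Brownian motion started at $0$.
   Context: $X_t$ is a planar standard Brownian motion started at $0$. Let $\varphi$ be a smooth nonnegative Schwartz function on $\mathbb{R}^2$ with $\int\varphi=1$, $\varphi_\varepsilon(x)=\varepsilon^{-2}\varphi(x/\varepsilon)$, and $$\beta_t=\lim_{\varepsilon\to0}\Big[\int_0^t\int_0^s\varphi_\varepsilon(X_s-X_u)\,du\,ds-\mathbb{E}\int_0^t\int_0^s\varphi_\varepsilon(X_s-X_u)\,du\,ds\Big]$$ (the limit exists a.s.). *)

(* Defs.v *)
From HB Require Import structures.
From mathcomp Require Import all_boot all_order all_algebra.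
From mathcomp Require Import all_classical all_reals all_analysis.
Set Implicit Arguments. Unset Strict Implicit. Unset Printing Implicit Defensive.
Import Order.TTheory GRing.Theory Num.Theory.
Import numFieldNormedType.Exports.
Local Open Scope classical_set_scope.
Local Open Scope ring_scope.

Section Defs.
Variable R : realType.

Definition pderiv (b : bool) (f : R -> R -> R) : R -> R -> R :=
  fun x y => if b then derive1 (fun a => f x a) y else derive1 (fun a => f a y) x.

Definition pderivable (b : bool) (f : R -> R -> R) (x y : R) : Prop :=
  if b then derivable (fun a => f x a) y 1 else derivable (fun a => f a y) x 1.

Fixpoint iter_pderiv (ds : seq bool) (f : R -> R -> R) : R -> R -> R :=
  match ds with
  | [::] => f
  | b :: ds' => pderiv b (iter_pderiv ds' f)
  end.

Definition smooth2 (f : R -> R -> R) : Prop :=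
  forall ds : seq bool,
    continuous (fun p : R * R => iter_pderiv ds f p.1 p.2) /\
    (forall b x y, pderivable b (iter_pderiv ds f) x y).

Definition schwartz2 (f : R -> R -> R) : Prop :=
  smooth2 f /\
  forall (ds : seq bool) (N : nat), exists C : R, forall x y : R,
    (1 + x ^+ 2 + y ^+ 2) ^+ N * `| iter_pderiv ds f x y | <= C.

Definition phi_eps (phi : R -> R -> R) (eps : R) : R -> R -> R :=
  fun x y => eps ^- 2 * phi (x / eps) (y / eps).

Definition planar_BM (d : measure_display) (Omega : measurableType d)
  (P : probability Omega R) (X1 X2 : R -> Omega -> R) : Prop :=
  [/\ (forall t, measurable_fun setT (X1 t) /\ measurable_fun setT (X2 t)),
      (forall w, X1 0 w = 0 /\ X2 0 w = 0),
      (forall w, {within `[0, +oo[, continuous (fun t => X1 t w)} /\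
                 {within `[0, +oo[, continuous (fun t => X2 t w)}) &
      (forall (n : nat) (t : nat -> R) (A B : nat -> set R),
         t 0%N = 0 -> (forall i, (i < n)%N -> t i < t i.+1) ->
         (forall i, measurable (A i) /\ measurable (B i)) ->
         P (\big[setI/setT]_(i < n)
              ([set w | A i (X1 (t i.+1) w - X1 (t i) w)] `&`
               [set w | B i (X2 (t i.+1) w - X2 (t i) w)])) =
         (\prod_(i < n)
            (normal_prob 0 (Num.sqrt (t i.+1 - t i)) (A i) *
             normal_prob 0 (Num.sqrt (t i.+1 - t i)) (B i)))%E)].

Definition approx_SILT (d : measure_display) (Omega : measurableType d)
  (X1 X2 : R -> Omega -> R) (phi : R -> R -> R) (eps : R) (w : Omega) : R :=
  fine (\int[lebesgue_measure]_(s in `[0%R, 1%R]%classic)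
          \int[lebesgue_measure]_(u in `[0%R, s]%classic)
             (phi_eps phi eps (X1 s w - X1 u w) (X2 s w - X2 u w))%:E)%E.

Definition approx_SILT_mean (d : measure_display) (Omega : measurableType d)
  (P : probability Omega R) (X1 X2 : R -> Omega -> R) (phi : R -> R -> R)
  (eps : R) : R :=
  fine (\int[P]_w (approx_SILT X1 X2 phi eps w)%:E)%E.

End Defs.

(* Main.v *)
(** Write [A] for the self-intersection local time of the path with kernel
    [phi_eps]. Cutting [0,1] into [n] blocks and discarding the nonnegative
    cross terms gives [A >= n^-1 (A_1 + ... + A_n)], where the [A_b] are
    independent copies of [A] for the kernel [phi_(eps sqrt n)]; the means
    differ by at most [ln n / (2 pi)]. Hence the Laplace transform
    [M th = E exp (- th beta)] satisfies [M (n th) <= M th ^ n * n ^ (n th / (2 pi))],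
    so that [ln (M th) / th - ln th / (2 pi)] decreases along multiplication by
    integers. It is bounded below: tilting by a drift of size [sqrt th] costs
    [exp th] and lowers the mean of [A] to its value up to time [1 / th].
    Thus this quantity converges to a constant [C], and exponential tilting
    turns [M th = exp (th (ln th / (2 pi) + C + o(1)))] into the double
    exponential tail, with [L = exp (- 2 pi C - 1) / (2 pi)].

    To pass to the limit [eps -> 0] one needs exponential moments uniform in
    [eps]; they come from the case [n = 2] by induction on the scale, the
    cross term having a variance bounded uniformly in [eps]. The same
    recursion applied to the difference of two kernel families bounds its
    variance by a multiple of [eps]; so [M], hence [L], depends neither on
    [phi] nor on the probability space. All moments of [A] are computed on
    Riemann sums, where only finitely many independent increments occur. *)

Require Import Defs.
From HB Require Import structures.
From mathcomp Require Import all_boot all_order all_algebra.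
From mathcomp Require Import all_classical all_reals all_analysis.
From mathcomp Require Import measurable_realfun lebesgue_measure.
From mathcomp Require Import ring lra zify.
Import Order.TTheory GRing.Theory Num.Theory.
Import numFieldNormedType.Exports.
Set Implicit Arguments. Unset Strict Implicit. Unset Printing Implicit Defensive.
Local Open Scope classical_set_scope.
Local Open Scope ring_scope.

(** * Bounded random variables *)

(** For a fixed range the approximate local time is bounded. Each estimate is therefore proved for
    [lap eps th] with constants free of [eps], and only then carried to the limit; there
    exponentials are truncated, and the exponential moment at [2 * th] controls what is cut off.

    Conditional expectations are replaced by [splice], that is, by an iterated integral over two
    copies of the probability space. This suffices because a Riemann sum sees finitely many Gaussian
    increments.

    The small-parameter bound has the Gaussian form [expR (K * th ^+ 2)] because this form
    reproduces itself when time is halved: Hoelder's inequality contracts [K] by 3/4 and leaves room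
    for the cross term.

    [L] has to be chosen before any probability space is given. Either some Brownian setup exists,
    and its Laplace transform serves all the others, or the claim is vacuous; no Brownian motion has
    to be constructed. *)

Section BoundedMeasurable.
Context d (T : measurableType d) (R : realType).
Implicit Types f g : T -> R.

(** For a fixed range [eps] the approximate local time belongs to this class, so integrability and
    the linearity of the expectation come free. *)
Definition bmf f := measurable_fun setT f /\ exists K : R, forall x, `|f x| <= K.

Lemma bmf_cst c : bmf (fun=> c).
Proof. by split; [exact: measurable_cst | exists `|c|]. Qed.

Lemma bmfD f g : bmf f -> bmf g -> bmf (fun x => f x + g x).
Proof.
move=> [mf [K fK]] [mg [L gL]]; split; first exact: measurable_funD.
by exists (K + L) => x; rewrite (le_trans (ler_normD _ _))// lerD.
Qed.

Lemma bmfM f g : bmf f -> bmf g -> bmf (fun x => f x * g x).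
Proof.
move=> [mf [K fK]] [mg [L gL]]; split; first exact: measurable_funM.
by exists (K * L) => x; rewrite normrM ler_pM.
Qed.

Lemma bmfZ c f : bmf f -> bmf (fun x => c * f x).
Proof. by move=> ?; apply: bmfM => //; exact: bmf_cst. Qed.

Lemma bmfN f : bmf f -> bmf (fun x => - f x).
Proof. by move=> /(bmfZ (-1)); under eq_fun do rewrite mulN1r. Qed.

Lemma bmfB f g : bmf f -> bmf g -> bmf (fun x => f x - g x).
Proof. by move=> ? ?; apply: bmfD => //; exact: bmfN. Qed.

Lemma bmf_sum I (r : seq I) (p : pred I) (F : I -> T -> R) :
  (forall i, bmf (F i)) -> bmf (fun x => \sum_(i <- r | p i) F i x).
Proof.
move=> bF; elim: r => [|i r IH]; first by under eq_fun do rewrite big_nil; exact: bmf_cst.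
under eq_fun do rewrite big_cons; case: (p i) => //; exact: bmfD.
Qed.

Lemma bmf_prod I (r : seq I) (p : pred I) (F : I -> T -> R) :
  (forall i, bmf (F i)) -> bmf (fun x => \prod_(i <- r | p i) F i x).
Proof.
move=> bF; elim: r => [|i r IH]; first by under eq_fun do rewrite big_nil; exact: bmf_cst.
under eq_fun do rewrite big_cons; case: (p i) => //; exact: bmfM.
Qed.

Lemma continuous_bounded_itv (g : R -> R) (K : R) : continuous g ->
  exists L : R, forall x, `|x| <= K -> `|g x| <= L.
Proof.
move=> cg; have [K0|K0] := ltP K 0.
  by exists 0 => x xK; have := le_lt_trans xK K0; rewrite normr_lt0.
have NK : - K <= K by lra.
have /(EVT_max NK)[c _ cm] : {within `[- K, K], continuous (fun x => `|g x|)}.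
  by apply: continuous_subspaceT => x; apply: cvg_norm; exact: cg.
by exists `|g c| => x; rewrite ler_norml => xK; apply: cm; rewrite in_itv.
Qed.

Lemma bmf_comp (g : R -> R) f : continuous g -> bmf f -> bmf (fun x => g (f x)).
Proof.
move=> cg [mf [K fK]]; split.
  by apply: measurableT_comp => //; exact: continuous_measurable_fun.
by have [L gL] := continuous_bounded_itv K cg; exists L => x; apply: gL.
Qed.

Lemma bmf_expR f : bmf f -> bmf (fun x => expR (f x)).
Proof. by apply: bmf_comp; exact: continuous_expR. Qed.

Variable P : probability T R.

Lemma bmf_integrable f : bmf f -> P.-integrable setT (EFin \o f).
Proof.
move=> [mf [K fK]]; apply: (@le_integrable _ _ _ _ _ _ _ (EFin \o cst K)) => //.
- exact/measurable_EFinP.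
- by move=> x _; rewrite /= lee_fin (le_trans (fK x))// ler_norm.
- exact: finite_measure_integrable_cst.
Qed.

Lemma expect_cst (c : R) : \int[P]_w c = c.
Proof.
rewrite Rintegral_cst//.
have /= -> := probability_setT P.
by rewrite mulr1.
Qed.

Lemma expect_norm_le f K : measurable_fun setT f -> (forall x, `|f x| <= K) -> `|\int[P]_w f w| <= K.
Proof.
move=> mf fK; have bf : bmf f by split => //; exists K.
apply: le_trans (le_normr_Rintegral measurableT (bmf_integrable bf)) _.
rewrite -[leRHS]expect_cst; apply: le_Rintegral => //.
- apply: (bmf_integrable (f := fun x => `|f x|)); apply: bmf_comp bf => x.
  exact: (@norm_continuous _ R^o).
- exact: (bmf_integrable (bmf_cst K)).
Qed.

Lemma expect_lim (F : nat -> T -> R) f K :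
  (forall n, measurable_fun setT (F n)) -> measurable_fun setT f ->
  (forall n x, `|F n x| <= K) ->
  {ae P, forall x, F n x @[n --> \oo] --> f x} ->
  \int[P]_w F n w @[n --> \oo] --> \int[P]_w f w.
Proof.
move=> mF mf FK Ff.
have iK : P.-integrable setT (EFin \o cst K) by exact: finite_measure_integrable_cst.
have [||||| intf _ cv] := @dominated_convergence _ T R P setT measurableT
    (fun n => EFin \o F n) (EFin \o f) (EFin \o cst K).
- by move=> n; exact/measurable_EFinP.
- exact/measurable_EFinP.
- move: Ff; apply: filterS => x Ffx _.
  by apply: cvg_EFin => //; exact: nearW.
- exact: iK.
- by apply: aeW => x n _; rewrite /= lee_fin.
apply: fine_cvg.
rewrite fineK; first by [].
exact: integrable_fin_num.
Qed.

Lemma expect_sum I (r : seq I) (p : pred I) (F : I -> T -> R) :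
  (forall i, bmf (F i)) ->
  \int[P]_w (\sum_(i <- r | p i) F i w) = \sum_(i <- r | p i) \int[P]_w F i w.
Proof.
move=> bF; elim: r => [|i r IH].
  by rewrite big_nil; under eq_Rintegral do rewrite big_nil; exact: expect_cst.
rewrite big_cons; under eq_Rintegral do rewrite big_cons.
case: (p i) => //; rewrite RintegralD ?IH//; apply: bmf_integrable => //.
exact: bmf_sum.
Qed.

Lemma expectD f g : bmf f -> bmf g ->
  \int[P]_w (f w + g w) = \int[P]_w f w + \int[P]_w g w.
Proof. by move=> bf bg; rewrite RintegralD//; exact: bmf_integrable. Qed.

Lemma expectB f g : bmf f -> bmf g ->
  \int[P]_w (f w - g w) = \int[P]_w f w - \int[P]_w g w.
Proof. by move=> bf bg; rewrite RintegralB//; exact: bmf_integrable. Qed.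

Lemma expectZ (c : R) f : bmf f -> \int[P]_w (c * f w) = c * \int[P]_w f w.
Proof. by move=> bf; rewrite RintegralZl//; exact: bmf_integrable. Qed.

Lemma expect_le f g : bmf f -> bmf g -> (forall w, f w <= g w) ->
  \int[P]_w f w <= \int[P]_w g w.
Proof. by move=> bf bg fg; apply: le_Rintegral => //; exact: bmf_integrable. Qed.

End BoundedMeasurable.

Lemma ge0_integralZl_real d (T : measurableType d) (R : realType)
    (mu : {measure set T -> \bar R}) (k : R) (f : T -> R) :
  measurable_fun setT f -> (forall x, 0 <= f x) -> 0 <= k ->
  (\int[mu]_x (k * f x)%:E = k%:E * \int[mu]_x (f x)%:E)%E.
Proof.
move=> mf f0 k0; under eq_integral do rewrite EFinM.
have mf' : measurable_fun setT (EFin \o f) by exact/measurable_EFinP.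
by rewrite ge0_integralZl// => x _; rewrite lee_fin.
Qed.

(** * Lattice walks *)

Section TupleLaw.
Context (R : realType) d (Omega : measurableType d) d' (Omega' : measurableType d').
Variables (P : probability Omega R) (P' : probability Omega' R).

(** Measurable rectangles are stable under intersection and generate the sigma-algebra of tuples, so
    they determine the law of the vector [X]. *)
Lemma tuple_law_unique n (X : 'I_n -> Omega -> R) (X' : 'I_n -> Omega' -> R) :
  (forall i, measurable_fun setT (X i)) -> (forall i, measurable_fun setT (X' i)) ->
  (forall A : 'I_n -> set R, (forall i, measurable (A i)) ->
     P [set w | forall i, A i (X i w)] = P' [set w | forall i, A i (X' i w)]) ->
  forall F : n.-tuple R -> \bar R, measurable_fun setT F -> (forall t, 0 <= F t)%E ->
  (\int[P]_w F [tuple X i w | i < n] = \int[P']_w F [tuple X' i w | i < n])%E.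
Proof.
move=> mX mX' XX' F mF F0.
pose tX w := [tuple X i w | i < n]; pose tX' w := [tuple X' i w | i < n].
have mtX : measurable_fun setT tX.
  apply/measurable_fun_tnthP => i.
  by rewrite (_ : _ \o _ = X i)//; apply/funext => w /=; rewrite tnth_mktuple.
have mtX' : measurable_fun setT tX'.
  apply/measurable_fun_tnthP => i.
  by rewrite (_ : _ \o _ = X' i)//; apply/funext => w /=; rewrite tnth_mktuple.
pose T := mfun_Sub (mem_set mtX); pose T' := mfun_Sub (mem_set mtX').
rewrite -[LHS](@ge0_integral_pushforward _ _ _ _ R T _ P setT F)//.
rewrite -[RHS](@ge0_integral_pushforward _ _ _ _ R T' _ P' setT F)//.
apply: eq_measure_integral => D mD _.
pose G : set (set (n.-tuple R)) := [set D | exists A : 'I_n -> set R,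
  (forall i, measurable (A i)) /\ D = [set t | forall i, A i (tnth t i)]].
have GT : G setT by exists (fun=> setT); split => //; apply/seteqP; split.
apply: (measure_unique G (fun=> setT)) => //.
- apply/seteqP; split.
  + apply: smallest_sub; first exact: smallest_sigma_algebra.
    move=> C; rewrite -bigcup_seq/= => -[i _] [B mB <-]; apply: sub_sigma_algebra.
    exists (fun j => if j == i then B else setT); split; first by move=> j; case: ifP.
    rewrite setTI; apply/seteqP; split => t /=.
      by move=> Bt j; case: eqP => // ->.
    by move=> /(_ i); rewrite eqxx.
  + apply: smallest_sub; first exact: sigma_algebra_measurable.
    move=> C [A [mA ->]].
    rewrite (_ : [set _ | _] = \big[setI/setT]_(i < n) ((@tnth _ R ^~ i) @^-1` A i)).
      apply: bigsetI_measurable => i _; rewrite -[X in measurable X]setTI.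
      exact: measurable_tnth.
    apply/seteqP; split => t /=.
      by move=> At; rewrite -bigcap_seq => i _; exact: At.
    by rewrite -bigcap_seq => At i; apply: At; rewrite /= mem_index_enum.
- move=> _ _ [A [mA ->]] [B [mB ->]].
  exists (fun i => A i `&` B i); split; first by move=> i; exact: measurableI.
  apply/seteqP; split => t /=; first by move=> [? ?] i.
  by move=> H; split=> i; case: (H i).
- by rewrite bigcup_const.
- move=> _ [A [mA ->]].
  have := XX' A mA; congr (_ = _).
    by congr (P _); apply/seteqP; split => w /= H i; move: (H i); rewrite tnth_mktuple.
  by congr (P' _); apply/seteqP; split => w /= H i; move: (H i); rewrite tnth_mktuple.
- by move=> _; have : (P setT < +oo)%E by rewrite probability_setT ltry.
Qed.

End TupleLaw.

Section Lattice.
Context (R : realType).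

(** A planar Gaussian walk; [s] is the standard deviation of one coordinate of one step. It records
    all that a Brownian motion shows on a finite grid, and it is stable under [splice]. *)
Definition lattice d (Omega : measurableType d) (P : probability Omega R)
    (N : nat) (s : R) (W1 W2 : nat -> Omega -> R) : Prop :=
  [/\ (forall k, measurable_fun setT (W1 k) /\ measurable_fun setT (W2 k)),
      (forall w, W1 0%N w = 0 /\ W2 0%N w = 0) &
      forall A B : nat -> set R, (forall i, measurable (A i) /\ measurable (B i)) ->
       P (\big[setI/setT]_(i < N)
              ([set w | A i (W1 i.+1 w - W1 i w)] `&`
               [set w | B i (W2 i.+1 w - W2 i w)])) =
         (\prod_(i < N) (normal_prob 0 s (A i) * normal_prob 0 s (B i)))%E].

(** Measurability is asked along every pair of measurable processes, so that no sigma-algebra on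
    sequences is needed. The space [T] varies because functionals are also evaluated on product
    spaces. *)
Definition cylinder (N : nat) (F : (nat -> R) -> (nat -> R) -> R) : Prop :=
  (forall x x' y y', (forall k, (k <= N)%N -> x k = x' k /\ y k = y' k) ->
    F x y = F x' y') /\
  (forall d (T : measurableType d) (x y : nat -> T -> R),
    (forall k, measurable_fun setT (x k) /\ measurable_fun setT (y k)) ->
    measurable_fun setT (fun w => F (x ^~ w) (y ^~ w))).

(** Positions up to step [N] are partial sums of the [N + N] increments, so [F] is a function of the
    increments, whose law is fixed on rectangles. *)
Lemma lattice_law d (Omega : measurableType d) (P : probability Omega R)
    d' (Omega' : measurableType d') (P' : probability Omega' R) N s W1 W2 W1' W2' F :
  lattice P N s W1 W2 -> lattice P' N s W1' W2' ->
  cylinder N F -> (forall x y, 0 <= F x y) ->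
  (\int[P]_w (F (W1 ^~ w) (W2 ^~ w))%:E = \int[P']_w (F (W1' ^~ w) (W2' ^~ w))%:E)%E.
Proof.
move=> [mW W0 LW] [mW' W0' LW'] [Fext Fm] F0.
pose inc d0 (T : measurableType d0) (V1 V2 : nat -> T -> R) (i : 'I_(N + N)) (w : T) : R :=
  match fintype.split i with inl j => V1 j.+1 w - V1 j w | inr j => V2 j.+1 w - V2 j w end.
pose p1 (k : nat) (t : (N + N).-tuple R) : R := \sum_(i < N | (i < k)%N) tnth t (lshift N i).
pose p2 (k : nat) (t : (N + N).-tuple R) : R := \sum_(i < N | (i < k)%N) tnth t (rshift N i).
have mp k : measurable_fun setT (p1 k) /\ measurable_fun setT (p2 k).
  rewrite /p1 /p2; split; under eq_fun do rewrite big_mkcond;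
    by apply: measurable_sum => i; case: (i < k)%N => //; exact: measurable_tnth.
have minc d0 (T : measurableType d0) (V1 V2 : nat -> T -> R) :
    (forall k, measurable_fun setT (V1 k) /\ measurable_fun setT (V2 k)) ->
    forall i, measurable_fun setT (inc d0 T V1 V2 i).
  move=> mV i; rewrite /inc; case: (fintype.split i) => j; apply: measurable_funB;
  by case: (mV j.+1); case: (mV j).
have tele (V : nat -> R) k : V 0%N = 0 -> (k <= N)%N ->
    \sum_(i < N | (i < k)%N) (V i.+1 - V i) = V k.
  move=> V0 kN; have := telescope_sumr V (leq0n k); rewrite V0 subr0 => <-; rewrite big_mkord.
  by rewrite (big_ord_widen N (fun i => V i.+1 - V i) kN).
pose G t := (F (p1 ^~ t) (p2 ^~ t))%:E.
have GE d0 (T : measurableType d0) (V1 V2 : nat -> T -> R) w :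
    V1 0%N w = 0 /\ V2 0%N w = 0 ->
    (F (V1 ^~ w) (V2 ^~ w))%:E = G [tuple inc d0 T V1 V2 i w | i < N + N].
  move=> [V10 V20]; congr EFin; apply: Fext => k kN; split.
    rewrite -(tele (V1 ^~ w))//; apply: eq_bigr => i _.
    by rewrite tnth_mktuple /inc (unsplitK (inl i)).
  rewrite -(tele (V2 ^~ w))//; apply: eq_bigr => i _.
  by rewrite tnth_mktuple /inc (unsplitK (inr i)).
under eq_integral do rewrite GE//.
under [RHS]eq_integral do rewrite GE//.
have rect d0 (T : measurableType d0) (Q : probability T R) (V1 V2 : nat -> T -> R)
    (A : 'I_(N + N) -> set R) : lattice Q N s V1 V2 -> (forall i, measurable (A i)) ->
    Q [set w | forall i, A i (inc d0 T V1 V2 i w)] =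
    (\prod_(i < N) (normal_prob 0 s (A (lshift N i)) * normal_prob 0 s (A (rshift N i))))%E.
  move=> [_ _ LV] mA.
  (* The hypothesis takes sets indexed by all naturals; beyond [N] they are padded with [setT]. *)
  pose A1 i := if insub i is Some j then A (lshift N j) else setT.
  pose A2 i := if insub i is Some j then A (rshift N j) else setT.
  have := LV A1 A2; rewrite (_ : \big[setI/setT]_(_ < _) _ =
      [set w | forall i, A i (inc d0 T V1 V2 i w)]); last first.
    rewrite -bigcap_seq; apply/seteqP; split => w /=.
      move=> H i; case: (splitP i) => j ij.
        have [+ _] := H j (mem_index_enum _); rewrite /A1 /= valK.
        rewrite /inc (_ : i = lshift N j); last exact/val_inj.
        by rewrite (unsplitK (inl j)).
      have [_ +] := H j (mem_index_enum _); rewrite /A2 /= valK.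
      rewrite /inc (_ : i = rshift N j); last exact/val_inj.
      by rewrite (unsplitK (inr j)).
    move=> H i _; split => /=.
      by rewrite /A1 valK; have := H (lshift N i); rewrite /inc (unsplitK (inl i)).
    by rewrite /A2 valK; have := H (rshift N i); rewrite /inc (unsplitK (inr i)).
  move=> ->; last by move=> i; rewrite /A1 /A2; case: insubP.
  by apply: eq_bigr => i _; rewrite /A1 /A2 valK.
apply: tuple_law_unique.
- exact: minc.
- exact: minc.
- by move=> A mA; rewrite !rect//; split.
- by apply/measurable_EFinP; apply: Fm.
- by move=> t; rewrite lee_fin.
Qed.

(** Adding the bound [K] makes the functional nonnegative, which brings it under [lattice_law]. *)
Lemma lattice_law_bounded d (Omega : measurableType d) (P : probability Omega R)
    d' (Omega' : measurableType d') (P' : probability Omega' R) N s W1 W2 W1' W2' F (K : R) :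
  lattice P N s W1 W2 -> lattice P' N s W1' W2' ->
  cylinder N F -> (forall x y, `|F x y| <= K) ->
  \int[P]_w F (W1 ^~ w) (W2 ^~ w) = \int[P']_w F (W1' ^~ w) (W2' ^~ w).
Proof.
move=> L L' [Fext Fm] FK.
pose G x y := F x y + K.
have GF d0 (T : measurableType d0) (Q : probability T R) (V1 V2 : nat -> T -> R) :
    lattice Q N s V1 V2 -> \int[Q]_w F (V1 ^~ w) (V2 ^~ w) = \int[Q]_w G (V1 ^~ w) (V2 ^~ w) - K.
  move=> [mV _ _]; rewrite RintegralD ?expect_cst ?addrK//.
    by apply: bmf_integrable; split; [exact: Fm | exists K].
  exact: finite_measure_integrable_cst.
rewrite (GF _ _ _ _ _ L) (GF _ _ _ _ _ L'); congr (_ - _); rewrite /Rintegral.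
congr fine; apply: (lattice_law L L').
  split; first by move=> x x' y y' H; rewrite /G (Fext x x' y y').
  by move=> d0 T x y mxy; apply: measurable_funD => //; exact: Fm.
by move=> x y; rewrite /G -lerBlDr sub0r; have := FK x y; rewrite ler_norml => /andP[].
Qed.

(* The increments after step [K] are resampled independently. *)
Definition splice d (Omega : measurableType d) (K : nat) (W : nat -> Omega -> R)
  (k : nat) (w : Omega * Omega) : R :=
  if (k <= K)%N then W k w.1 else W K w.1 + W k w.2 - W K w.2.

Lemma splice_left d (Omega : measurableType d) K (W : nat -> Omega -> R) k w :
  (k <= K)%N -> splice K W k w = W k w.1.
Proof. by rewrite /splice => ->. Qed.

Lemma splice_right d (Omega : measurableType d) K (W : nat -> Omega -> R) k w :
  (K <= k)%N -> splice K W k w = W K w.1 + W k w.2 - W K w.2.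
Proof. by rewrite /splice; case: ltngtP => // -> _; rewrite addrK. Qed.

Lemma splice_sub_right d (Omega : measurableType d) K (W : nat -> Omega -> R) j k w :
  (K <= j)%N -> (K <= k)%N -> splice K W k w - splice K W j w = W k w.2 - W j w.2.
Proof. by move=> Kj Kk; rewrite !splice_right//; ring. Qed.

(** An increment of the spliced walk involves [w.1] alone before step [K] and [w.2] alone after it,
    so a rectangle event is a product set. *)
Lemma lattice_splice d (Omega : measurableType d) (P : probability Omega R) N s W1 W2 K :
  lattice P N s W1 W2 -> lattice (P \x P)%E N s (splice K W1) (splice K W2).
Proof.
move=> [mW W0 LW]; split.
- move=> k; have [m1 m2] := mW k; have [n1 n2] := mW K.
  split; rewrite /splice; case: (k <= K)%N.
  + exact: measurableT_comp.
  + by apply: measurable_funB; [apply: measurable_funD|]; exact: measurableT_comp.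
  + exact: measurableT_comp.
  + by apply: measurable_funB; [apply: measurable_funD|]; exact: measurableT_comp.
- by move=> w; rewrite /splice leq0n; have [] := W0 w.1.
move=> A B mAB.
(* Each half of the conditions is completed by [setT], so that the law of the whole walk applies to
   both factors. *)
pose Al i := if (i < K)%N then A i else setT.
pose Bl i := if (i < K)%N then B i else setT.
pose Ar i := if (i < K)%N then setT else A i.
pose Br i := if (i < K)%N then setT else B i.
pose E (C D : nat -> set R) := \big[setI/setT]_(i < N)
              ([set w | C i (W1 i.+1 w - W1 i w)] `&` [set w | D i (W2 i.+1 w - W2 i w)]).
have mE C D : (forall i, measurable (C i) /\ measurable (D i)) -> measurable (E C D).
  move=> mCD; apply: bigsetI_measurable => i _; have [mC mD] := mCD i.
  have [m1 m2] := mW i; have [n1 n2] := mW i.+1.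
  apply: measurableI; rewrite -[X in measurable X]setTI.
    exact: (measurable_funB n1 m1).
  exact: (measurable_funB n2 m2).
rewrite (_ : \big[setI/setT]_(i < N) _ = E Al Bl `*` E Ar Br); last first.
  rewrite /E -!bigcap_seq; apply/seteqP; split => [[w1 w2]|[w1 w2]] /=.
    move=> H; split => i _; have /= [] := H i (mem_index_enum _);
      rewrite /Al /Ar /Bl /Br; case: (ltnP i K) => iK //.
      by rewrite !splice_left// ltnW.
    by rewrite !splice_sub_right// leqW.
  move=> [H1 H2] i _; have /= [] := H1 i (mem_index_enum _); have /= [] := H2 i (mem_index_enum _).
  rewrite /Al /Ar /Bl /Br; case: (ltnP i K) => iK.
    by rewrite !splice_left// ltnW.
  by rewrite !splice_sub_right// leqW.
have mAl i : measurable (Al i) /\ measurable (Bl i).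
  by rewrite /Al /Bl; case: ifP => _ //; exact: mAB.
have mAr i : measurable (Ar i) /\ measurable (Br i).
  by rewrite /Ar /Br; case: ifP => _ //; exact: mAB.
transitivity (P (E Al Bl) * P (E Ar Br))%E.
  exact: (product_measure1E P P (mE _ _ mAl) (mE _ _ mAr)).
rewrite /E !LW// -big_split/=; apply: eq_bigr => i _.
rewrite /Al /Ar /Bl /Br; case: (i < K)%N.
  by rewrite !probability_setT !mule1.
by rewrite !probability_setT !mul1e.
Qed.

(** This plays the role of the Markov property at step [K]: the inner integral is the conditional
    expectation given the first [K] steps, which are frozen in [w]. *)
Lemma lattice_decouple d (Omega : measurableType d) (P : probability Omega R) N s W1 W2 F K :
  lattice P N s W1 W2 -> cylinder N F -> (forall x y, 0 <= F x y) ->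
  (\int[P]_w (F (W1 ^~ w) (W2 ^~ w))%:E =
   \int[P]_w \int[P]_w' (F (splice K W1 ^~ (w, w')) (splice K W2 ^~ (w, w')))%:E)%E.
Proof.
move=> L cF F0; have LS := lattice_splice K L.
rewrite (lattice_law L LS cF F0).
pose G (z : Omega * Omega) := (F (splice K W1 ^~ z) (splice K W2 ^~ z))%:E.
rewrite (@fubini_tonelli1 _ _ _ _ R P P G)//; last by move=> z; rewrite lee_fin.
apply/measurable_EFinP; apply: (proj2 cF) => k; have [mS _ _] := LS; exact: mS.
Qed.

Lemma lattice_decouple_bounded d (Omega : measurableType d) (P : probability Omega R) N s W1 W2 F
    K (C : R) :
  lattice P N s W1 W2 -> cylinder N F -> (forall x y, `|F x y| <= C) ->
  \int[P]_w F (W1 ^~ w) (W2 ^~ w) =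
   \int[P]_w \int[P]_w' F (splice K W1 ^~ (w, w')) (splice K W2 ^~ (w, w')).
Proof.
move=> L cF FC; have LS := lattice_splice K L.
rewrite (lattice_law_bounded L LS cF FC).
pose G (z : Omega * Omega) := (F (splice K W1 ^~ z) (splice K W2 ^~ z))%:E.
have iG : (P \x P)%E.-integrable setT G.
  apply: bmf_integrable; split; last by exists C => z; exact: FC.
  by apply: (proj2 cF) => k; have [mS _ _] := LS; exact: mS.
have G1 w : (\int[P]_w' G (w, w'))%E =
    (\int[P]_w' F (splice K W1 ^~ (w, w')) (splice K W2 ^~ (w, w')))%:E.
  rewrite /Rintegral fineK//; apply: integrable_fin_num => //.
  apply: bmf_integrable; split; last by exists C => z; exact: FC.
  apply: (measurableT_comp (f := fun z => F (splice K W1 ^~ z) (splice K W2 ^~ z))).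
    by apply: (proj2 cF) => k; have [mS _ _] := LS; exact: mS.
  exact: measurable_pair1.
rewrite [LHS]/Rintegral -(integral12_prod_meas1 iG) /fubini_F.
by under eq_integral do rewrite G1.
Qed.
End Lattice.

(** * Brownian increments *)

Section Density.
Import HBNNSimple.
Context d (T : measurableType d) (R : realType).
Variables (mu nu : {measure set T -> \bar R}) (w : T -> R).
Hypotheses (mw : measurable_fun setT w) (w0 : forall x, 0 <= w x).
Hypothesis nuE : forall A, measurable A -> nu A = (\int[mu]_(x in A) (w x)%:E)%E.

(** Both sides are monotone limits along simple functions, and on an indicator the identity is
    [nuE]. *)
Lemma ge0_integral_density (f : T -> \bar R) :
  measurable_fun setT f -> (forall x, 0 <= f x)%E ->
  (\int[nu]_x f x = \int[mu]_x (f x * (w x)%:E))%E.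
Proof.
move=> mf f0.
pose h := nnsfun_approx measurableT mf.
have hf x : (EFin \o h n) x @[n --> \oo] --> f x by exact: cvg_nnsfun_approx.
have ndh x : nondecreasing_seq (fun n => (h n x)%:E).
  by move=> m n mn; rewrite lee_fin; exact/lefP/nd_nnsfun_approx.
transitivity (limn (fun n => \int[nu]_x (h n x)%:E))%E.
  rewrite -monotone_convergence//=.
  - by apply: eq_integral => x _; apply/esym/cvg_lim => //; exact: hf.
  - by move=> n; exact/measurable_EFinP.
  - by move=> n x _; rewrite lee_fin.
transitivity (limn (fun n => \int[mu]_x ((h n x)%:E * (w x)%:E))%E); last first.
  rewrite -monotone_convergence//=.
  - apply: eq_integral => x _; apply/cvg_lim => //; apply: cvgeZr => //; exact: hf.
  - by move=> n; apply/measurable_EFinP; apply: measurable_funM.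
  - by move=> n x _; rewrite -EFinM lee_fin mulr_ge0.
  - by move=> x _ m n mn; rewrite lee_wpmul2r ?lee_fin//; exact/lefP/nd_nnsfun_approx.
congr (limn _); apply/funext => n.
under eq_integral do rewrite fimfunE -fsumEFin//.
have hn0 y : y \in range (h n) -> 0 <= y by rewrite inE => -[x _ <-].
rewrite ge0_integral_fsum//; last 2 first.
  - by move=> y; apply/measurable_EFinP; apply: measurable_funM.
  - by move=> y x _; rewrite nnfun_muleindic_ge0.
rewrite (_ : (\int[mu]_x _)%E = (\int[mu]_x \sum_(y \in range (h n))
    ((y * \1_(h n @^-1` [set y]) x)%:E * (w x)%:E))%E); last first.
  apply: eq_integral => x _; rewrite fimfunE -fsumEFin// ge0_mule_fsuml// => y.
  exact: nnfun_muleindic_ge0.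
rewrite ge0_integral_fsum//; last 2 first.
  - move=> y; apply/measurable_EFinP; apply: measurable_funM => //.
    exact: measurable_funM.
  - by move=> y x _; rewrite mule_ge0 ?lee_fin//; exact: nnfun_muleindic_ge0.
apply: eq_fsbigr => y /hn0 y0.
have mD : measurable (h n @^-1` [set y]) by [].
transitivity (y%:E * nu (h n @^-1` [set y]))%E.
  under eq_integral do rewrite EFinM.
  by rewrite ge0_integralZl// ?integral_indic// ?setIT//; exact/measurable_EFinP.
rewrite nuE//; under [RHS]eq_integral do rewrite EFinM -muleA.
rewrite ge0_integralZl//; last 2 first.
  - by apply/measurable_EFinP; apply: measurable_funM.
  - by move=> x _; rewrite -EFinM lee_fin mulr_ge0.
congr (_ * _)%E; rewrite integral_mkcond; apply: eq_integral => x _.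
rewrite patchE indicE; case: ifP => _; first by rewrite mul1e.
by rewrite mul0e.
Qed.
End Density.

Section Affine.
Context (R : realType).
Local Notation mu := (@lebesgue_measure R).

Lemma measurable_affine (c b : R) : measurable_fun setT (fun x : R => c * x + b).
Proof. by apply: measurable_funD => //; apply: measurable_funM. Qed.

(** Multiplied by [c], the image of Lebesgue measure under the affine map gives every half-open
    interval its length, and these lengths determine the measure. *)
Lemma lebesgue_affine (c b : R) (f : R -> \bar R) : 0 < c ->
  measurable_fun setT f -> (forall x, 0 <= f x)%E ->
  (\int[mu]_x f x = c%:E * \int[mu]_x f (c * x + b)%R)%E.
Proof.
move=> c0 mf f0.
have mg : measurable_fun setT ((fun x : R => c * x + b) : measurableTypeR R -> measurableTypeR R).
  exact: measurable_affine.
pose g := mfun_Sub (mem_set mg).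
have cge : 0 <= c by exact: ltW.
pose m' : {measure set (measurableTypeR R) -> \bar R} :=
  mscale (NngNum cge) (pushforward mu (g : _ -> measurableTypeR R)).
pose m := m' mg.
have mE A : measurable A -> mu A = m A.
  move=> mA; apply: (lebesgue_measure_unique (mu := m)) => //.
  move=> D [[x y]] _ <-.
  rewrite [RHS](_ : _ = c%:E * mu ((fun z => c * z + b)%R @^-1` `]x, y]))%E//.
  rewrite (_ : _ @^-1` _ = `](x - b) / c, (y - b) / c]%classic); last first.
    by apply/seteqP; split => z /=; rewrite !in_itv/= ltr_pdivrMr// ler_pdivlMr// ltrBlDr lerBrDr mulrC.
  rewrite !lebesgue_measure_itv/= !lte_fin ltr_pM2r ?invr_gt0// ltrD2r.
  case: ifP => _; last by rewrite mule0.
  by rewrite -!EFinB -EFinM; congr EFin; field; rewrite gt_eqF.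
rewrite -[X in (c%:E * X)%E](@ge0_integral_pushforward _ _ (measurableTypeR R) (measurableTypeR R) R g _ mu setT f)//.
rewrite -(ge0_integral_mscale _ _ (NngNum cge))//.
by apply: eq_measure_integral => A mA _; exact: mE.
Qed.

Lemma normal_pdf_scale (r s x : R) : 0 < r -> 0 < s ->
  r * normal_pdf 0 s (r * x) = normal_pdf 0 (s / r) x.
Proof.
move=> r0 s0; have rn : r != 0 by rewrite gt_eqF.
have sn : s != 0 by rewrite gt_eqF.
rewrite !normal_pdfE ?mulf_neq0 ?invr_neq0// /normal_peak /normal_fun !subr0 mulrA.
congr (_ * expR _).
  rewrite (_ : (s / r) ^+ 2 * pi *+ 2 = r ^- 2 * (s ^+ 2 * pi *+ 2)); last by field.
  rewrite sqrtrM ?invr_ge0 ?exprn_ge0 ?ltW// invfM; congr (_ * _).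
  by rewrite -exprVn sqrtr_sqr ger0_norm ?invrK// invr_ge0 ltW.
by field; rewrite rn sn.
Qed.

Lemma normal_prob_scale (r s : R) (A : set R) : 0 < r -> 0 < s -> measurable A ->
  normal_prob 0 (s / r) [set x | A (r * x)] = normal_prob 0 s A.
Proof.
move=> r0 s0 mA; rewrite /normal_prob.
have E q (C : set R) : (\int[mu]_(x in C) (normal_pdf 0 q x)%:E =
    \int[mu]_x (normal_pdf 0 q x * \1_C x)%:E)%E.
  rewrite integral_mkcond; apply: eq_integral => x _; rewrite patchE indicE.
  by case: ifP => _; rewrite ?mulr1 ?mulr0.
rewrite !E [RHS](@lebesgue_affine r 0)//; last 2 first.
- apply/measurable_EFinP; apply: measurable_funM; first exact: measurable_normal_pdf.
  exact: measurable_indic.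
- by move=> x; rewrite lee_fin mulr_ge0// normal_pdf_ge0.
rewrite -ge0_integralZl//; last 3 first.
- apply/measurable_EFinP; apply: (measurableT_comp (f := fun x => normal_pdf 0 s x * \1_A x)).
    by apply: measurable_funM; [exact: measurable_normal_pdf|exact: measurable_indic].
  exact: measurable_affine.
- by move=> x _; rewrite lee_fin mulr_ge0// normal_pdf_ge0.
- by rewrite lee_fin ltW.
apply: eq_integral => x _; rewrite addr0 -EFinM mulrA normal_pdf_scale// !indicE.
Qed.

(** The density at [(x, y)] of a planar Brownian increment over a time span [a]. *)
Definition heat (a x y : R) : R := (pi *+ 2 * a)^-1 * expR (- (x ^+ 2 + y ^+ 2) / (a *+ 2)).

Lemma normal_pdf_heat (a x y : R) : 0 < a ->
  normal_pdf 0 (Num.sqrt a) x * normal_pdf 0 (Num.sqrt a) y = heat a x y.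
Proof.
move=> a0; rewrite !normal_pdfE ?gt_eqF ?sqrtr_gt0// /normal_peak /normal_fun !subr0.
rewrite sqr_sqrtr ?ltW// mulrACA -expRD; congr (_ * expR _).
  by rewrite -invfM -expr2 sqr_sqrtr ?mulrn_wge0 ?mulr_ge0 ?pi_ge0 ?ltW//; congr _^-1; ring.
by rewrite -mulrDl opprD.
Qed.

Lemma heat_ge0 (a x y : R) : 0 < a -> 0 <= heat a x y.
Proof. by move=> a0; rewrite /heat mulr_ge0 ?expR_ge0// invr_ge0 ltW// mulr_gt0// mulrn_wgt0// pi_gt0. Qed.

Lemma measurable_heat (a : R) d (T : measurableType d) (f g : T -> R) :
  measurable_fun setT f -> measurable_fun setT g ->
  measurable_fun setT (fun z => heat a (f z) (g z)).
Proof.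
move=> mf mg; apply: measurable_funM => //; apply: measurableT_comp => //.
apply: measurable_funM => //; apply: measurableT_comp => //.
by apply: measurable_funD; apply: measurable_funX.
Qed.

End Affine.

Section BrownianLattice.
Context (R : realType) d (Omega : measurableType d) (P : probability Omega R).
Implicit Types X : R -> Omega -> R.

Lemma BM_lattice X1 X2 (h : R) N : planar_BM P X1 X2 -> 0 < h ->
  lattice P N (Num.sqrt h) (fun k => X1 (k%:R * h)) (fun k => X2 (k%:R * h)).
Proof.
move=> [mX X0 _ LX] h0; split.
- by move=> k; exact: mX.
- by move=> w; rewrite mul0r.
move=> A B mAB; have := LX N (fun k => k%:R * h) A B (mul0r _) _ mAB.
have E i : i.+1%:R * h - i%:R * h = h by rewrite -natr1; ring.
move=> -> => [|i _]; last by rewrite -subr_gt0 E.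
by apply: eq_bigr => i _; rewrite E.
Qed.

(** Freezing the path at its value at 0 for negative times turns continuity on the half-line into
    continuity on the line, which composes without side conditions. *)
Lemma within_continuous_max0 (f : R -> R) :
  {within `[0, +oo[, continuous f} <-> continuous (fun t : R => f (Num.max 0 t)).
Proof.
split.
  move=> /subspace_continuousP fc t.
  have m0 : `[0, +oo[%classic (Num.max 0 t) by rewrite /= in_itv/= le_max lexx.
  move=> U /(fc _ m0) fU.
  have {}fU : nbhs (Num.max 0 t) (fun y => `[0, +oo[%classic y -> U (f y)) by exact: fU.
  have cm : (fun t : R => Num.max 0 t) z @[z --> t] --> Num.max 0 t.
    by apply: continuous_max => //; exact: cvg_cst.
  have : \forall z \near t, U (f (Num.max 0 z)); last by [].
  near=> z.
  have : `[0, +oo[%classic (Num.max 0 z) -> U (f (Num.max 0 z)) by near: z; exact: (cm _ fU).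
  by apply; rewrite /= in_itv/= le_max lexx.
move=> fc; apply/subspace_continuousP => x /=; rewrite in_itv/= andbT => x0 U.
have fx : f x = f (Num.max 0 x) by rewrite max_r.
rewrite [X in nbhs X]fx => fU.
have : \forall z \near x, `[0, +oo[%classic z -> U (f z); last by [].
near=> z; rewrite /= in_itv/= andbT => z0.
rewrite -(max_r z0); near: z; exact: (fc _ _ fU).
Unshelve. all: by end_near. Qed.

Lemma sqrt_div_sqr (s r : R) : 0 <= s -> 0 < r -> Num.sqrt (s / r ^+ 2) = Num.sqrt s / r.
Proof.
by move=> s0 r0; rewrite sqrtrM// sqrtrV ?sqr_ge0// sqrtr_sqr gtr0_norm.
Qed.

(** The Markov property at time [a] together with Brownian scaling; the two combined turn a time
    block into a Brownian motion on unit time. *)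
Lemma BM_restart X1 X2 (a r : R) : planar_BM P X1 X2 -> 0 <= a -> 0 < r ->
  planar_BM P (fun t w => r * (X1 (a + t / r ^+ 2) w - X1 a w))
              (fun t w => r * (X2 (a + t / r ^+ 2) w - X2 a w)).
Proof.
move=> [mX X0 cX LX] a0 r0.
have r2 : 0 < r ^+ 2 by rewrite exprn_gt0.
have cres X w : {within `[0, +oo[, continuous (X ^~ w)} ->
   {within `[0, +oo[, continuous (fun t => r * (X (a + t / r ^+ 2) w - X a w))}.
  move=> /within_continuous_max0 cXw; apply/within_continuous_max0 => t.
  apply: cvgM; [exact: cvg_cst|apply: cvgB; last exact: cvg_cst].
  have E s : a + Num.max 0 s / r ^+ 2 = Num.max 0 (a + Num.max 0 s / r ^+ 2).
    by rewrite [RHS]max_r// addr_ge0// divr_ge0 ?le_max ?lexx// ltW.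
  under eq_fun do rewrite E; rewrite E.
  apply: (cvg_comp (fun s => a + Num.max 0 s / r ^+ 2) (fun s => X (Num.max 0 s) w) _ (cXw _)).
  apply: cvgD; [exact: cvg_cst|apply: cvgM; last exact: cvg_cst].
  by apply: continuous_max => //; exact: cvg_cst.
split.
- by move=> t; split; apply: measurable_funM => //; apply: measurable_funB;
    solve [exact: (mX _).1 | exact: (mX _).2].
- by move=> w; rewrite mul0r addr0 !subrr mulr0.
- by move=> w; have [c1 c2] := cX w; split; exact: cres.
move=> n t A B t0 tS mAB.
have rsc (s : R) (C : set R) : 0 < s -> measurable C ->
    normal_prob 0 (Num.sqrt (s / r ^+ 2)) [set x | C (r * x)] = normal_prob 0 (Num.sqrt s) C.
  move=> s0 mC; rewrite (sqrt_div_sqr (ltW s0) r0) normal_prob_scale; [by []|by []| |by []].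
  by rewrite sqrtr_gt0.
have mr (C : set R) : measurable C -> measurable [set x | C (r * x)].
  by move=> mC; rewrite -[X in measurable X]setTI;
    have : measurable_fun setT (fun x : R => r * x) by [exact: measurable_funM]; exact.
pose A' i := [set x | A i (r * x)]; pose B' i := [set x | B i (r * x)].
have mAB' i : measurable (A' i) /\ measurable (B' i) by have [? ?] := mAB i; split; exact: mr.
have dt i : a + t i.+1 / r ^+ 2 - (a + t i / r ^+ 2) = (t i.+1 - t i) / r ^+ 2 by ring.
have EX X i w : r * (X (a + t i.+1 / r ^+ 2) w - X a w) - r * (X (a + t i / r ^+ 2) w - X a w)
   = r * (X (a + t i.+1 / r ^+ 2) w - X (a + t i / r ^+ 2) w) by ring.
transitivity (P (\big[setI/setT]_(i < n)
   ([set w | A' i (X1 (a + t i.+1 / r ^+ 2) w - X1 (a + t i / r ^+ 2) w)] `&`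
    [set w | B' i (X2 (a + t i.+1 / r ^+ 2) w - X2 (a + t i / r ^+ 2) w)]))).
  congr (P _); apply: eq_bigr => i _.
  by apply/seteqP; split => w /=; rewrite /A' /B' /= !EX.
transitivity (\prod_(i < n) (normal_prob 0 (Num.sqrt ((t i.+1 - t i) / r ^+ 2)) (A' i) *
   normal_prob 0 (Num.sqrt ((t i.+1 - t i) / r ^+ 2)) (B' i)))%E; last first.
  apply: eq_bigr => i _; have [? ?] := mAB i.
  by rewrite !rsc// subr_gt0; exact: tS.
move: a0; rewrite le_eqVlt => /predU1P[a0|a0].
  have H0 : a + t 0%N / r ^+ 2 = 0 by rewrite t0 mul0r addr0.
  have HS i : (i < n)%N -> a + t i / r ^+ 2 < a + t i.+1 / r ^+ 2.
    by move=> ni; rewrite ltrD2l ltr_pM2r ?invr_gt0//; exact: tS.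
  rewrite (LX n (fun i => a + t i / r ^+ 2) A' B' H0 HS mAB').
  by apply: eq_bigr => i _; rewrite dt.
(* The time grid in [planar_BM] has to start at 0, so for [0 < a] the interval from 0 to [a] is put
   in front with the sure event. *)
pose t' i := if i is j.+1 then a + t j / r ^+ 2 else 0.
pose A'' i := if i is j.+1 then A' j else setT.
pose B'' i := if i is j.+1 then B' j else setT.
have HS i : (i < n.+1)%N -> t' i < t' i.+1.
  case: i => [_|i]/=; first by rewrite t0 mul0r addr0.
  by rewrite ltnS => ni; rewrite ltrD2l ltr_pM2r ?invr_gt0//; exact: tS.
have mAB'' i : measurable (A'' i) /\ measurable (B'' i).
  by case: i => [|i]; [split; exact: measurableT|exact: mAB'].
have := LX n.+1 t' A'' B'' erefl HS mAB''.
rewrite !big_ord_recl /= !probability_setT !mul1e.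
have ST : [set _ : Omega | True] = setT by [].
rewrite ST !setTI => H; etransitivity; first exact: H.
by apply: eq_bigr => i _; rewrite -[bump 0 i]/(i.+1) -[(0 + i)%N]/(nat_of_ord i) dt.
Qed.

(** On rectangles the increment has the law of two independent Gaussians, read off from one step of
    the motion restarted at [u]. Rectangles determine the law, and the two densities multiply to
    [heat]. *)
Lemma BM_increment X1 X2 (u s : R) (Phi : R * R -> \bar R) :
  planar_BM P X1 X2 -> 0 <= u -> u < s ->
  measurable_fun setT Phi -> (forall z, 0 <= Phi z)%E ->
  (\int[P]_w Phi (X1 s w - X1 u w, X2 s w - X2 u w)%R =
   \int[lebesgue_measure]_x \int[lebesgue_measure]_y (Phi (x, y) * (heat (s - u) x y)%:E))%E.
Proof.
move=> BX u0 us mPhi Phi0; set a := s - u.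
have a0 : 0 < a by rewrite subr_gt0.
have ua : u + a = s by rewrite /a; ring.
have [mX _ _ _] := BX.
have [_ _ _ LX] := BM_restart BX u0 (@ltr01 R).
pose V w := (X1 s w - X1 u w, X2 s w - X2 u w).
have mV : measurable_fun setT V.
  apply/measurable_fun_pair; apply: measurable_funB;
    solve [exact: (mX _).1 | exact: (mX _).2].
pose N : probability (measurableTypeR R) R := normal_prob 0 (Num.sqrt a).
have rect A B : measurable A -> measurable B -> P (V @^-1` (A `*` B)) = (N A * N B)%E.
  move=> mA mB.
  have := LX 1%N (fun i => i%:R * a) (fun=> A) (fun=> B) (mul0r _) _ (fun=> conj mA mB).
  rewrite !big_ord1 /= !mul1r !mul0r subr0 expr1n !divr1 addr0 => <-.
    by congr (P _); apply/seteqP; split => w /=; rewrite ua !mul1r !subrr !subr0.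
  by move=> i; rewrite ltnS leqn0 => /eqP ->; rewrite mul0r mul1r.
pose RR := (measurableTypeR R * measurableTypeR R)%type.
have mV' : measurable_fun setT (V : Omega -> RR) := mV.
have mPhi' : measurable_fun setT (Phi : RR -> \bar R) := mPhi.
pose Vm := mfun_Sub (mem_set mV').
rewrite -[LHS](@ge0_integral_pushforward _ _ _ RR R Vm _ P setT Phi)//.
transitivity (\int[(N \x N)%E]_z Phi z)%E.
  apply: eq_measure_integral => A mA _; apply/esym.
  by apply: product_measure_unique; [move=> A' B' mA' mB'; exact: rect|].
rewrite (@fubini_tonelli1 _ _ _ _ R N N Phi)//.
have mpdf := measurable_normal_pdf 0 (Num.sqrt a).
rewrite (ge0_integral_density (mu := lebesgue_measure) mpdf)//; last 3 first.
- by move=> x; exact: normal_pdf_ge0.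
- exact: measurable_fun_fubini_tonelli_F.
- by move=> x; exact: integral_ge0.
apply: eq_integral => x _; rewrite /fubini_F.
rewrite (ge0_integral_density (mu := lebesgue_measure) mpdf)//; last 2 first.
- by move=> z; exact: normal_pdf_ge0.
- exact: measurableT_comp.
rewrite -ge0_integralZr//; last 3 first.
- apply: emeasurable_funM; first exact: measurableT_comp.
  exact/measurable_EFinP.
- by move=> y _; rewrite mule_ge0// lee_fin normal_pdf_ge0.
- by rewrite lee_fin normal_pdf_ge0.
apply: eq_integral => y _; rewrite -muleA -EFinM mulrC normal_pdf_heat//.
Qed.

End BrownianLattice.

(** * Integrals over the plane against the heat kernel *)

Section Plane.
Context (R : realType).
Local Notation mu := (@lebesgue_measure R).
Local Notation mu2 := (mu \x mu)%E.

Lemma measurable_curry_plane (g : R * R -> \bar R) (c b1 b2 : R) :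
  measurable_fun setT g ->
  measurable_fun setT (fun z : R * R => g (c * z.1 + b1, c * z.2 + b2)).
Proof.
move=> mg; apply: measurableT_comp => //.
by apply/measurable_fun_pair; apply: measurable_funD => //; apply: measurable_funM.
Qed.

Lemma plane_fubini (g : R * R -> \bar R) :
  measurable_fun setT g -> (forall z, 0 <= g z)%E ->
  (\int[mu2]_z g z = \int[mu]_x \int[mu]_y g (x, y))%E.
Proof. by move=> mg g0; rewrite (@fubini_tonelli1 _ _ _ _ R mu mu g). Qed.

Lemma plane_affine (c b1 b2 : R) (g : R * R -> \bar R) : 0 < c ->
  measurable_fun setT g -> (forall z, 0 <= g z)%E ->
  (\int[mu2]_z g z = (c ^+ 2)%:E * \int[mu2]_z g (c * z.1 + b1, c * z.2 + b2)%R)%E.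
Proof.
move=> c0 mg g0.
have mg' : measurable_fun setT (fun z : R * R => g (c * z.1 + b1, c * z.2 + b2)%R).
  exact: measurable_curry_plane.
rewrite plane_fubini// (plane_fubini mg')//=.
have mG : measurable_fun setT (fun x => \int[mu]_y g (x, y))%E.
  exact: (measurable_fun_fubini_tonelli_F (m2 := mu)).
have G0 x : (0 <= \int[mu]_y g (x, y))%E by exact: integral_ge0.
rewrite (lebesgue_affine b1 c0 mG G0).
have E x : (\int[mu]_y g (c * x + b1, y)%R =
    c%:E * \int[mu]_y g (c * x + b1, c * y + b2)%R)%E.
  by apply: (@lebesgue_affine _ c b2 (fun y => g (c * x + b1, y)%R)) => //; exact: measurableT_comp.
under eq_integral do rewrite E.
rewrite ge0_integralZl//; last 3 first.
- exact: (measurable_fun_fubini_tonelli_F (m2 := mu) _ mg').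
- by move=> x _; exact: integral_ge0.
- by rewrite lee_fin ltW.
by rewrite muleA -EFinM expr2.
Qed.

(** The moments enter as upper bounds. They measure the distance of [f] from a point mass at the
    origin; for a kernel of range [eps] they shrink like [eps] and [eps ^+ 2]. *)
Definition dens (f : R -> R -> R) (m1 m2 : R) : Prop :=
  [/\ continuous (fun p : R * R => f p.1 p.2),
      (forall x y, 0 <= f x y) /\ (exists B, forall x y, f x y <= B),
      (\int[mu2]_z (f z.1 z.2)%:E = 1)%E,
      (\int[mu2]_z (f z.1 z.2 * (`|z.1| + `|z.2|))%:E <= m1%:E)%E &
      (\int[mu2]_z (f z.1 z.2 * (z.1 ^+ 2 + z.2 ^+ 2))%:E <= m2%:E)%E].

(** Measurability refers to the product sigma-algebra. Rounding the first coordinate down to a grid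
    makes preimages countable unions of rectangles, and [f] is the pointwise limit of these
    approximants. *)
Lemma continuous_plane_measurable (f : R -> R -> R) :
  continuous (fun p : R * R => f p.1 p.2) -> measurable_fun setT (fun p : R * R => f p.1 p.2).
Proof.
move=> cf.
pose r (n : nat) (x : R) : R := (Num.floor (n.+1%:R * x))%:~R / n.+1%:R.
pose h (n : nat) (p : R * R) := f (r n p.1) p.2.
have mfl n (m : int) : measurable [set x : R | Num.floor (n.+1%:R * x) = m].
  rewrite (_ : [set x | _] = `[m%:~R / n.+1%:R, (m + 1)%:~R / n.+1%:R[%classic)//.
  apply/seteqP; split => x /=; rewrite in_itv/= ler_pdivrMr// ltr_pdivlMr// mulrC.
    by move=> <-; rewrite floor_le floorD1_gt.
  by move=> H; apply: floor_def.
have mh n : measurable_fun setT (h n).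
  move=> _ A mA; rewrite setTI.
  have my (x : R) : measurable_fun setT (f x).
    apply: continuous_measurable_fun => y.
    have fa : (fun _ : R => x) z @[z --> y] --> x by exact: cvg_cst.
    have fb : z @[z --> y] --> y by exact: cvg_id.
    exact: (cvg_comp _ (fun p => f p.1 p.2) (cvg_pair fa fb) (cf (x, y))).
  rewrite (_ : h n @^-1` A = \bigcup_(k : nat)
     (if unpickle k is Some m then
       [set x : R | Num.floor (n.+1%:R * x) = m] `*` (f (m%:~R / n.+1%:R) @^-1` A)
      else set0)).
    apply: bigcup_measurable => k _; case: unpickle => // m.
    apply: measurableX; first exact: mfl.
    by rewrite -[X in measurable X]setTI; exact: my.
  apply/seteqP; split => [[x y]|[x y]].
    move=> H; set m := Num.floor (n.+1%:R * x).
    by exists (pickle m); [exact: I|rewrite pickleK; split].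
  by move=> [k _]; case: unpickle => // m [/= xm]; rewrite /h /r /= xm.
apply: (measurable_fun_cvg mh) => -[x y] _ /=.
have rx : r n x @[n --> \oo] --> x.
  apply/cvgrPdist_le => e e0; near=> n.
  have n0 : 0 < n.+1%:R :> R by [].
  rewrite /r (_ : x - _ = (n.+1%:R * x - (Num.floor (n.+1%:R * x))%:~R) / n.+1%:R); last by field; rewrite gt_eqF.
  have := floor_itv (n.+1%:R * x); rewrite intrD => /andP[f1 f2].
  rewrite ger0_norm ?divr_ge0 ?subr_ge0// ler_pdivrMr//.
  rewrite (@le_trans _ _ 1)//; first by rewrite lerBlDl ltW.
  near: n; apply: filterS (near_infty_natSinv_lt (PosNum e0)) => n /= ne.
  by rewrite -ler_pdivrMr// mul1r ltW.
have fb : (fun _ : nat => y) n @[n --> \oo] --> y by exact: cvg_cst.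
exact: (cvg_comp _ (fun p => f p.1 p.2) (cvg_pair rx fb) (cf (x, y))).
Unshelve. all: by end_near. Qed.

Lemma measurable_plane_comp d (T : measurableType d) (f : R -> R -> R) (g1 g2 : T -> R) :
  measurable_fun setT (fun p : R * R => f p.1 p.2) ->
  measurable_fun setT g1 -> measurable_fun setT g2 ->
  measurable_fun setT (fun z => f (g1 z) (g2 z)).
Proof.
move=> mf mg1 mg2.
have mp : measurable_fun setT (fun z => (g1 z, g2 z)) by apply/measurable_fun_pair.
exact: (measurableT_comp mf mp).
Qed.

Lemma dens_measurable f m1 m2 : dens f m1 m2 -> measurable_fun setT (fun p : R * R => f p.1 p.2).
Proof. by case=> cf *; exact: continuous_plane_measurable. Qed.

Lemma dens_integrable_bounded f m1 m2 (h : R * R -> R) (K : R) : dens f m1 m2 ->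
  measurable_fun setT h -> (forall z, `|h z| <= K) ->
  mu2.-integrable setT (fun z => (f z.1 z.2 * h z)%:E).
Proof.
move=> df mh hK; have mf := dens_measurable df; have [_ [f0 _] f1 _ _] := df.
have K0 : 0 <= K by exact: le_trans (hK (0, 0)).
apply/integrableP; split; first by apply/measurable_EFinP; apply: measurable_funM.
apply: (@le_lt_trans _ _ (\int[mu2]_z (K%:E * (f z.1 z.2)%:E)))%E; last first.
  by rewrite ge0_integralZl//; [rewrite f1 mule1 ltry|exact/measurable_EFinP|move=> *; rewrite lee_fin].
apply: ge0_le_integral => //.
- by apply/measurable_EFinP; apply: measurableT_comp => //; apply: measurable_funM.
- by apply/measurable_EFinP; apply: measurable_funM.
- by move=> z _; rewrite -EFinM lee_fin normrM (ger0_norm (f0 _ _)) mulrC ler_wpM2r.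
Qed.

Lemma dens_integral_cst f m1 m2 (K : R) : dens f m1 m2 ->
  \int[mu2]_z (f z.1 z.2 * K) = K.
Proof.
move=> df; have [_ [f0 _] f1 _ _] := df.
have n1 (z : R * R) : `|cst 1 z| <= 1 :> R by rewrite normr1.
have := dens_integrable_bounded df (@measurable_cst _ _ _ _ setT (1 : R)) n1.
under eq_fun do rewrite mulr1; move=> fi.
by rewrite RintegralZr// [X in X * _]/Rintegral f1 mul1r.
Qed.

Lemma dens_moment1 f m1 m2 : dens f m1 m2 ->
  mu2.-integrable setT (fun z => (f z.1 z.2 * (`|z.1| + `|z.2|))%:E) /\
  0 <= \int[mu2]_z (f z.1 z.2 * (`|z.1| + `|z.2|)) <= m1.
Proof.
move=> df; have mf := dens_measurable df; have [_ [f0 _] f1 fm1 _] := df.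
have g0 z : 0 <= f z.1 z.2 * (`|z.1| + `|z.2|) by rewrite mulr_ge0 ?addr_ge0.
have fi : mu2.-integrable setT (fun z => (f z.1 z.2 * (`|z.1| + `|z.2|))%:E).
  apply/integrableP; split.
    by apply/measurable_EFinP; apply: measurable_funM => //; apply: measurable_funD;
      apply: measurableT_comp.
  under eq_integral do rewrite /= ger0_norm//.
  by apply: le_lt_trans fm1 _; rewrite ltry.
split=> //; apply/andP; split; first by apply: Rintegral_ge0.
by rewrite -lee_fin /Rintegral fineK//; exact: integrable_fin_num.
Qed.

Lemma dens_moment2 f m1 m2 : dens f m1 m2 ->
  mu2.-integrable setT (fun z => (f z.1 z.2 * (z.1 ^+ 2 + z.2 ^+ 2))%:E) /\
  0 <= \int[mu2]_z (f z.1 z.2 * (z.1 ^+ 2 + z.2 ^+ 2)) <= m2.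
Proof.
move=> df; have mf := dens_measurable df; have [_ [f0 _] f1 _ fm2] := df.
have g0 z : 0 <= f z.1 z.2 * (z.1 ^+ 2 + z.2 ^+ 2) by rewrite mulr_ge0 ?addr_ge0// sqr_ge0.
have fi : mu2.-integrable setT (fun z => (f z.1 z.2 * (z.1 ^+ 2 + z.2 ^+ 2))%:E).
  apply/integrableP; split.
    by apply/measurable_EFinP; apply: measurable_funM => //; apply: measurable_funD;
      apply: measurable_funX.
  under eq_integral do rewrite /= ger0_norm//.
  by apply: le_lt_trans fm2 _; rewrite ltry.
split=> //; apply/andP; split; first by apply: Rintegral_ge0.
by rewrite -lee_fin /Rintegral fineK//; exact: integrable_fin_num.
Qed.

Lemma heat_le a x y : 0 < a -> heat a x y <= (pi *+ 2 * a)^-1 :> R.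
Proof.
move=> a0; rewrite /heat ler_piMr//.
  by rewrite invr_ge0 ltW// mulr_gt0// mulrn_wgt0// pi_gt0.
rewrite -expR0 ler_expR mulNr oppr_le0; apply: divr_ge0; first by rewrite addr_ge0 ?sqr_ge0.
by rewrite pmulrn_lge0// ltW.
Qed.

Lemma heat_ge a x y : 0 < a ->
  (pi *+ 2 * a)^-1 * (1 - (x ^+ 2 + y ^+ 2) / (a *+ 2)) <= heat a x y :> R.
Proof.
move=> a0; rewrite /heat ler_wpM2l//; first by rewrite invr_ge0 ltW// mulr_gt0// mulrn_wgt0// pi_gt0.
by rewrite mulNr expR_ge1Dx.
Qed.

(** For 0 <= s <= t with t - s < 1 the difference is at most exp(-s^2) (t - s) (2 s + (t - s)), and
    2 s exp(-s^2) <= 1 because 1 + s^2 >= 2 s. *)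
Lemma gauss_lip (s t : R) : `|expR (- s ^+ 2) - expR (- t ^+ 2)| <= 2 * `|s - t|.
Proof.
wlog st : s t / `|s| <= `|t|.
  move=> H; case: (leP `|s| `|t|) => st; first exact: H.
  by rewrite distrC (distrC s); apply: H; exact: ltW.
rewrite -(real_normK (num_real s)) -(real_normK (num_real t)).
apply: (@le_trans _ _ (2 * (`|t| - `|s|))); last first.
  by rewrite ler_pM2l// distrC; have := lerB_dist t s.
move: st; move: (normr_ge0 s); move: `|s| `|t| => {s t} s t s0 st.
rewrite ger0_norm ?subr_ge0 ?ler_expR ?lerN2 ?ler_pXn2r ?nnegrE//; last exact: le_trans st.
have e1 : expR (- s ^+ 2) <= 1 by rewrite -expR0 ler_expR oppr_le0 sqr_ge0.
have e0 := expR_ge0 (- t ^+ 2).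
have [ts|ts] := leP 1 (t - s); first by lra.
have -> : expR (- t ^+ 2) = expR (- s ^+ 2) * expR (- (t ^+ 2 - s ^+ 2)).
  by rewrite -expRD; congr expR; ring.
rewrite -{1}(mulr1 (expR _)) -mulrBr.
have E : 1 - expR (- (t ^+ 2 - s ^+ 2)) <= (t - s) * (2 * s + (t - s)).
  by have := expR_ge1Dx (- (t ^+ 2 - s ^+ 2)); nra.
have sE : 2 * s * expR (- s ^+ 2) <= 1.
  have HE : expR (s ^+ 2) * expR (- s ^+ 2) = 1 by rewrite -expRD subrr expR0.
  rewrite -[leRHS]HE ler_wpM2r ?expR_ge0// (le_trans _ (expR_ge1Dx _))//.
  by rewrite -subr_ge0 (_ : _ - _ = (s - 1) ^+ 2) ?sqr_ge0//; ring.
have G0 := expR_ge0 (- s ^+ 2).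
have d0 : 0 <= t - s by rewrite subr_ge0.
have h0 := ler_wpM2l G0 E.
have h1 := ler_wpM2l d0 sE.
have h2 : (t - s) * ((t - s) * expR (- s ^+ 2)) <= (t - s) * 1.
  by rewrite ler_wpM2l// mulr_ile1// ltW.
apply: (le_trans h0); rewrite [leLHS](_ : _ = (t - s) * (2 * s * expR (- s ^+ 2))
  + (t - s) * ((t - s) * expR (- s ^+ 2))); last by ring.
by rewrite [leRHS](_ : _ = (t - s) * 1 + (t - s) * 1); [exact: lerD|ring].
Qed.

Lemma heat_lip a x y x' y' : 0 < a ->
  `|heat a x y - heat a x' y'| <=
  (pi *+ 2 * a)^-1 * (2 / Num.sqrt a) * (`|x - x'| + `|y - y'|) :> R.
Proof.
move=> a0; have sa : 0 < Num.sqrt a by rewrite sqrtr_gt0.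
have k0 : 0 <= (pi *+ 2 * a)^-1 :> R by rewrite invr_ge0 ltW// mulr_gt0// mulrn_wgt0// pi_gt0.
pose c : R := (Num.sqrt (a *+ 2))^-1.
have c2 : c ^+ 2 = (a *+ 2)^-1 by rewrite exprVn sqr_sqrtr// mulrn_wge0// ltW.
have c0 : 0 <= c by rewrite invr_ge0 sqrtr_ge0.
have ca : c <= (Num.sqrt a)^-1.
  rewrite lef_pV2 ?posrE ?sqrtr_gt0 ?mulrn_wgt0//.
  by rewrite ler_wsqrtr// mulr2n lerDl ltW.
have E u v : heat a u v = (pi *+ 2 * a)^-1 * (expR (- (c * u) ^+ 2) * expR (- (c * v) ^+ 2)).
  by rewrite /heat -expRD; congr (_ * expR _); rewrite !exprMn c2; ring.
rewrite !E -mulrBr normrM (ger0_norm k0) -mulrA ler_wpM2l//.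
have le1 u : expR (- (c * u) ^+ 2) <= 1 by rewrite -expR0 ler_expR oppr_le0 sqr_ge0.
rewrite (_ : _ - _ = (expR (- (c * x) ^+ 2) - expR (- (c * x') ^+ 2)) * expR (- (c * y) ^+ 2)
  + expR (- (c * x') ^+ 2) * (expR (- (c * y) ^+ 2) - expR (- (c * y') ^+ 2))); last by ring.
apply: (le_trans (ler_normD _ _)); rewrite [leRHS]mulrDr; apply: lerD.
- rewrite normrM [X in _ * X]ger0_norm ?expR_ge0//.
  rewrite (le_trans (ler_piMr _ (le1 _)))// (le_trans (gauss_lip _ _))//.
  by rewrite -mulrBr normrM (ger0_norm c0) mulrA ler_wpM2r// ler_wpM2l.
- rewrite normrM [X in X * _]ger0_norm ?expR_ge0//.
  rewrite (le_trans (ler_piMl _ (le1 _)))// (le_trans (gauss_lip _ _))//.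
  by rewrite -mulrBr normrM (ger0_norm c0) mulrA ler_wpM2r// ler_wpM2l.
Qed.

(** With drift [v] the increment sits near [v * a], so its density near the origin is small. Let A =
    v^2 a and z = v x. If z >= A / 2, the polynomial factor alone is large enough; otherwise the
    exponent [Q] is at least A / 8 and exp(-Q) <= 1 / (1 + Q) suffices. *)
Lemma tilted_gauss_decay (a v x y : R) : 0 < a -> 0 < v -> 1 <= v ^+ 2 * a ->
  expR (- ((x - v * a) ^+ 2 + y ^+ 2) / (a *+ 2)) <=
  8 / (v ^+ 2 * a) * (1 + v ^+ 2 * (x ^+ 2 + y ^+ 2)).
Proof.
move=> a0 v0 va; have v2 : 0 < v ^+ 2 by rewrite exprn_gt0.
set Q := ((x - v * a) ^+ 2 + y ^+ 2) / (a *+ 2).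
have q0 : 0 <= Q.
  by apply: divr_ge0; [rewrite addr_ge0 ?sqr_ge0|rewrite pmulrn_lge0// ltW].
have Q1 : 0 < 1 + Q by rewrite ltr_pwDl.
have e1 : expR (- ((x - v * a) ^+ 2 + y ^+ 2) / (a *+ 2)) <= (1 + Q)^-1.
  by rewrite mulNr expRN lef_pV2 ?posrE ?expR_gt0 ?expR_ge1Dx.
apply: (le_trans e1); rewrite -[leLHS]mul1r ler_pdivrMr//.
have A0 : 0 < v ^+ 2 * a by rewrite mulr_gt0.
rewrite [leRHS](_ : _ = 8 * (1 + v ^+ 2 * (x ^+ 2 + y ^+ 2)) * (1 + Q) / (v ^+ 2 * a)); last by ring.
rewrite ler_pdivlMr// mul1r.
have y2 : 0 <= v ^+ 2 * y ^+ 2 by rewrite mulr_ge0 ?sqr_ge0.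
have QE : (v * x - v ^+ 2 * a) ^+ 2 / (2 * (v ^+ 2 * a)) <= Q.
  rewrite /Q (_ : _ / _ = (x - v * a) ^+ 2 / (a *+ 2)).
    by rewrite ler_wpM2r ?lerDl ?sqr_ge0// invr_ge0 pmulrn_lge0// ltW.
  by field; rewrite !gt_eqF.
rewrite (mulrDr (v ^+ 2)) -exprMn.
move: (v * x) (v ^+ 2 * y ^+ 2) y2 (v ^+ 2 * a) A0 va Q q0 QE {e1 Q1} => z Y Y0 A A0 A1 Q q0.
rewrite ler_pdivrMr ?mulr_gt0// => QE.
have [zA|zA] := leP (A / 2) z.
  have : A ^+ 2 / 4 <= z ^+ 2 by nra.
  have : 0 <= Q * (1 + (z ^+ 2 + Y)) by rewrite mulr_ge0// addr_ge0// addr_ge0// sqr_ge0.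
  nra.
have : A / 8 <= Q.
  rewrite -(ler_pM2r (x := 2 * A)) ?mulr_gt0//; apply: le_trans QE.
  nra.
have : 0 <= Q * (z ^+ 2 + Y) by rewrite mulr_ge0// addr_ge0// sqr_ge0.
have := sqr_ge0 z; nra.
Qed.

Section IncrementKernel.
Context d (Omega : measurableType d) (P : probability Omega R) (X1 X2 : R -> Omega -> R).
Hypothesis BX : planar_BM P X1 X2.
Variables (u s : R).
Hypotheses (u0 : 0 <= u) (us : u < s).
Let a := s - u.
Let a0 : 0 < a. Proof. by rewrite subr_gt0. Qed.

(** Cameron-Martin for one increment: completing the square turns the exponential weight into a
    shift of the heat kernel by [v * a]. *)
Lemma increment_tilt (f : R -> R -> R) m1 m2 (x0 y0 v : R) : dens f m1 m2 ->
  \int[P]_w (expR (v * (X1 s w - X1 u w) - v ^+ 2 * a / 2) *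
     f (x0 + (X1 s w - X1 u w)) (y0 + (X2 s w - X2 u w))) =
  \int[mu2]_z (f z.1 z.2 * heat a (z.1 - x0 - v * a) (z.2 - y0)).
Proof.
move=> df; have mf := dens_measurable df; have [_ [f0 _] _ _ _] := df.
pose Phi (z : R * R) := (expR (v * z.1 - v ^+ 2 * a / 2) * f (x0 + z.1) (y0 + z.2))%:E.
have mfs : measurable_fun setT (fun z : R * R => f (x0 + z.1) (y0 + z.2)).
  by apply: (measurable_plane_comp mf); apply: measurable_funD.
have mPhi : measurable_fun setT Phi.
  apply/measurable_EFinP; apply: measurable_funM => //; apply: measurableT_comp => //.
  by apply: measurable_funB => //; apply: measurable_funM.
have Phi0 z : (0 <= Phi z)%E by rewrite lee_fin mulr_ge0 ?expR_ge0.
rewrite /Rintegral; congr fine.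
rewrite (BM_increment BX u0 us mPhi Phi0).
have mh : measurable_fun setT (fun z : R * R => (Phi z * (heat a z.1 z.2)%:E)%E).
  by apply: emeasurable_funM => //; apply/measurable_EFinP; apply: measurable_heat.
have mh0 z : (0 <= Phi z * (heat a z.1 z.2)%:E)%E.
  by apply: mule_ge0 (Phi0 z) _; rewrite lee_fin heat_ge0.
rewrite -(plane_fubini mh mh0).
have mg : measurable_fun setT (fun z : R * R => (f z.1 z.2 * heat a (z.1 - x0 - v * a) (z.2 - y0))%:E).
  apply/measurable_EFinP; apply: measurable_funM => //; apply: measurable_heat;
    by do ?apply: measurable_funB.
rewrite [RHS](plane_affine (c := 1) x0 y0 ltr01 mg); last first.
  by move=> z; rewrite lee_fin mulr_ge0 ?heat_ge0.
rewrite expr1n mul1e; apply: eq_integral => -[x y] _ /=.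
rewrite /Phi/= -EFinM !mul1r (addrC x x0) (addrC y y0); congr EFin.
rewrite mulrAC mulrC; congr (_ * _).
rewrite /heat mulrCA -expRD; congr (_ * expR _).
rewrite (_ : x0 + x - x0 - v * a = x - v * a); last by ring.
rewrite (_ : y0 + y - y0 = y); last by ring.
by field; rewrite gt_eqF.
Qed.

Lemma increment_expect (f : R -> R -> R) m1 m2 (x0 y0 : R) : dens f m1 m2 ->
  \int[P]_w f (x0 + (X1 s w - X1 u w)) (y0 + (X2 s w - X2 u w)) =
  \int[mu2]_z (f z.1 z.2 * heat a (z.1 - x0) (z.2 - y0)).
Proof.
move=> df; have := increment_tilt x0 y0 0 df.
under eq_Rintegral do rewrite expr0n/= !mul0r subr0 expR0 mul1r.
by move=> ->; apply: eq_Rintegral => z _; rewrite mul0r subr0.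
Qed.

Let heatm (b1 b2 : R) : measurable_fun setT (fun z : R * R => heat a (z.1 - b1) (z.2 - b2)).
Proof. by apply: measurable_heat; apply: measurable_funB. Qed.

Let k := (pi *+ 2 * a)^-1 : R.
Let k0 : 0 <= k. Proof. by rewrite invr_ge0 ltW// mulr_gt0// mulrn_wgt0// pi_gt0. Qed.

Let heatk b1 b2 (z : R * R) : `|heat a (z.1 - b1) (z.2 - b2)| <= k.
Proof. by rewrite ger0_norm ?heat_ge0// heat_le. Qed.

Lemma increment_le (f : R -> R -> R) m1 m2 (x0 y0 : R) : dens f m1 m2 ->
  0 <= \int[P]_w f (x0 + (X1 s w - X1 u w)) (y0 + (X2 s w - X2 u w)) <= k.
Proof.
move=> df; rewrite (increment_expect x0 y0 df); have [_ [f0 _] _ _ _] := df.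
apply/andP; split; first by apply: Rintegral_ge0 => z _; rewrite mulr_ge0 ?heat_ge0.
rewrite -[leRHS](dens_integral_cst k df); apply: le_Rintegral => //.
- exact: (dens_integrable_bounded df (heatm x0 y0) (heatk x0 y0)).
- by apply: (dens_integrable_bounded df (measurable_cst k) (K := k)) => z; rewrite ger0_norm.
- by move=> z _; rewrite ler_wpM2l ?heat_le.
Qed.

(** Replacing [f] by a point mass costs the Lipschitz constant of the heat kernel times the first
    moment of [f]. This is where the comparison of two kernels of range [eps] gains a factor
    [eps]. *)
Lemma increment_lip (f : R -> R -> R) m1 m2 (x0 y0 : R) : dens f m1 m2 ->
  `|\int[P]_w f (x0 + (X1 s w - X1 u w)) (y0 + (X2 s w - X2 u w)) - heat a x0 y0| <=
  k * (2 / Num.sqrt a) * m1.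
Proof.
move=> df; rewrite (increment_expect x0 y0 df); have [_ [f0 _] _ _ _] := df.
have [i1 /andP[_ M1]] := dens_moment1 df.
have ih := dens_integrable_bounded df (heatm x0 y0) (heatk x0 y0).
have ic : mu2.-integrable setT (fun z => (f z.1 z.2 * heat a x0 y0)%:E).
  by apply: (dens_integrable_bounded df (measurable_cst _) (K := `|heat a x0 y0|)).
rewrite -[X in _ - X](dens_integral_cst (heat a x0 y0) df) -RintegralB//.
have iD : mu2.-integrable setT (EFin \o (fun z : R * R =>
    f z.1 z.2 * heat a (z.1 - x0) (z.2 - y0) - f z.1 z.2 * heat a x0 y0)).
  exact: integrableB ih ic.
apply: (le_trans (le_normr_Rintegral measurableT iD)).
have c0 : 0 <= k * (2 / Num.sqrt a) by rewrite mulr_ge0// divr_ge0// sqrtr_ge0.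
apply: (@le_trans _ _ (\int[mu2]_z (k * (2 / Num.sqrt a) * (f z.1 z.2 * (`|z.1| + `|z.2|))))).
  apply: le_Rintegral => //.
  - exact: integrable_abse iD.
  - exact: (integrableZl measurableT (k * (2 / Num.sqrt a)) i1).
  - move=> z _; rewrite -mulrBr normrM (ger0_norm (f0 _ _)) mulrCA ler_wpM2l//.
    have := heat_lip (z.1 - x0) (z.2 - y0) (- x0) (- y0) a0.
    rewrite (_ : heat a (- x0) (- y0) = heat a x0 y0); last by rewrite /heat !sqrrN.
    by rewrite !opprK !subrK.
by rewrite RintegralZl// ler_wpM2l.
Qed.

Lemma increment_ge (f : R -> R -> R) m1 m2 : dens f m1 m2 ->
  k * (1 - m2 / (a *+ 2)) <= \int[P]_w f (X1 s w - X1 u w) (X2 s w - X2 u w).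
Proof.
move=> df; have := increment_expect 0 0 df.
under eq_Rintegral do rewrite !add0r; move=> ->.
have [_ [f0 _] _ _ _] := df.
have [i2 /andP[_ M2]] := dens_moment2 df.
have a2 : 0 < a *+ 2 by rewrite pmulrn_lgt0.
have ic : mu2.-integrable setT (fun z => (f z.1 z.2 * k)%:E).
  by apply: (dens_integrable_bounded df (measurable_cst k) (K := k)) => z; rewrite ger0_norm.
have i2' := integrableZl measurableT (k / (a *+ 2)) i2.
apply: (@le_trans _ _ (\int[mu2]_z (f z.1 z.2 * k -
    k / (a *+ 2) * (f z.1 z.2 * (z.1 ^+ 2 + z.2 ^+ 2))))).
  rewrite RintegralB// RintegralZl// (dens_integral_cst _ df).
  rewrite mulrBr mulr1 lerB// -mulrA ler_wpM2l// mulrC ler_wpM2r//.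
  by rewrite invr_ge0 ltW.
apply: le_Rintegral => //.
- exact: integrableB ic i2'.
- exact: (dens_integrable_bounded df (heatm 0 0) (heatk 0 0)).
- move=> z _; rewrite !subr0 (_ : _ - _ = f z.1 z.2 * (k * (1 - (z.1 ^+ 2 + z.2 ^+ 2) / (a *+ 2)))).
    by rewrite ler_wpM2l// heat_ge.
  by field; rewrite gt_eqF.
Qed.

(** Meant for time lags up to the inverse of [v ^+ 2], where the shift [v * a] does not exceed the
    width of the heat kernel. *)
Lemma increment_tilt_lip (f : R -> R -> R) m1 m2 (v : R) : dens f m1 m2 -> 0 <= v ->
  \int[P]_w (expR (v * (X1 s w - X1 u w) - v ^+ 2 * a / 2) * f (X1 s w - X1 u w) (X2 s w - X2 u w))
   - \int[P]_w f (X1 s w - X1 u w) (X2 s w - X2 u w) <=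
  k * (2 / Num.sqrt a) * (v * a).
Proof.
move=> df v0; have [_ [f0 _] _ _ _] := df.
have := increment_expect 0 0 df.
under eq_Rintegral do rewrite !add0r; move=> ->.
have := increment_tilt 0 0 v df.
under eq_Rintegral do rewrite !add0r; move=> ->.
have ih := dens_integrable_bounded df (heatm 0 0) (heatk 0 0).
have hva : measurable_fun setT (fun z : R * R => heat a (z.1 - 0 - v * a) (z.2 - 0)).
  by apply: measurable_heat; do ?apply: measurable_funB.
have kva (z : R * R) : `|heat a (z.1 - 0 - v * a) (z.2 - 0)| <= k.
  by rewrite ger0_norm ?heat_ge0// heat_le.
have ihv := dens_integrable_bounded df hva kva.
set C := k * (2 / Num.sqrt a) * (v * a).
have C0 : 0 <= C.
  rewrite /C; apply: mulr_ge0; apply: mulr_ge0 => //; last exact: ltW.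
rewrite -RintegralB// -[leRHS](dens_integral_cst C df); apply: le_Rintegral => //.
- exact: integrableB ihv ih.
- by apply: (dens_integrable_bounded df (measurable_cst C) (K := C)) => z; rewrite ger0_norm.
- move=> z _; rewrite -mulrBr ler_wpM2l//.
  apply: (le_trans (ler_norm _)); apply: (le_trans (heat_lip _ _ _ _ a0)).
  rewrite -/k subrr normr0 addr0 [X in `|X|](_ : _ = - (v * a)); last by ring.
  by rewrite normrN ger0_norm// mulr_ge0// ltW.
Qed.

(** Meant for the longer lags, over which the drift has carried the path away from its earlier
    position. The resulting decay 1 / a^2 is summable over them. *)
Lemma increment_tilt_decay (f : R -> R -> R) m1 m2 (v : R) : dens f m1 m2 -> 0 < v ->
  1 <= v ^+ 2 * a ->
  \int[P]_w (expR (v * (X1 s w - X1 u w) - v ^+ 2 * a / 2) * f (X1 s w - X1 u w) (X2 s w - X2 u w))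
  <= 8 * k * (1 + v ^+ 2 * m2) / (v ^+ 2 * a).
Proof.
move=> df v0 va; have [_ [f0 _] _ _ _] := df.
have [i2 /andP[_ M2]] := dens_moment2 df.
have := increment_tilt 0 0 v df.
under eq_Rintegral do rewrite !add0r; move=> ->.
set c := 8 * k / (v ^+ 2 * a).
have v2 : 0 < v ^+ 2 by rewrite exprn_gt0.
have c0 : 0 <= c by rewrite /c divr_ge0 ?mulr_ge0// ltW.
have ic : mu2.-integrable setT (fun z => (f z.1 z.2 * c)%:E).
  by apply: (dens_integrable_bounded df (measurable_cst c) (K := c)) => z; rewrite ger0_norm.
have i2' := integrableZl measurableT (c * v ^+ 2) i2.
apply: (@le_trans _ _ (\int[mu2]_z (f z.1 z.2 * c +
    c * v ^+ 2 * (f z.1 z.2 * (z.1 ^+ 2 + z.2 ^+ 2))))); last first.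
  rewrite RintegralD// RintegralZl// (dens_integral_cst _ df).
  rewrite (_ : 8 * k * _ / _ = c + c * v ^+ 2 * m2); last by rewrite /c; ring.
  by rewrite lerD2l ler_wpM2l// mulr_ge0// ltW.
apply: le_Rintegral => //.
- have hva : measurable_fun setT (fun z : R * R => heat a (z.1 - 0 - v * a) (z.2 - 0)).
    by apply: measurable_heat; do ?apply: measurable_funB.
  have kva (z : R * R) : `|heat a (z.1 - 0 - v * a) (z.2 - 0)| <= k.
    by rewrite ger0_norm ?heat_ge0// heat_le.
  exact: (dens_integrable_bounded df hva kva).
- exact: integrableD ic i2'.
- move=> z _; rewrite !subr0 (_ : _ + _ = f z.1 z.2 * (c * (1 + v ^+ 2 * (z.1 ^+ 2 + z.2 ^+ 2)))); last by ring.
  rewrite ler_wpM2l//.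
  rewrite /heat -/k [leRHS](_ : _ = k * (8 / (v ^+ 2 * a) * (1 + v ^+ 2 * (z.1 ^+ 2 + z.2 ^+ 2)))); last by rewrite /c; ring.
  by rewrite ler_wpM2l//; exact: tilted_gauss_decay.
Qed.

End IncrementKernel.

End Plane.

(** * Schwartz kernels as approximate identities *)

Section SchwartzDensity.
Context (R : realType).
Local Notation mu := (@lebesgue_measure R).
Local Notation mu2 := (mu \x mu)%E.

Lemma integral_oneDsqrV : (\int[mu]_x (oneDsqr x)^-1%:E = pi%:E)%E.
Proof.
rewrite (@ge0_symfun_integralT _ (fun x => (oneDsqr x)^-1)); last 3 first.
- by move=> x; rewrite invr_ge0 (le_trans ler01)// oneDsqr_ge1.
- exact: continuous_oneDsqrV.
- by move=> x /=; rewrite /oneDsqr sqrrN.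
rewrite (_ : [set x | _] = `[0, +oo[%classic); last first.
  by apply/seteqP; split => x/=; rewrite in_itv/= andbT.
by rewrite integral0y_oneDsqr -EFinM mulrCA divff// mulr1.
Qed.

Lemma measurable_oneDsqrV : measurable_fun setT (fun x : R => (oneDsqr x)^-1).
Proof. by apply: continuous_measurable_fun; exact: continuous_oneDsqrV. Qed.

Lemma integral_plane_decay (g : R -> R -> R) (C : R) : 0 <= C ->
  measurable_fun setT (fun z : R * R => g z.1 z.2) -> (forall x y, 0 <= g x y) ->
  (forall x y, g x y <= C * ((oneDsqr x)^-1 * (oneDsqr y)^-1)) ->
  (\int[mu2]_z (g z.1 z.2)%:E <= (C * pi ^+ 2)%:E)%E.
Proof.
move=> C0 mg g0 gC.
have v0 (x : R) : 0 <= (oneDsqr x)^-1 by rewrite invr_ge0 (le_trans ler01)// oneDsqr_ge1.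
have mb : measurable_fun setT (fun z : R * R => (C * ((oneDsqr z.1)^-1 * (oneDsqr z.2)^-1))%:E).
  apply/measurable_EFinP; apply: measurable_funM => //; apply: measurable_funM.
    by apply: (measurableT_comp measurable_oneDsqrV).
  by apply: (measurableT_comp measurable_oneDsqrV).
have b0 (z : R * R) : (0 <= (C * ((oneDsqr z.1)^-1 * (oneDsqr z.2)^-1))%:E)%E.
  by rewrite lee_fin mulr_ge0// mulr_ge0.
apply: (@le_trans _ _ (\int[mu2]_z (C * ((oneDsqr z.1)^-1 * (oneDsqr z.2)^-1))%:E)%E).
  apply: ge0_le_integral => //.
  - by move=> z _; rewrite lee_fin.
  - exact/measurable_EFinP.
  - by move=> z _; rewrite lee_fin.
rewrite (plane_fubini mb b0) /=.
have E x : (\int[mu]_y (C * ((oneDsqr x)^-1 * (oneDsqr y)^-1))%:E = (C * pi * (oneDsqr x)^-1)%:E)%E.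
  under eq_integral do rewrite mulrA.
  rewrite (ge0_integralZl_real mu measurable_oneDsqrV v0) ?mulr_ge0//.
  by rewrite integral_oneDsqrV -EFinM; congr EFin; ring.
under eq_integral do rewrite E.
rewrite (ge0_integralZl_real mu measurable_oneDsqrV v0); last by rewrite mulr_ge0// pi_ge0.
by rewrite integral_oneDsqrV -EFinM lee_fin expr2 mulrA.
Qed.

Lemma schwartz_dens (phi : R -> R -> R) : schwartz2 phi -> (forall x y, 0 <= phi x y) ->
  (\int[mu2]_(p in [set: R * R]) (phi p.1 p.2)%:E)%E = 1%E ->
  exists m B : R, [/\ 0 <= m, 0 <= B &
    forall eps, 0 < eps -> dens (phi_eps phi eps) (eps * m) (eps ^+ 2 * m) /\
      forall x y, phi_eps phi eps x y <= B / eps ^+ 2].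
Proof.
move=> [smooth decay] phi0 int1.
have [cphi _] := smooth [::]; rewrite /= in cphi.
have mphi := continuous_plane_measurable cphi.
(* Decay of order 3: one factor 1 + x^2 + y^2 absorbs the moment weights, and its square dominates
   (1 + x^2)(1 + y^2), whose inverse has integral pi^2. *)
have [B HB] := decay [::] 0%N; have [C HC] := decay [::] 3%N.
have B0 : 0 <= B by apply: le_trans (HB 0 0); rewrite expr0 mul1r.
have C0 : 0 <= C.
  apply: le_trans (HC 0 0); rewrite mulr_ge0// exprn_ge0// expr0n/= !addr0.
have phiB x y : phi x y <= B.
  by have := HB x y; rewrite expr0 mul1r; apply: le_trans; exact: ler_norm.
have tail x y : phi x y * (1 + x ^+ 2 + y ^+ 2) <= C * ((oneDsqr x)^-1 * (oneDsqr y)^-1).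
  have := HC x y; rewrite /= ger0_norm// => H.
  have x2 := sqr_ge0 x; have y2 := sqr_ge0 y.
  have q0 : 0 < oneDsqr x * oneDsqr y by rewrite mulr_gt0// (lt_le_trans ltr01)// oneDsqr_ge1.
  rewrite -invfM ler_pdivlMr//; apply: le_trans H.
  rewrite (_ : _ ^+ 3 * _ = phi x y * (1 + x ^+ 2 + y ^+ 2) * (1 + x ^+ 2 + y ^+ 2) ^+ 2); last by ring.
  rewrite ler_wpM2l ?mulr_ge0 ?addr_ge0//.
  by rewrite /oneDsqr; move: (x ^+ 2) (y ^+ 2) x2 y2 => a b; nra.
pose m := C * pi ^+ 2.
have m1 : (\int[mu2]_z (phi z.1 z.2 * (`|z.1| + `|z.2|))%:E <= m%:E)%E.
  apply: (@integral_plane_decay (fun x y => phi x y * (`|x| + `|y|))) => //.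
  - apply: measurable_funM => //; apply: measurable_funD; exact: measurableT_comp.
  - by move=> x y; rewrite mulr_ge0// addr_ge0.
  - move=> x y; apply: le_trans (tail x y); rewrite ler_wpM2l//.
    rewrite -(real_normK (num_real x)) -(real_normK (num_real y)).
    move: `|x| `|y| => a b; have := sqr_ge0 (a - 2^-1); have := sqr_ge0 (b - 2^-1).
    by nra.
have m2 : (\int[mu2]_z (phi z.1 z.2 * (z.1 ^+ 2 + z.2 ^+ 2))%:E <= m%:E)%E.
  apply: (@integral_plane_decay (fun x y => phi x y * (x ^+ 2 + y ^+ 2))) => //.
  - by apply: measurable_funM => //; apply: measurable_funD; exact: measurable_funX.
  - by move=> x y; rewrite mulr_ge0// addr_ge0// sqr_ge0.
  - by move=> x y; apply: le_trans (tail x y); rewrite ler_wpM2l// -addrA lerDr.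
exists m, B; split => //; first by rewrite mulr_ge0// exprn_ge0// pi_ge0.
move=> e e0; have en : e != 0 by rewrite gt_eqF.
have e2 : 0 <= e ^- 2 by rewrite invr_ge0 exprn_ge0// ltW.
have pe x y : phi_eps phi e (e * x + 0) (e * y + 0) = e ^- 2 * phi x y.
  by rewrite /phi_eps !addr0 [e * x]mulrC [e * y]mulrC !mulfK.
have pe0 x y : 0 <= phi_eps phi e x y by rewrite mulr_ge0.
have mpe : measurable_fun setT (fun z : R * R => phi_eps phi e z.1 z.2).
  apply: measurable_funM => //; apply: (measurable_plane_comp mphi); exact: measurable_funM.
split; last by move=> x y; rewrite /phi_eps mulrC ler_wpM2r.
split.
- move=> p; apply: cvgM; first exact: cvg_cst.
  have fa : z.1 / e @[z --> p] --> p.1 / e by apply: cvgM; [exact: cvg_fst|exact: cvg_cst].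
  have fb : z.2 / e @[z --> p] --> p.2 / e by apply: cvgM; [exact: cvg_snd|exact: cvg_cst].
  exact: (cvg_comp _ (fun q => phi q.1 q.2) (cvg_pair fa fb) (cphi (p.1 / e, p.2 / e))).
- by split => //; exists (e ^- 2 * B) => x y; rewrite ler_wpM2l.
- rewrite (plane_affine 0 0 e0); [|exact/measurable_EFinP|by move=> z; rewrite lee_fin].
  under eq_integral do rewrite pe EFinM.
  rewrite ge0_integralZl//; [|exact/measurable_EFinP|by move=> z _; rewrite lee_fin].
  by rewrite int1 mule1 -EFinM divff// expf_neq0.
- have mg : measurable_fun setT (fun z : R * R => (phi z.1 z.2 * (`|z.1| + `|z.2|))%:E).
    apply/measurable_EFinP; apply: measurable_funM => //.
    by apply: measurable_funD; exact: measurableT_comp.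
  rewrite (plane_affine 0 0 e0); last 2 first.
  + apply/measurable_EFinP; apply: measurable_funM => //.
    by apply: measurable_funD; exact: measurableT_comp.
  + by move=> z; rewrite lee_fin mulr_ge0// addr_ge0.
  rewrite (_ : (\int[mu2]_z _)%E = (\int[mu2]_z (e^-1 * (phi z.1 z.2 * (`|z.1| + `|z.2|)))%:E)%E); last first.
    apply: eq_integral => z _ /=; rewrite pe !addr0 !normrM (gtr0_norm e0); congr EFin.
    by field.
  have g0 (z : R * R) : 0 <= phi z.1 z.2 * (`|z.1| + `|z.2|) by rewrite mulr_ge0// addr_ge0.
  rewrite ge0_integralZl_real//; last 2 first.
  + exact/measurable_EFinP.
  + by rewrite invr_ge0 ltW.
  rewrite muleA -EFinM (_ : e ^+ 2 / e = e); last by field.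
  by rewrite EFinM lee_pmul2l// lte_fin.
- have mg : measurable_fun setT (fun z : R * R => (phi z.1 z.2 * (z.1 ^+ 2 + z.2 ^+ 2))%:E).
    apply/measurable_EFinP; apply: measurable_funM => //.
    by apply: measurable_funD; exact: measurable_funX.
  rewrite (plane_affine 0 0 e0); last 2 first.
  + apply/measurable_EFinP; apply: measurable_funM => //.
    by apply: measurable_funD; exact: measurable_funX.
  + by move=> z; rewrite lee_fin mulr_ge0// addr_ge0// sqr_ge0.
  rewrite (_ : (\int[mu2]_z _)%E = \int[mu2]_z (phi z.1 z.2 * (z.1 ^+ 2 + z.2 ^+ 2))%:E)%E; last first.
    apply: eq_integral => z _ /=; rewrite pe !addr0; congr EFin.
    by field.
  by rewrite [leRHS]EFinM lee_pmul2l// lte_fin exprn_gt0.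
Qed.

End SchwartzDensity.

(** * Riemann sums *)

Section RiemannSums.
Context (R : realType).
Local Notation mu := (@lebesgue_measure R).
Let U : probability (measurableTypeR R) R := uniform_prob (@ltr01 R).

Lemma uniform_itv (h : R -> R) : measurable_fun setT h -> (forall x, 0 <= h x) ->
  (\int[U]_x (h x)%:E = \int[mu]_(x in `[0%R, 1%R]%classic) (h x)%:E)%E.
Proof.
move=> mh h0; rewrite integral_uniform ?subr0 ?invr1 ?mul1e//.
exact/measurable_EFinP.
Qed.

(** The index of the cell of mesh 1 / (N + 1) that contains [s]. Cutting off at [N], and at 0
    through [truncn], makes it total, so that a Riemann sum is exactly an expectation under the
    uniform law [U]. *)
Definition gridpt (N : nat) (s : R) : nat := minn (Num.truncn (N.+1%:R * s)) N.

Lemma gridpt_ge N k s : (0 < k)%N -> (k <= N)%N ->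
  (k <= gridpt N s)%N = (k%:R / N.+1%:R <= s).
Proof.
move=> k0 kN; rewrite /gridpt leq_min kN andbT ler_pdivrMr// mulrC.
by case: k k0 kN => // k _ _; rewrite truncn_gt_nat.
Qed.

Lemma gridpt_level N k : [set s | (k <= gridpt N s)%N] =
  if k == 0%N then setT else if (k <= N)%N then `[k%:R / N.+1%:R, +oo[%classic else set0.
Proof.
case: eqP => [->|/eqP k0]; first by apply/seteqP; split.
case: leqP => kN; apply/seteqP; split => s //=.
- by rewrite in_itv/= andbT gridpt_ge// lt0n.
- by rewrite in_itv/= andbT gridpt_ge// lt0n.
- by move=> ks; have := geq_minr (Num.truncn (N.+1%:R * s)) N; rewrite -/(gridpt N s) => /(leq_trans ks); rewrite leqNgt kN.
Qed.

Lemma gridpt_levelD N k : [set s | gridpt N s = k] =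
  [set s | (k <= gridpt N s)%N] `\` [set s | (k < gridpt N s)%N].
Proof.
apply/seteqP; split => s /=; first by move=> ->; rewrite ltnn leqnn; split.
by move=> [H1 /negP]; rewrite -leqNgt => H2; apply/eqP; rewrite eqn_leq H1 H2.
Qed.

Lemma measurable_gridpt_level N k : measurable [set s | (k <= gridpt N s)%N].
Proof. by rewrite gridpt_level; case: ifP => // _; case: ifP => // _. Qed.

Lemma gridpt_measurable N k : measurable [set s | gridpt N s = k].
Proof. by rewrite gridpt_levelD; apply: measurableD; exact: measurable_gridpt_level. Qed.

Lemma gridpt_level_uniform N k : (k <= N.+1)%N ->
  U [set s | (k <= gridpt N s)%N] = (1 - k%:R / N.+1%:R)%:E.
Proof.
move=> kN; rewrite gridpt_level; case: eqP => [->|/eqP k0].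
  by rewrite mul0r subr0; exact: (probability_setT U).
have [kN1|kN1] := leqP k N; last first.
  by rewrite measure0 (_ : k = N.+1); [rewrite divff// subrr|apply/eqP; rewrite eqn_leq kN].
have t0 : 0 <= k%:R / N.+1%:R :> R by rewrite divr_ge0.
have t1 : k%:R / N.+1%:R <= 1 :> R by rewrite ler_pdivrMr// mul1r ler_nat.
rewrite -[LHS](_ : (\int[U]_x (\1_`[k%:R / N.+1%:R, +oo[%classic x)%:E = _)%E); last first.
  by rewrite integral_indic// setIT.
rewrite uniform_itv; [|exact: measurable_indic|by []].
rewrite integral_indic//= (_ : _ `&` _ = `[k%:R / N.+1%:R, 1]%classic); last first.
  apply/seteqP; split => x /=; rewrite !in_itv/= andbT; first by case=> -> /andP[].
  by move=> /andP[kx ->]; rewrite kx (le_trans t0 kx).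
by rewrite lebesgue_measure_itv/= lte_fin; case: ltP => // t; rewrite (@le_anti _ _ (k%:R / N.+1%:R) 1) ?subrr// t1 t.
Qed.

Lemma gridpt_uniform N k : (k <= N)%N -> U [set s | gridpt N s = k] = (N.+1%:R^-1)%:E.
Proof.
move=> kN; rewrite gridpt_levelD measureD; [|exact: measurable_gridpt_level..|]; last first.
  by rewrite (le_lt_trans (probability_le1 _ _))// ?ltry//; exact: measurable_gridpt_level.
rewrite (_ : _ `&` _ = [set s | (k < gridpt N s)%N]); last first.
  by apply/seteqP; split => s /=; [case|move=> ks; split => //; exact: ltnW].
have H1 := gridpt_level_uniform (leqW kN).
have H2 := gridpt_level_uniform (N := N) (k := k.+1) kN.
etransitivity; first exact: (f_equal2 (fun a b : \bar R => (a - b)%E) H1 H2).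
by rewrite -EFinB; congr EFin; rewrite -natr1; field; rewrite gt_eqF.
Qed.

Lemma gridpt_indicE N (g : nat -> R) s :
  g (gridpt N s) = \sum_(k < N.+1) g k * \1_[set s | gridpt N s = k] s.
Proof.
have kN : (gridpt N s < N.+1)%N by rewrite ltnS geq_minr.
rewrite (bigD1 (Ordinal kN))//= indicE mem_set// mulr1 big1 ?addr0// => i ik.
rewrite indicE memNset ?mulr0//= => H; move/eqP: ik; apply; exact/val_inj.
Qed.

Lemma bmf_gridpt N (g : nat -> R) : bmf (fun s : R => g (gridpt N s)).
Proof.
under eq_fun do rewrite gridpt_indicE.
apply: bmf_sum => k; apply: bmfZ; split; first exact: (measurable_indic (gridpt_measurable N k)).
by exists 1 => x; rewrite indicE; case: (_ \in _); rewrite ?normr1 ?normr0.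
Qed.

Lemma gridpt_expect N (g : nat -> R) :
  \int[U]_s g (gridpt N s) = N.+1%:R^-1 * \sum_(k < N.+1) g k.
Proof.
under eq_Rintegral do rewrite gridpt_indicE.
have bI k : bmf (fun s : R => \1_[set s | gridpt N s = k] s : R).
  split; first exact: (measurable_indic (gridpt_measurable N k)).
  by exists 1 => x; rewrite indicE; case: (_ \in _); rewrite ?normr1 ?normr0.
rewrite expect_sum; last by move=> k; apply: bmfZ; exact: bI.
rewrite mulr_sumr; apply: eq_bigr => k _.
rewrite RintegralZl//; last exact: (bmf_integrable U (bI k)).
rewrite mulrC; congr (_ * _); rewrite /Rintegral integral_indic//; last exact: gridpt_measurable.
by rewrite setIT; apply: (f_equal fine (gridpt_uniform _)); rewrite -ltnS.
Qed.

(** The limit of the rounded points at every real [s], also outside the unit interval, so that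
    convergence holds everywhere. *)
Definition clamp (s : R) : R := Num.max 0 (Num.min 1 s).

Lemma gridpt_cvg s : (gridpt N s)%:R / N.+1%:R @[N --> \oo] --> clamp s.
Proof.
have bound N : `|clamp s - (gridpt N s)%:R / N.+1%:R| <= N.+1%:R^-1.
  have n0 : 0 < N.+1%:R :> R by [].
  have nV : 0 < N.+1%:R^-1 :> R by rewrite invr_gt0.
  rewrite /clamp /gridpt; have [s0|s0] := ltP s 0.
    rewrite (_ : Num.truncn _ = 0%N); last first.
      by apply/truncn0Pn; rewrite -ltNge (lt_trans _ ltr01)// pmulr_rlt0.
    rewrite min0n mul0r subr0 (min_r (le_trans (ltW s0) ler01)) max_l ?normr0//; exact: ltW.
  have [s1|s1] := leP 1 s.
    rewrite (minn_idPr _); last first.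
      rewrite truncn_ge_nat ?mulr_ge0//; rewrite (le_trans _ (ler_wpM2l _ s1))// mulr1 ler_nat//.
    rewrite max_r// (_ : 1 - _ = N.+1%:R^-1) ?ger0_norm// ?ltW//.
    by rewrite -natr1; field; rewrite natr1 gt_eqF.
  rewrite max_r// (minn_idPl _); last first.
    by rewrite -ltnS truncn_lt_nat ?mulr_ge0// -[ltRHS]mulr1 ltr_pM2l.
  have /andP[t1 t2] := truncn_itv (mulr_ge0 (ltW n0) s0).
  rewrite ger0_norm; last by rewrite subr_ge0 ler_pdivrMr// [leRHS]mulrC.
  rewrite lerBlDl -[X in _ + X]mul1r -mulrDl ler_pdivlMr// [leLHS]mulrC natr1; exact: ltW.
apply/cvgrPdist_le => e e0; near=> N; apply: (le_trans (bound N)).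
near: N; apply: filterS (near_infty_natSinv_lt (PosNum e0)) => n /= /ltW.
by [].
Unshelve. all: by end_near. Qed.

(** Ensures that the step functions of the strict triangle vanish wherever the two clamped points
    coincide, so that no separate argument is needed on the diagonal. *)
Lemma gridpt_clamp_eq N s u : clamp s = clamp u -> s = u \/ gridpt N s = gridpt N u.
Proof.
have trn t : t <= 0 -> gridpt N t = 0%N.
  move=> t0; rewrite /gridpt (_ : Num.truncn _ = 0%N) ?min0n//.
  by apply/truncn0Pn; rewrite -ltNge (le_lt_trans _ ltr01)// pmulr_rle0.
have trN t : 1 <= t -> gridpt N t = N.
  move=> t1; rewrite /gridpt (minn_idPr _)// truncn_ge_nat.
    by rewrite (le_trans _ (ler_wpM2l _ t1))// mulr1 ler_nat.
  by rewrite mulr_ge0// (le_trans ler01).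
have cl0 t : t <= 0 -> clamp t = 0.
  by move=> t0; rewrite /clamp (min_r (le_trans t0 ler01)) max_l.
have cl1 t : 1 <= t -> clamp t = 1.
  by move=> t1; rewrite /clamp min_l// max_r.
have cl t : 0 <= t -> t <= 1 -> clamp t = t.
  by move=> t0 t1; rewrite /clamp min_r// max_r.
have [s0|s0] := leP s 0; have [u0|u0] := leP u 0.
- by move=> _; right; rewrite !trn.
- rewrite (cl0 s)//; have [u1|u1] := leP 1 u; first by rewrite (cl1 u)// => /eqP; rewrite eq_sym oner_eq0.
  by rewrite (cl u) ?ltW// => H; rewrite -H ltxx in u0.
- rewrite (cl0 u)//; have [s1|s1] := leP 1 s; first by rewrite (cl1 s)// => /eqP; rewrite oner_eq0.
  by rewrite (cl s) ?ltW// => H; rewrite H ltxx in s0.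
- have [s1|s1] := leP 1 s; have [u1|u1] := leP 1 u.
  + by move=> _; right; rewrite !trN.
  + by rewrite (cl1 s)// (cl u) ?ltW// => H; rewrite -H ltxx in u1.
  + by rewrite (cl1 u)// (cl s) ?ltW// => H; rewrite H ltxx in s1.
  + by rewrite !cl ?ltW//; left.
Qed.

(** The double sum is an iterated expectation of the step functions [G], and bounded convergence is
    applied first in [u] and then in [s]. Away from the diagonal two cells are eventually ordered
    like the points themselves, so the indicator of the triangle converges too. *)
Lemma riemann_triangle (k : R -> R -> R) (B : R) :
  continuous (fun p : R * R => k p.1 p.2) -> (forall s u, 0 <= k s u <= B) ->
  N.+1%:R^-1 ^+ 2 * (\sum_(i < N.+1) \sum_(j < N.+1 | (j < i)%N)
     k (i%:R / N.+1%:R) (j%:R / N.+1%:R)) @[N --> \oo] -->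
  fine (\int[mu]_(s in `[0%R, 1%R]%classic) \int[mu]_(u in `[0%R, s]%classic) (k s u)%:E)%E.
Proof.
move=> ck kB.
have k0 s u : 0 <= k s u by case/andP: (kB s u).
have B0 : 0 <= B by apply: le_trans (k0 0 0) _; case/andP: (kB 0 0).
have mk := continuous_plane_measurable ck.
pose r N s : R := (gridpt N s)%:R / N.+1%:R.
pose G N s u := (if (gridpt N u < gridpt N s)%N then k (r N s) (r N u) else 0).
pose H s u := (if clamp u < clamp s then k (clamp s) (clamp u) else 0).
have GB N s u : `|G N s u| <= B.
  by rewrite /G; case: ifP => _; [rewrite ger0_norm//; case/andP: (kB (r N s) (r N u))|rewrite normr0].
have HB s u : `|H s u| <= B.
  by rewrite /H; case: ifP => _; [rewrite ger0_norm//; case/andP: (kB (clamp s) (clamp u))|rewrite normr0].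
have GH s u : G N s u @[N --> \oo] --> H s u.
  have gr N s' u' : (gridpt N u' < gridpt N s')%N = (r N u' < r N s').
    by rewrite /r ltr_pM2r ?invr_gt0// ltr_nat.
  have sep s' u' : clamp u' < clamp s' -> \forall N \near \oo, (gridpt N u' < gridpt N s')%N.
    move=> us; near=> N; rewrite gr.
    apply: (@lt_trans _ _ ((clamp u' + clamp s') / 2)).
      by near: N; have /cvgr_lt := @gridpt_cvg u'; apply; lra.
    by near: N; have /cvgr_gt := @gridpt_cvg s'; apply; lra.
  rewrite /H; have [us|su|E] := ltgtP (clamp u) (clamp s).
  - have kc : k (r N s) (r N u) @[N --> \oo] --> k (clamp s) (clamp u).
      exact: (cvg_comp _ (fun p => k p.1 p.2) (cvg_pair (@gridpt_cvg s) (@gridpt_cvg u)) (ck (clamp s, clamp u))).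
    apply: cvg_trans kc; apply: near_eq_cvg; near=> N.
    by rewrite /G ifT//; near: N; exact: sep.
  - have z0 : (fun _ : nat => 0 : R) N @[N --> \oo] --> (0 : R) by exact: cvg_cst.
    apply: cvg_trans z0; apply: near_eq_cvg; near=> N.
    rewrite /G ifF//; apply/negbTE; rewrite -leqNgt ltnW//; near: N; exact: sep.
  - rewrite (_ : (fun N => G N s u) = cst 0); first exact: cvg_cst.
    apply/funext => N; rewrite /G ifF//; apply/negbTE; rewrite -leqNgt.
    by have [->//|->] := gridpt_clamp_eq N (esym E).
have mG N s : measurable_fun setT (G N s).
  exact: (bmf_gridpt N (fun j => if (j < gridpt N s)%N then k (r N s) (j%:R / N.+1%:R) else 0)).1.
have mH s : measurable_fun setT (H s).
  by apply: (measurable_fun_cvg (h := fun N => G N s)) => // u _; exact: GH.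
pose IG N s := \int[U]_u G N s u; pose IH s := \int[U]_u H s u.
have IGH s : IG N s @[N --> \oo] --> IH s.
  apply: (@expect_lim _ (measurableTypeR R) R U (fun N => G N s) (H s) B).
  - by move=> N; exact: mG.
  - exact: mH.
  - by move=> N u; exact: GB.
  - by apply: aeW => u; exact: GH.
have mIG N : measurable_fun setT (IG N).
  exact: (bmf_gridpt N (fun i => \int[U]_u
     (if (gridpt N u < i)%N then k (i%:R / N.+1%:R) (r N u) else 0))).1.
have mIH : measurable_fun setT IH.
  by apply: (measurable_fun_cvg mIG) => s _; exact: IGH.
have IGB N s : `|IG N s| <= B.
  by apply: (@expect_norm_le _ (measurableTypeR R) R U); [exact: mG|move=> u; exact: GB].
have lim : \int[U]_s IG N s @[N --> \oo] --> \int[U]_s IH s.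
  apply: (@expect_lim _ (measurableTypeR R) R U IG IH B) => //.
  by apply: aeW => u; exact: IGH.
have sumE N : \int[U]_s IG N s = N.+1%:R^-1 ^+ 2 *
   (\sum_(i < N.+1) \sum_(j < N.+1 | (j < i)%N) k (i%:R / N.+1%:R) (j%:R / N.+1%:R)).
  rewrite (gridpt_expect N (fun i => \int[U]_u
     (if (gridpt N u < i)%N then k (i%:R / N.+1%:R) (r N u) else 0))).
  rewrite expr2 -mulrA; congr (_ * _); rewrite mulr_sumr; apply: eq_bigr => i _.
  rewrite (gridpt_expect N (fun j => if (j < i)%N then k (i%:R / N.+1%:R) (j%:R / N.+1%:R) else 0)).
  by rewrite -big_mkcond.
rewrite -(funext sumE).
suff -> : fine (\int[mu]_(s in `[0%R, 1%R]%classic) \int[mu]_(u in `[0%R, s]%classic) (k s u)%:E)%E =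
  \int[U]_s IH s by [].
apply/esym.
have H0 s u : 0 <= H s u by rewrite /H; case: ifP.
have IH0 s : 0 <= IH s by apply: Rintegral_ge0.
rewrite [LHS]/Rintegral uniform_itv//; congr fine.
apply: eq_integral => s; rewrite inE/= in_itv/= => /andP[s0 s1].
have -> : (IH s)%:E = (\int[U]_u (H s u)%:E)%E.
  rewrite /IH /Rintegral fineK//; apply: integrable_fin_num => //.
  by apply: bmf_integrable; split; [exact: mH|exists B].
rewrite uniform_itv//.
have mks : measurable_fun setT (k s).
  by apply: (measurable_plane_comp mk) => //; exact: measurable_cst.
(* The limit [H] carries the strict condition [u < s]; the endpoint is negligible. *)
rewrite -(integral_itv_bndo_bndc (r := s)); last first.
  by apply: measurable_funTS; exact/measurable_EFinP.
have cl t : 0 <= t -> t <= 1 -> clamp t = t.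
  by move=> t0 t1; rewrite /clamp min_r// max_r.
rewrite integral_mkcond [RHS]integral_mkcond; apply: eq_integral => u _.
rewrite !patchE; case: ifPn => [|u01].
  rewrite inE/= in_itv/= => /andP[u0 u1].
  rewrite /H !cl//; case: ifPn => us.
    by rewrite mem_set//= in_itv/= u0 us.
  by rewrite memNset//= in_itv/= u0; exact/negP.
rewrite memNset//= in_itv/= => /andP[u0 us]; move/negP: u01; apply.
by rewrite inE/= in_itv/= u0 (le_trans (ltW us)).
Unshelve. all: by end_near. Qed.

End RiemannSums.

(** * Functionals of finitely many grid points *)

Section Cylinders.
Context (R : realType).
Implicit Types (F G : (nat -> R) -> (nat -> R) -> R).

Lemma cylinder_cst N (c : R) : cylinder N (fun _ _ : nat -> R => c).
Proof. by split => // d T x y mxy; exact: measurable_cst. Qed.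

Lemma cylinder_incr N (f : R -> R -> R) (c : R) j k : measurable_fun setT (fun p : R * R => f p.1 p.2) ->
  (j <= N)%N -> (k <= N)%N ->
  cylinder N (fun x y => f (c * x k - c * x j) (c * y k - c * y j)).
Proof.
move=> mf jN kN; split=> [x x' y y' E|d T x y mxy].
  by have [-> ->] := E _ jN; have [-> ->] := E _ kN.
have [mxk myk] := mxy k; have [mxj myj] := mxy j.
by apply: (measurable_plane_comp mf); apply: measurable_funB; apply: measurable_funM => //; exact: measurable_cst.
Qed.

Lemma cylinder_comp N (g : R -> R) F : measurable_fun setT g -> cylinder N F ->
  cylinder N (fun x y => g (F x y)).
Proof.
move=> mg [e m]; split=> [x x' y y' E|d T x y mxy]; first by rewrite (e x x' y y' E).
exact: (measurableT_comp mg (m d T x y mxy)).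
Qed.

Lemma cylinderM N F G : cylinder N F -> cylinder N G -> cylinder N (fun x y => F x y * G x y).
Proof.
move=> [e m] [e' m']; split=> [x x' y y' E|d T x y mxy]; first by rewrite (e x x' y y' E) (e' x x' y y' E).
exact: (measurable_funM (m d T x y mxy) (m' d T x y mxy)).
Qed.

Lemma cylinder_sum N (I : Type) (r : seq I) (p : pred I) (F : I -> (nat -> R) -> (nat -> R) -> R) :
  (forall i, p i -> cylinder N (F i)) -> cylinder N (fun x y => \sum_(i <- r | p i) F i x y).
Proof.
move=> cF; split=> [x x' y y' E|d T x y mxy].
  by apply: eq_bigr => i pi; rewrite ((cF i pi).1 x x' y y' E).
under eq_fun do rewrite big_mkcond; apply: measurable_sum => i.
case pi: (p i); [exact: ((cF i pi).2 d T x y mxy)|exact: measurable_cst].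
Qed.

Lemma cylinder_prod N (I : Type) (r : seq I) (F : I -> (nat -> R) -> (nat -> R) -> R) :
  (forall i, cylinder N (F i)) -> cylinder N (fun x y => \prod_(i <- r) F i x y).
Proof.
move=> cF; elim: r => [|i r IH].
  rewrite (_ : (fun x y => _) = fun _ _ => 1); first exact: cylinder_cst.
  by apply/funext => x; apply/funext => y; rewrite big_nil.
rewrite (_ : (fun x y => _) = fun x y => F i x y * \prod_(i <- r) F i x y); first exact: cylinderM.
by apply/funext => x; apply/funext => y; rewrite big_cons.
Qed.

Lemma cylinder_shift N M K (c : R) F : cylinder M F -> (K + M <= N)%N ->
  cylinder N (fun x y => F (fun k => c * (x (K + k)%N - x K)) (fun k => c * (y (K + k)%N - y K))).
Proof.
move=> [e m] KM; split=> [x x' y y' E|d T x y mxy].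
  apply: e => k kM; have [-> ->] := E K (leq_trans (leq_addr _ _) KM).
  by have [|-> ->] := E (K + k)%N _; first by rewrite (leq_trans _ KM)// leq_add2l.
apply: (m d T (fun k w => c * (x (K + k)%N w - x K w)) (fun k w => c * (y (K + k)%N w - y K w))) => k.
have [mxk myk] := mxy (K + k)%N; have [mxj myj] := mxy K.
by split; apply: measurable_funM; [exact: measurable_cst|exact: measurable_funB|
  exact: measurable_cst|exact: measurable_funB].
Qed.

(** Decoupling at step [m * M] makes the last block independent of the earlier ones; induction on
    [m] peels off one block at a time. *)
Lemma lattice_blocks d (Omega : measurableType d) (P : probability Omega R) N s W1 W2
    (M m : nat) (c K : R) (G : nat -> (nat -> R) -> (nat -> R) -> R) :
  lattice P N s W1 W2 -> (m * M <= N)%N -> (forall b, cylinder M (G b)) ->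
  (forall b x y, `|G b x y| <= K) ->
  let blk b w := G b (fun k => c * (W1 (b * M + k)%N w - W1 (b * M)%N w))
                     (fun k => c * (W2 (b * M + k)%N w - W2 (b * M)%N w)) in
  \int[P]_w (\prod_(b < m) blk b w) = \prod_(b < m) \int[P]_w blk b w.
Proof.
move=> LW + cG GK blk; elim: m => [|m IH] mN.
  rewrite big_ord0 -[RHS](expect_cst P); apply: eq_Rintegral => w _; exact: big_ord0.
have mN' : (m * M <= N)%N by rewrite (leq_trans _ mN)// leq_mul2r leqnSn orbT.
rewrite big_ord_recr/= -IH//.
have K0 : 0 <= K by apply: le_trans (GK 0%N (fun=> 0) (fun=> 0)).
pose sh b (x : nat -> R) := (fun k => c * (x (b * M + k)%N - x (b * M)%N)).
have cS b : (b < m.+1)%N -> cylinder N (fun x y => G b (sh b x) (sh b y)).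
  move=> bm; apply: cylinder_shift => //; rewrite addnC -mulSn (leq_trans _ mN)// leq_mul2r bm orbT//.
have cP : cylinder N (fun x y => \prod_(b < m.+1) G b (sh b x) (sh b y)).
  pose F b x y := if (b < m.+1)%N then G b (sh b x) (sh b y) else 1.
  have -> : (fun x y => \prod_(b < m.+1) G b (sh b x) (sh b y)) = fun x y => \prod_(b < m.+1) F b x y.
    by apply/funext => x; apply/funext => y; apply: eq_bigr => b _; rewrite /F ltn_ord.
  apply: cylinder_prod => b; rewrite /F ltn_ord; exact: cS.
have bP x y : `|\prod_(b < m.+1) G b (sh b x) (sh b y)| <= K ^+ m.+1.
  rewrite normr_prod; apply: le_trans (_ : \prod_(b < m.+1) K <= _).
    by apply: ler_prod => b _; rewrite normr_ge0 GK.
  by rewrite prodr_const card_ord.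
have := lattice_decouple_bounded (m * M) LW cP bP => /= ->.
have E1 w w' : \prod_(b < m.+1) G b (sh b (splice (m * M) W1 ^~ (w, w'))) (sh b (splice (m * M) W2 ^~ (w, w'))) =
   (\prod_(b < m) blk b w) * blk m w'.
  rewrite big_ord_recr/=; congr (_ * _).
    apply: eq_bigr => b _; rewrite /blk; apply: (cG b).1 => k kM; rewrite /sh.
    have h1 : (b * M + k <= m * M)%N.
      by have := leq_mul (ltn_ord b) (leqnn M); rewrite mulSn; lia.
    have h2 : (b * M <= m * M)%N by rewrite leq_mul2r ltnW ?orbT.
    by rewrite !splice_left.
  rewrite /blk; apply: (cG m).1 => k kM; rewrite /sh.
  by rewrite !splice_sub_right// leq_addr.
have bblk b : (b < m.+1)%N -> bmf (blk b).
  move=> bm; split; last by exists K => w; exact: GK.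
  by have := (cS b bm).2 d Omega W1 W2; apply => k; case: LW.
have -> : \int[P]_w \int[P]_w' (\prod_(b < m.+1) G b (sh b (splice (m * M) W1 ^~ (w, w'))) (sh b (splice (m * M) W2 ^~ (w, w')))) =
    \int[P]_w ((\int[P]_w' blk m w') * (\prod_(b < m) blk b w)).
  apply: eq_Rintegral => w _; rewrite mulrC -expectZ; last exact: bblk.
  by apply: eq_Rintegral => w' _; exact: E1.
rewrite expectZ 1?mulrC//.
pose F b w := if (b < m.+1)%N then blk b w else 1.
have -> : (fun w => \prod_(b < m) blk b w) = fun w => \prod_(b < m) F b w.
  by apply/funext => w; apply: eq_bigr => b _; rewrite /F (ltn_trans (ltn_ord b) (ltnSn _)).
apply: bmf_prod => b; rewrite /F (ltn_trans (ltn_ord b) (ltnSn _)); apply: bblk.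
exact: ltn_trans (ltn_ord b) (ltnSn _).
Qed.

End Cylinders.

(** * Self-intersection local time as a limit of Riemann sums *)

Section RiemannSILT.
Context (R : realType).
Local Notation mu := (@lebesgue_measure R).
Implicit Types (f g : R -> R -> R).

Definition RS (N : nat) f (x y : nat -> R) : R :=
  N%:R^-1 ^+ 2 * (\sum_(i < N) \sum_(j < N | (j < i)%N) f (x i - x j) (y i - y j)).

Definition grid d (Omega : measurableType d) (N : nat) (X : R -> Omega -> R) (w : Omega) (k : nat) : R :=
  X (k%:R / N%:R) w.

(* The kernel [f] may change sign here: differences of two kernels are needed. *)
Definition siltof d (Omega : measurableType d) f (X1 X2 : R -> Omega -> R) (A : Omega -> R) : Prop :=
  forall w, RS N.+1 f (grid N.+1 X1 w) (grid N.+1 X2 w) @[N --> \oo] --> A w.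

Definition bker f (B : R) : Prop :=
  continuous (fun p : R * R => f p.1 p.2) /\ forall x y, `|f x y| <= B.

Definition rescale (c : R) f : R -> R -> R := fun x y => f (c * x) (c * y).

Lemma bker_rescale c f B : bker f B -> bker (rescale c f) B.
Proof.
move=> [cf fB]; split; last by move=> x y; exact: fB.
move=> p; have fa : c * q.1 @[q --> p] --> c * p.1.
  by apply: cvgM; [exact: cvg_cst|exact: cvg_fst].
have fb : c * q.2 @[q --> p] --> c * p.2.
  by apply: cvgM; [exact: cvg_cst|exact: cvg_snd].
exact: (cvg_comp _ (fun p => f p.1 p.2) (cvg_pair fa fb) (cf (c * p.1, c * p.2))).
Qed.

Lemma bkerB f g B C : bker f B -> bker g C -> bker (fun x y => f x y - g x y) (B + C).
Proof.
move=> [cf fB] [cg gC]; split; last by move=> x y; rewrite (le_trans (ler_normB _ _))// lerD.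
by move=> p; apply: cvgB; [exact: cf|exact: cg].
Qed.

Lemma bker_ge0 f B : bker f B -> 0 <= B.
Proof. by move=> [_ fB]; apply: le_trans (normr_ge0 _) (fB 0 0). Qed.

Lemma RS_bound N f B x y : bker f B -> `|RS N f x y| <= B.
Proof.
move=> fB; have B0 := bker_ge0 fB; have {}fB := fB.2.
case: N => [|N]; first by rewrite /RS big_ord0 mulr0 normr0.
rewrite /RS normrM ger0_norm ?exprn_ge0// -[leRHS](@mulKf _ (N.+1%:R ^+ 2)) ?expf_neq0//.
rewrite exprVn ler_wpM2l ?invr_ge0 ?exprn_ge0//.
apply: (le_trans (ler_norm_sum _ _ _)).
apply: (@le_trans _ _ (\sum_(i < N.+1) \sum_(j < N.+1) B)).
  apply: ler_sum => i _; apply: (le_trans (ler_norm_sum _ _ _)).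
  rewrite big_mkcond; apply: ler_sum => j _; case: ifP => _ //; exact: fB.
rewrite (eq_bigr (fun=> N.+1%:R * B)); last by move=> i _; rewrite sumr_const card_ord mulr_natl.
by rewrite sumr_const card_ord -[leLHS]mulr_natl expr2 mulrA.
Qed.

Lemma RSB N f g x y : RS N (fun a b => f a b - g a b) x y = RS N f x y - RS N g x y.
Proof.
rewrite /RS -mulrBr -sumrB; apply: congr1; apply: eq_bigr => i _; by rewrite -sumrB.
Qed.

Lemma RSZ N c f x y : RS N (fun a b => c * f a b) x y = c * RS N f x y.
Proof.
rewrite /RS [RHS]mulrCA; congr (_ * _); rewrite mulr_sumr; apply: eq_bigr => i _; by rewrite mulr_sumr.
Qed.

Lemma RS_shift N c f x y a b : RS N f (fun k => c * (x k - a)) (fun k => c * (y k - b)) =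
  RS N (rescale c f) x y.
Proof.
rewrite /RS; congr (_ * _); apply: eq_bigr => i _; apply: eq_bigr => j _.
by rewrite /rescale -!mulrBr !opprB !addrA !subrK.
Qed.

Lemma cylinder_RS N f : measurable_fun setT (fun p : R * R => f p.1 p.2) -> cylinder N (RS N f).
Proof.
move=> mf; apply: (cylinder_comp (g := fun x => N%:R^-1 ^+ 2 * x)).
  by apply: measurable_funM => //; exact: measurable_cst.
apply: cylinder_sum => i _; apply: cylinder_sum => j _.
have := @cylinder_incr R N f 1 j i mf (ltnW (ltn_ord j)) (ltnW (ltn_ord i)).
by congr cylinder; apply/funext => x; apply/funext => y; rewrite !mul1r.
Qed.

Section OneSetup.
Context d (Omega : measurableType d).
Implicit Types (X : R -> Omega -> R) (A : Omega -> R).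

Lemma siltofB f g X1 X2 A A' : siltof f X1 X2 A -> siltof g X1 X2 A' ->
  siltof (fun x y => f x y - g x y) X1 X2 (fun w => A w - A' w).
Proof. by move=> SA SA' w; under eq_fun do rewrite RSB; apply: cvgB. Qed.

Lemma siltofZ c f X1 X2 A : siltof f X1 X2 A ->
  siltof (fun x y => c * f x y) X1 X2 (fun w => c * A w).
Proof. by move=> SA w; under eq_fun do rewrite RSZ; apply: cvgM => //; exact: cvg_cst. Qed.

Lemma siltof_sub (u : nat -> nat) f X1 X2 A w : siltof f X1 X2 A -> (forall n, (n <= u n)%N) ->
  RS (u N).+1 f (grid (u N).+1 X1 w) (grid (u N).+1 X2 w) @[N --> \oo] --> A w.
Proof.
move=> SA un; apply: (cvg_comp u (fun N => RS N.+1 f (grid N.+1 X1 w) (grid N.+1 X2 w)) _ (SA w)).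
by move=> S [n _ nS]; exists n => // m /= nm; apply: nS => /=; exact: leq_trans nm (un m).
Qed.

Lemma silt_exists (P : probability Omega R) f B X1 X2 : planar_BM P X1 X2 -> bker f B -> (forall x y, 0 <= f x y) ->
  siltof f X1 X2 (fun w => fine (\int[mu]_(s in `[0%R, 1%R]%classic)
          \int[mu]_(u in `[0%R, s]%classic) (f (X1 s w - X1 u w) (X2 s w - X2 u w))%:E)%E).
Proof.
move=> [_ _ cX _] [cf fB] f0 w.
pose k s u := f (X1 (Num.max 0 s) w - X1 (Num.max 0 u) w) (X2 (Num.max 0 s) w - X2 (Num.max 0 u) w).
have [/within_continuous_max0 c1 /within_continuous_max0 c2] := cX w.
have ck : continuous (fun p : R * R => k p.1 p.2).
  move=> p.
  have fa : X1 (Num.max 0 q.1) w - X1 (Num.max 0 q.2) w @[q --> p] -->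
     X1 (Num.max 0 p.1) w - X1 (Num.max 0 p.2) w.
    apply: cvgB; first exact: (cvg_comp _ (fun t => X1 (Num.max 0 t) w) cvg_fst (c1 p.1)).
    exact: (cvg_comp _ (fun t => X1 (Num.max 0 t) w) cvg_snd (c1 p.2)).
  have fb : X2 (Num.max 0 q.1) w - X2 (Num.max 0 q.2) w @[q --> p] -->
     X2 (Num.max 0 p.1) w - X2 (Num.max 0 p.2) w.
    apply: cvgB; first exact: (cvg_comp _ (fun t => X2 (Num.max 0 t) w) cvg_fst (c2 p.1)).
    exact: (cvg_comp _ (fun t => X2 (Num.max 0 t) w) cvg_snd (c2 p.2)).
  exact: (cvg_comp _ (fun p => f p.1 p.2) (cvg_pair fa fb) (cf (_, _))).
have kB s u : 0 <= k s u <= B by rewrite f0 (le_trans (ler_norm _))// fB.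
have := riemann_triangle ck kB.
rewrite (_ : fine _ = fine (\int[mu]_(s in `[0%R, 1%R]%classic) \int[mu]_(u in `[0%R, s]%classic) (f (X1 s w - X1 u w) (X2 s w - X2 u w))%:E)%E); last first.
  congr fine; apply: eq_integral => s; rewrite inE/= in_itv/= => /andP[s0 s1].
  apply: eq_integral => u; rewrite inE/= in_itv/= => /andP[u0 us].
  by rewrite /k !max_r.
apply: cvg_trans; apply: near_eq_cvg; apply: nearW => N /=; rewrite /RS; congr (_ * _).
apply: eq_bigr => i _; apply: eq_bigr => j _.
by rewrite /k /grid !max_r// divr_ge0.
Qed.

Section Laws.
Variables (P : probability Omega R) (f : R -> R -> R) (B : R) (X1 X2 : R -> Omega -> R) (A : Omega -> R).
Hypotheses (BX : planar_BM P X1 X2) (fB : bker f B) (SA : siltof f X1 X2 A).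

Lemma RS_grid_measurable N : measurable_fun setT (fun w => RS N f (grid N X1 w) (grid N X2 w)).
Proof.
have := (cylinder_RS N (continuous_plane_measurable fB.1)).2 d Omega (fun k => X1 (k%:R / N%:R)) (fun k => X2 (k%:R / N%:R)).
by apply => k; have [+ _ _ _] := BX; apply.
Qed.

Lemma siltof_bound w : `|A w| <= B.
Proof.
have h : `|RS N.+1 f (grid N.+1 X1 w) (grid N.+1 X2 w)| @[N --> \oo] --> `|A w|.
  by apply: cvg_norm; exact: SA.
by apply: (cvgr_to_le h); apply: nearW => N; exact: RS_bound.
Qed.

Lemma siltof_measurable : measurable_fun setT A.
Proof. by apply: (measurable_fun_cvg (fun N => RS_grid_measurable N.+1)) => w _; exact: SA. Qed.

Lemma siltof_bmf : bmf A.
Proof. by split; [exact: siltof_measurable|exists B; exact: siltof_bound]. Qed.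

Lemma siltof_expect_lim (u : nat -> nat) (g : R -> R) : continuous g -> (forall n, (n <= u n)%N) ->
  \int[P]_w g (RS (u N).+1 f (grid (u N).+1 X1 w) (grid (u N).+1 X2 w)) @[N --> \oo] --> \int[P]_w g (A w).
Proof.
move=> cg un; have [L gL] := continuous_bounded_itv B cg.
have mg : measurable_fun setT g by exact: continuous_measurable_fun.
apply: (@expect_lim _ _ _ P (fun N w => g (RS (u N).+1 f (grid (u N).+1 X1 w) (grid (u N).+1 X2 w))) (fun w => g (A w)) L).
- by move=> N; exact: (measurableT_comp mg (RS_grid_measurable _)).
- exact: (measurableT_comp mg siltof_measurable).
- by move=> N w; apply: gL; exact: RS_bound.
- by apply: aeW => w; apply: continuous_cvg; [exact: cg|exact: siltof_sub].
Qed.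

End Laws.
End OneSetup.

(** Riemann sums see finitely many increments, whose law is the same on both spaces; bounded
    convergence carries the equality to the limit. *)
Lemma siltof_law d (Omega : measurableType d) (P : probability Omega R) X1 X2 A
    d' (Omega' : measurableType d') (P' : probability Omega' R) X1' X2' A' f B (g : R -> R) :
  planar_BM P X1 X2 -> planar_BM P' X1' X2' -> bker f B -> continuous g ->
  siltof f X1 X2 A -> siltof f X1' X2' A' ->
  \int[P]_w g (A w) = \int[P']_w g (A' w).
Proof.
move=> BX BX' fB cg SA SA'.
have h := siltof_expect_lim BX fB SA (u := id) cg (fun n => leqnn n).
have h' := siltof_expect_lim BX' fB SA' (u := id) cg (fun n => leqnn n).
rewrite (_ : (fun N => _) = (fun N => \int[P]_w g (RS N.+1 f (grid N.+1 X1 w) (grid N.+1 X2 w)))) in h'.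
  exact: (cvg_unique _ h h').
apply/funext => N.
have [L gL] := continuous_bounded_itv B cg.
have mg : measurable_fun setT g by exact: continuous_measurable_fun.
have N0 : 0 < N.+1%:R^-1 :> R by rewrite invr_gt0.
apply: (lattice_law_bounded (F := fun x y => g (RS N.+1 f x y)) (K := L) (BM_lattice N.+1 BX' N0) (BM_lattice N.+1 BX N0)).
  by apply: cylinder_comp => //; apply: cylinder_RS; exact: continuous_plane_measurable fB.1.
by move=> x y; apply: gL; exact: RS_bound.
Qed.

(* Brownian scaling of the [b]-th of [n] time blocks to unit time. *)
Definition blk d (Omega : measurableType d) (n b : nat) (X : R -> Omega -> R) (t : R) (w : Omega) : R :=
  Num.sqrt n%:R * (X (b%:R / n%:R + t / Num.sqrt n%:R ^+ 2) w - X (b%:R / n%:R) w).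

Lemma blk_BM d (Omega : measurableType d) (P : probability Omega R) X1 X2 n b :
  planar_BM P X1 X2 -> (0 < n)%N -> planar_BM P (blk n b X1) (blk n b X2).
Proof. by move=> BX n0; apply: BM_restart BX _ _; [exact: divr_ge0|rewrite sqrtr_gt0 ltr0n]. Qed.

Lemma blk_grid d (Omega : measurableType d) (X : R -> Omega -> R) n b M w k : (0 < n)%N -> (0 < M)%N ->
  grid M (blk n b X) w k =
  Num.sqrt n%:R * (grid (n * M) X w (b * M + k) - grid (n * M) X w (b * M)).
Proof.
move=> n0 M0; have n0' : n%:R != 0 :> R by rewrite pnatr_eq0 -lt0n.
have M0' : M%:R != 0 :> R by rewrite pnatr_eq0 -lt0n.
rewrite /grid /blk sqr_sqrtr// natrD !natrM.
by congr (_ * (X _ w - X _ w)); field; rewrite n0' M0'.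
Qed.

(** On a grid of [n * N.+1] steps the Riemann sums of the blocks use disjoint sets of increments, so
    they are independent already before the limit. *)
Lemma siltof_indep d (Omega : measurableType d) (P : probability Omega R) X1 X2 n (A : nat -> Omega -> R) f B
    (g : R -> R) :
  planar_BM P X1 X2 -> (0 < n)%N -> bker f B -> continuous g ->
  (forall b, siltof f (blk n b X1) (blk n b X2) (A b)) ->
  \int[P]_w (\prod_(b < n) g (A b w)) = \prod_(b < n) \int[P]_w g (A b w).
Proof.
move=> BX n0 fB cg SA; have [L gL] := continuous_bounded_itv B cg.
have mg : measurable_fun setT g by exact: continuous_measurable_fun.
have L0 : 0 <= L by apply: le_trans (normr_ge0 _) (gL 0 _); rewrite normr0 (bker_ge0 fB).
pose Z N b w := g (RS N.+1 f (grid N.+1 (blk n b X1) w) (grid N.+1 (blk n b X2) w)).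
have ZL N b w : `|Z N b w| <= L by apply: gL; exact: RS_bound.
have mZ N b : measurable_fun setT (Z N b).
  exact: (measurableT_comp mg (RS_grid_measurable (blk_BM b BX n0) fB _)).
have SAb b : bmf (fun w => g (A b w)) by apply: bmf_comp => //; exact: (siltof_bmf (blk_BM b BX n0) fB).
have ZA w b : Z N b w @[N --> \oo] --> g (A b w).
  by apply: continuous_cvg; [exact: cg|exact: SA].
have l1 : \int[P]_w (\prod_(b < n) Z N b w) @[N --> \oo] --> \int[P]_w (\prod_(b < n) g (A b w)).
  apply: (@expect_lim _ _ _ P (fun N w => \prod_(b < n) Z N b w) (fun w => \prod_(b < n) g (A b w)) (L ^+ n)).
  - move=> N; suff : bmf (fun w => \prod_(b < n) Z N b w) by case.
    by apply: bmf_prod => b; split; [exact: mZ|exists L; exact: ZL].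
  - suff : bmf (fun w => \prod_(b < n) g (A b w)) by case.
    by apply: bmf_prod => b; exact: SAb.
  - move=> N w; rewrite normr_prod; apply: le_trans (_ : \prod_(b < n) L <= _).
      by apply: ler_prod => b _; rewrite normr_ge0 ZL.
    by rewrite prodr_const card_ord.
  - by apply: aeW => w; apply: cvg_big => [|b _]; [exact: mul_continuous|exact: ZA].
have l2 : \prod_(b < n) \int[P]_w Z N b w @[N --> \oo] --> \prod_(b < n) \int[P]_w g (A b w).
  apply: cvg_big => [|b _]; first exact: mul_continuous.
  exact: (siltof_expect_lim (blk_BM b BX n0) fB (SA b) (u := id) cg (fun n => leqnn n)).
rewrite (_ : (fun N => \prod_(b < n) _) = (fun N => \int[P]_w (\prod_(b < n) Z N b w))) in l2.
  exact: (cvg_unique _ l1 l2).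
apply/funext => N; apply/esym.
have N0 : 0 < (n * N.+1)%:R^-1 :> R by rewrite invr_gt0 ltr0n muln_gt0 n0.
have LW := BM_lattice (n * N.+1) BX N0.
have := lattice_blocks (M := N.+1) (m := n) (K := L) (G := fun _ x y => g (RS N.+1 f x y)) (Num.sqrt n%:R) LW (leqnn _).
move=> /(_ (fun _ => cylinder_comp mg (cylinder_RS N.+1 (continuous_plane_measurable fB.1)))).
move=> /(_ (fun _ x y => gL _ (RS_bound N.+1 x y fB))) /=.
have E : Z N = fun b w => g (RS N.+1 f (fun k => Num.sqrt n%:R * (X1 ((b * N.+1 + k)%:R / (n * N.+1)%:R) w - X1 ((b * N.+1)%:R / (n * N.+1)%:R) w))
   (fun k => Num.sqrt n%:R * (X2 ((b * N.+1 + k)%:R / (n * N.+1)%:R) w - X2 ((b * N.+1)%:R / (n * N.+1)%:R) w))).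
  apply/funext => b; apply/funext => w.
  rewrite /Z; congr (g (RS _ _ _ _)); apply/funext => k; exact: blk_grid.
by rewrite E.
Qed.

Definition tri (N : nat) (F : nat -> nat -> R) : R := \sum_(i < N) \sum_(j < N | (j < i)%N) F i j.

Lemma triE N F : tri N F = \sum_(i < N) \sum_(j < i) F i j.
Proof.
by apply: eq_bigr => i _; rewrite (big_ord_widen _ (fun j => F i j) (ltnW (ltn_ord i))).
Qed.

(** The large triangle consists of [n] triangles of side [M] along the diagonal and of the
    rectangles off it. *)
Lemma tri_block n M F : tri (n * M) F =
  \sum_(b < n) (tri M (fun i j => F (b * M + i)%N (b * M + j)%N) +
    \sum_(i < M) \sum_(j < b * M) F (b * M + i)%N j).
Proof.
elim: n => [|n IH]; first by rewrite mul0n /tri !big_ord0.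
rewrite big_ord_recr/= -IH mulSn addnC triE big_split_ord/= triE; congr (_ + _).
rewrite triE -big_split/=; apply: eq_bigr => i _.
by rewrite big_split_ord/= addrC.
Qed.

Lemma RS_block n M f x y : (0 < n)%N -> (0 < M)%N ->
  RS (n * M) f x y = n%:R^-1 ^+ 2 * (\sum_(b < n)
    RS M f (fun k => x (b * M + k)%N) (fun k => y (b * M + k)%N)) +
  (n * M)%:R^-1 ^+ 2 * (\sum_(b < n) \sum_(i < M) \sum_(j < b * M)
     f (x (b * M + i)%N - x j) (y (b * M + i)%N - y j)).
Proof.
move=> n0 M0; rewrite /RS -/(tri _ (fun i j => f (x i - x j) (y i - y j))) tri_block big_split/= mulrDr.
congr (_ + _); rewrite -mulr_sumr mulrA; congr (_ * _).
by rewrite natrM invfM exprMn.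
Qed.

Lemma RS_grid_blk d (Omega : measurableType d) (X1 X2 : R -> Omega -> R) f n b M w : (0 < n)%N -> (0 < M)%N ->
  RS M (rescale (Num.sqrt n%:R)^-1 f) (grid M (blk n b X1) w) (grid M (blk n b X2) w) =
  RS M f (fun k => grid (n * M) X1 w (b * M + k)) (fun k => grid (n * M) X2 w (b * M + k)).
Proof.
move=> n0 M0.
have n0' : Num.sqrt n%:R != 0 :> R by rewrite gt_eqF// sqrtr_gt0 ltr0n.
rewrite -(RS_shift M _ f (grid M (blk n b X1) w) (grid M (blk n b X2) w)
   (- (Num.sqrt n%:R * grid (n * M) X1 w (b * M))) (- (Num.sqrt n%:R * grid (n * M) X2 w (b * M)))).
by congr RS; apply/funext => k; rewrite blk_grid// opprK -mulrDr subrK mulKf.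
Qed.

(** The rectangles off the diagonal are nonnegative and are dropped. [rescale] undoes the spatial
    scaling in [blk], and the squared inverse of [n] comes from the two time variables, each
    compressed by [n]. *)
Lemma siltof_split d (Omega : measurableType d) (X1 X2 : R -> Omega -> R) n A (Ab : nat -> Omega -> R) f w :
  (0 < n)%N -> (forall x y, 0 <= f x y) -> siltof f X1 X2 A ->
  (forall b, siltof (rescale (Num.sqrt n%:R)^-1 f) (blk n b X1) (blk n b X2) (Ab b)) ->
  n%:R^-1 ^+ 2 * (\sum_(b < n) Ab b w) <= A w.
Proof.
move=> n0 f0 SA SAb.
have un m : (m <= (n * m.+1).-1)%N by case: n n0 {SAb} => // n _; lia.
have h := siltof_sub (w := w) SA un.
have h' : n%:R^-1 ^+ 2 * (\sum_(b < n) RS M.+1 (rescale (Num.sqrt n%:R)^-1 f) (grid M.+1 (blk n b X1) w) (grid M.+1 (blk n b X2) w)) @[M --> \oo] -->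
   n%:R^-1 ^+ 2 * (\sum_(b < n) Ab b w).
  apply: cvgM; first exact: cvg_cst.
  by apply: cvg_big => [|b _]; [exact: add_continuous|exact: SAb].
apply: (ler_cvg_to h' h); apply: nearW => M.
rewrite prednK ?muln_gt0 ?n0// RS_block//; under eq_bigr do rewrite RS_grid_blk//.
by rewrite lerDl mulr_ge0 ?exprn_ge0// !sumr_ge0// => b _; rewrite sumr_ge0// => i _; rewrite sumr_ge0.
Qed.

End RiemannSILT.

(** * Moments of the cross term *)

Section ProductExpectation.
Context d (T : measurableType d) (R : realType) (P : probability T R).

Lemma bmf_slice1 (G : T * T -> R) w : bmf G -> bmf (fun w' => G (w, w')).
Proof.
move=> [mG [K GK]]; split; last by exists K.
by apply: (measurableT_comp mG); exact: measurable_pair1.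
Qed.

Lemma bmf_swap (G : T * T -> R) : bmf G -> bmf (fun z => G (z.2, z.1)).
Proof.
move=> [mG [K GK]]; split; last by exists K.
apply: (measurableT_comp mG); exact: measurable_swap.
Qed.

Lemma bmf_inner (G : T * T -> R) : bmf G -> bmf (fun w => \int[P]_w' G (w, w')).
Proof.
move=> bG; have [mG [K GK]] := bG; split; last first.
  by exists K => w; apply: expect_norm_le => //; exact: (bmf_slice1 w bG).1.
pose H (z : T * T) := (G z + K)%:E.
have mH : measurable_fun setT H.
  by apply/measurable_EFinP; apply: measurable_funD => //; exact: measurable_cst.
have H0 z : (0 <= H z)%E by rewrite lee_fin -lerBlDr sub0r; have := GK z; rewrite ler_norml => /andP[].
have mF := @measurable_fun_fubini_tonelli_F _ _ T T R P H mH H0.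
have -> : (fun w => \int[P]_w' G (w, w')) = (fun w => fine (fubini_F P H w) - K).
  apply/funext => w; rewrite -[fine _]/(\int[P]_w' (G (w, w') + K)).
  by rewrite expectD ?expect_cst ?addrK//; [exact: bmf_slice1|exact: bmf_cst].
apply: measurable_funB; last exact: measurable_cst.
by apply: measurableT_comp => //; exact: measurable_fine.
Qed.

Lemma expect_swap (G : T * T -> R) : bmf G ->
  \int[P]_w \int[P]_w' G (w, w') = \int[P]_w' \int[P]_w G (w, w').
Proof.
move=> bG.
have iG : (P \x P)%E.-integrable setT (EFin \o G) by exact: bmf_integrable.
have E1 w : (\int[P]_w' (G (w, w'))%:E)%E = (\int[P]_w' G (w, w'))%:E.
  by rewrite /Rintegral fineK//; apply: integrable_fin_num => //; exact: (bmf_integrable P (bmf_slice1 w bG)).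
have E2 w' : (\int[P]_w (G (w, w'))%:E)%E = (\int[P]_w G (w, w'))%:E.
  rewrite /Rintegral fineK//; apply: integrable_fin_num => //.
  exact: (bmf_integrable P (bmf_slice1 w' (bmf_swap bG))).
rewrite [LHS]/Rintegral [RHS]/Rintegral; congr fine.
under eq_integral do rewrite -E1; under [RHS]eq_integral do rewrite -E2.
exact: (Fubini iG).
Qed.

Lemma expect_pair_le (G : T * T -> R) (h : T -> R) (K : R) : bmf G -> bmf h ->
  (forall w, `|\int[P]_w' G (w, w')| <= K * `|h w|) ->
  `|\int[P]_w \int[P]_w' G (w, w')| <= K * \int[P]_w `|h w|.
Proof.
move=> bG bh Gh; have bI := bmf_inner bG.
have bn (u : T -> R) : bmf u -> bmf (fun w => `|u w|).
  by apply: bmf_comp => x; exact: (@norm_continuous _ R^o).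
apply: (le_trans (le_normr_Rintegral measurableT (bmf_integrable P bI))).
rewrite -expectZ; last exact: bn.
by apply: expect_le => //; [exact: bn|apply: bmfZ; exact: bn].
Qed.

End ProductExpectation.

Section PairBound.
Context (R : realType) d (Omega : measurableType d) (P : probability Omega R).
Variables (N : nat) (s : R) (W1 W2 : nat -> Omega -> R) (f : R -> R -> R) (B : R).
Hypotheses (LW : lattice P N s W1 W2) (fB : bker f B).

Lemma bmf_increment (x0 y0 : R) j k :
  bmf (fun w => f (x0 + (W1 k w - W1 j w)) (y0 + (W2 k w - W2 j w))).
Proof.
split; last by exists B => w; exact: fB.2.
have [mW _ _] := LW; have [a1 a2] := mW k; have [b1 b2] := mW j.
apply: (measurable_plane_comp (continuous_plane_measurable fB.1)).
  by apply: measurable_funD; [exact: measurable_cst|exact: measurable_funB].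
by apply: measurable_funD; [exact: measurable_cst|exact: measurable_funB].
Qed.

Lemma bmf_increment0 j k : bmf (fun w => f (W1 k w - W1 j w) (W2 k w - W2 j w)).
Proof.
by have := bmf_increment 0 0 j k; under eq_fun do rewrite !add0r.
Qed.

Variables (kap lam : nat -> R).
Hypothesis f_kap : forall j k, (j < k)%N -> (k <= N)%N -> forall x0 y0,
  `|\int[P]_w f (x0 + (W1 k w - W1 j w)) (y0 + (W2 k w - W2 j w))| <= kap (k - j)%N.
Hypothesis f_lam : forall j k, (j < k)%N -> (k <= N)%N ->
  \int[P]_w `|f (W1 k w - W1 j w) (W2 k w - W2 j w)| <= lam (k - j)%N.

Lemma kap_ge0 j k : (j < k)%N -> (k <= N)%N -> 0 <= kap (k - j)%N.
Proof. by move=> jk kN; apply: le_trans (normr_ge0 _) (f_kap jk kN 0 0). Qed.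

Let pair j k j' k' (x y : nat -> R) := f (x k - x j) (y k - y j) * f (x k' - x j') (y k' - y j').

Let pair_cyl j k j' k' : (j <= N)%N -> (k <= N)%N -> (j' <= N)%N -> (k' <= N)%N ->
  cylinder N (pair j k j' k').
Proof.
move=> jN kN jN' kN'; have mf := continuous_plane_measurable fB.1.
apply: cylinderM.
  have := @cylinder_incr R N f 1 j k mf jN kN.
  by congr cylinder; apply/funext => x; apply/funext => y; rewrite !mul1r.
have := @cylinder_incr R N f 1 j' k' mf jN' kN'.
by congr cylinder; apply/funext => x; apply/funext => y; rewrite !mul1r.
Qed.

Let pair_bound j k j' k' x y : `|pair j k j' k' x y| <= B * B.
Proof. by rewrite normrM ler_pM// fB.2. Qed.

Let bmf_spliced F K : cylinder N F -> (forall x y, `|F x y| <= B * B) ->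
  bmf (fun z => F (splice K W1 ^~ z) (splice K W2 ^~ z)).
Proof.
move=> cF FB; split; last by exists (B * B) => z; exact: FB.
by apply: cF.2 => k; have [mS _ _] := lattice_splice K LW; exact: mS.
Qed.

(** Conditioning at step [k]: the second increment still has the part from [k] to [k'] ahead of it,
    whose mean is at most [kap] whatever the offset. The first factor then enters only through its
    absolute mean [lam]. *)
Lemma pair_right j k j' k' : (j < k)%N -> (j' <= k)%N -> (k < k')%N -> (k' <= N)%N ->
  `|\int[P]_w (f (W1 k w - W1 j w) (W2 k w - W2 j w) * f (W1 k' w - W1 j' w) (W2 k' w - W2 j' w))|
   <= kap (k' - k) * lam (k - j).
Proof.
move=> jk j'k kk' k'N; have kN : (k <= N)%N by lia.
have cF : cylinder N (pair j k j' k') by apply: pair_cyl; lia.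
rewrite (lattice_decouple_bounded k LW cF (pair_bound _ _ _ _)).
have := bmf_spliced k cF (pair_bound _ _ _ _) => bG.
apply: (le_trans (expect_pair_le (h := fun w => f (W1 k w - W1 j w) (W2 k w - W2 j w)) (K := kap (k' - k)) bG (bmf_increment0 j k) _)).
  move=> w; rewrite /pair.
  have E w' : f (splice k W1 k (w, w') - splice k W1 j (w, w')) (splice k W2 k (w, w') - splice k W2 j (w, w')) *
    f (splice k W1 k' (w, w') - splice k W1 j' (w, w')) (splice k W2 k' (w, w') - splice k W2 j' (w, w')) =
    f (W1 k w - W1 j w) (W2 k w - W2 j w) *
    f ((W1 k w - W1 j' w) + (W1 k' w' - W1 k w')) ((W2 k w - W2 j' w) + (W2 k' w' - W2 k w')).
    rewrite !(splice_left _ _ (leqnn k)) !(splice_left _ _ (ltnW jk)) !(splice_left _ _ j'k) !(splice_right _ _ (ltnW kk'))/=.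
    by congr (_ * f _ _); ring.
  under eq_Rintegral do rewrite E.
  by rewrite expectZ ?normrM 1?mulrC ?ler_wpM2r//; [exact: f_kap|exact: bmf_increment].
by rewrite ler_wpM2l//; [exact: kap_ge0|exact: f_lam].
Qed.

(** The mirror image: the steps before [j'] enter the first increment alone, so they are averaged
    out first while the later steps are kept fixed. *)
Lemma pair_left j k j' k' : (j < j')%N -> (j' <= k)%N -> (j' < k')%N -> (k <= N)%N -> (k' <= N)%N ->
  `|\int[P]_w (f (W1 k w - W1 j w) (W2 k w - W2 j w) * f (W1 k' w - W1 j' w) (W2 k' w - W2 j' w))|
   <= kap (j' - j) * lam (k' - j').
Proof.
move=> jj' j'k j'k' kN k'N.
have cF : cylinder N (pair j k j' k') by apply: pair_cyl; lia.
rewrite (lattice_decouple_bounded j' LW cF (pair_bound _ _ _ _)).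
have := bmf_spliced j' cF (pair_bound _ _ _ _) => bG.
rewrite (expect_swap P bG).
apply: (le_trans (expect_pair_le (h := fun w => f (W1 k' w - W1 j' w) (W2 k' w - W2 j' w)) (K := kap (j' - j)) (bmf_swap bG) (bmf_increment0 j' k') _)).
  move=> w'; rewrite /pair/=.
  have E w : f (splice j' W1 k (w, w') - splice j' W1 j (w, w')) (splice j' W2 k (w, w') - splice j' W2 j (w, w')) *
    f (splice j' W1 k' (w, w') - splice j' W1 j' (w, w')) (splice j' W2 k' (w, w') - splice j' W2 j' (w, w')) =
    f (W1 k' w' - W1 j' w') (W2 k' w' - W2 j' w') *
    f ((W1 k w' - W1 j' w') + (W1 j' w - W1 j w)) ((W2 k w' - W2 j' w') + (W2 j' w - W2 j w)).
    rewrite !(splice_right _ _ j'k) !(splice_left _ _ (ltnW jj')) !(splice_right _ _ (ltnW j'k')) !(splice_left _ _ (leqnn j'))/=.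
    by rewrite [LHS]mulrC; congr (f _ _ * f _ _); ring.
  under eq_Rintegral do rewrite E.
  rewrite expectZ ?normrM 1?mulrC ?ler_wpM2r//; last exact: bmf_increment.
  by apply: f_kap => //; lia.
rewrite ler_wpM2l//; last exact: f_lam.
by apply: kap_ge0 => //; lia.
Qed.

End PairBound.

(** * Sums of powers of the lags *)

Section PowerSums.
Context (R : realType).
Local Notation sqrt := (@Num.sqrt R).

Definition invsqrt (n : nat) : R := (sqrt n%:R)^-1.
(** The power -3/4. Conditional means are bounded by the lag to the power -3/2, and a geometric mean
    of two such bounds leaves half of the exponent for each index. *)
Definition invpow34 (n : nat) : R := (sqrt n%:R * sqrt (sqrt n%:R))^-1.
Local Notation rt4 n := (sqrt (sqrt n%:R)).

Lemma invsqrt_ge0 n : 0 <= invsqrt n.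
Proof. by rewrite invr_ge0 sqrtr_ge0. Qed.

Lemma invpow34_ge0 n : 0 <= invpow34 n.
Proof. by rewrite invr_ge0 mulr_ge0 ?sqrtr_ge0. Qed.

(** Since the inverse of 0 is 0, in a sum of the terms at [i - k] and [k - i] with truncated
    subtraction only the true distance counts. *)
Lemma invpow34_0 : invpow34 0 = 0.
Proof. by rewrite /invpow34 sqrtr0 mul0r invr0. Qed.

Lemma invsqrt_tele n : invsqrt n.+1 <= 2 * (sqrt n.+1%:R - sqrt n%:R).
Proof.
have a0 : 0 < sqrt n.+1%:R by rewrite sqrtr_gt0.
have b0 : 0 <= sqrt n%:R by exact: sqrtr_ge0.
have ab : sqrt n%:R <= sqrt n.+1%:R by rewrite ler_sqrt// ler_nat.
have a2 : sqrt n.+1%:R ^+ 2 = n%:R + 1 by rewrite sqr_sqrtr// natr1.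
have b2 : sqrt n%:R ^+ 2 = n%:R by rewrite sqr_sqrtr.
rewrite /invsqrt -[leLHS]mul1r ler_pdivrMr//; nra.
Qed.

Lemma invpow34_tele n : invpow34 n.+1 <= 4 * (rt4 n.+1 - rt4 n).
Proof.
rewrite /invpow34; set a := rt4 n.+1; set b := rt4 n.
have a0 : 0 < a by rewrite !sqrtr_gt0.
have b0 : 0 <= b by exact: sqrtr_ge0.
have ab : b <= a by rewrite ler_sqrt ?sqrtr_ge0// ler_sqrt// ler_nat.
have a2 : sqrt n.+1%:R = a ^+ 2 by rewrite sqr_sqrtr// sqrtr_ge0.
have a4 : a ^+ 4 = n%:R + 1 by rewrite (exprM a 2 2) -a2 sqr_sqrtr// natr1.
have b4 : b ^+ 4 = n%:R by rewrite (exprM b 2 2) /b !sqr_sqrtr// sqrtr_ge0.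
rewrite a2 -[leLHS]mul1r ler_pdivrMr ?mulr_gt0 ?exprn_gt0//.
have E : 1 = (a - b) * (a ^+ 3 + a ^+ 2 * b + a * b ^+ 2 + b ^+ 3).
  by transitivity (a ^+ 4 - b ^+ 4); [rewrite a4 b4; ring|ring].
have -> : 4 * (a - b) * (a ^+ 2 * a) = (a - b) * (4 * a ^+ 3) by ring.
rewrite [leLHS]E ler_wpM2l ?subr_ge0//.
have ba2 : b ^+ 2 <= a ^+ 2 by rewrite lerXn2r// nnegrE ltW.
have ba3 : b ^+ 3 <= a ^+ 3 by rewrite lerXn2r// nnegrE ltW.
have h1 : a ^+ 2 * b <= a ^+ 3 by rewrite [leRHS]exprSr ler_wpM2l// sqr_ge0.
have h2 : a * b ^+ 2 <= a ^+ 3 by rewrite [leRHS]exprS ler_wpM2l// ltW.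
lra.
Qed.

Lemma sum_tele_up (g h : nat -> R) m : (forall n, g n.+1 <= h n.+1 - h n) ->
  \sum_(i < m) g i.+1 <= h m - h 0%N.
Proof.
move=> gh; elim: m => [|m IH]; first by rewrite big_ord0 subrr.
by rewrite big_ord_recr/=; have := gh m; lra.
Qed.

Lemma sum_tele_down (g h : nat -> R) M m : g 0%N <= 0 -> (forall n, g n.+1 <= h n.+1 - h n) ->
  \sum_(i < m) g (M - i)%N <= h M - h (M - m)%N.
Proof.
move=> g0 gh; elim: m => [|m IH]; first by rewrite big_ord0 subn0 subrr.
rewrite big_ord_recr/=; have [mM|mM] := ltnP m M.
  have := gh (M - m.+1)%N; rewrite -subSn// subSS; lra.
have E : (M - m = 0)%N by lia.
have -> : (M - m.+1 = M - m)%N by lia.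
by move: IH; rewrite E; lra.
Qed.

Lemma sum_invsqrt M : \sum_(i < M) invsqrt i.+1 <= 2 * sqrt M%:R.
Proof.
have := @sum_tele_up invsqrt (fun n => 2 * sqrt n%:R) M.
rewrite sqrtr0 mulr0 subr0; apply=> n; rewrite -mulrBr; exact: invsqrt_tele.
Qed.

Lemma sum_invsqrt_rev M : \sum_(i < M) invsqrt (M - i) <= 2 * sqrt M%:R.
Proof.
have := @sum_tele_down invsqrt (fun n => 2 * sqrt n%:R) M M.
rewrite subnn sqrtr0 mulr0 subr0; apply; first by rewrite /invsqrt sqrtr0 invr0.
move=> n; rewrite -mulrBr; exact: invsqrt_tele.
Qed.

Lemma sum_invpow34 M i : (i < M)%N ->
  \sum_(k < M) (invpow34 (i - k) + invpow34 (k - i)) <= 8 * rt4 M.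
Proof.
move=> iM; rewrite big_split/=.
have mono m n : (m <= n)%N -> rt4 m <= rt4 n.
  by move=> mn; rewrite ler_sqrt ?sqrtr_ge0// ler_sqrt// ler_nat.
have te n : invpow34 n.+1 <= 4 * rt4 n.+1 - 4 * rt4 n by rewrite -mulrBr; exact: invpow34_tele.
have h1 := @sum_tele_down invpow34 (fun n => 4 * rt4 n) i M _ te.
have {}h1 : \sum_(k < M) invpow34 (i - k) <= 4 * rt4 i - 4 * rt4 (i - M)%N by apply: h1; rewrite invpow34_0.
have h2 m : \sum_(k < m.+1) invpow34 (k - i) <= 4 * rt4 (m - i)%N.
  elim: m => [|m IH]; first by rewrite big_ord1 sub0n invpow34_0 mulr_ge0// sqrtr_ge0.
  rewrite big_ord_recr/=; have [im|mi] := leqP i m.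
    by have := te (m - i)%N; rewrite -subSn//; lra.
  rewrite (_ : m.+1 - i = 0)%N; last by lia.
  by move: IH; rewrite invpow34_0 addr0 (_ : m - i = 0)%N//; lia.
have := h2 M.-1; rewrite prednK ?(leq_ltn_trans _ iM)//.
have := mono _ _ (ltnW iM); have := mono (M.-1 - i)%N M; have := sqrtr_ge0 (sqrt (i - M)%N%:R).
have e : (M.-1 - i <= M)%N by lia.
by move=> + /(_ e); lra.
Qed.

(** With p^2 = i + 1 and q^2 = M - j the lag is p^2 + q^2 - 1, which is at least p q because p, q >=
    1. The product form separates the two indices. *)
Lemma lag_le i j M : (j < M)%N -> (M + i - j)%N%:R^-1 <= invsqrt i.+1 * invsqrt (M - j).
Proof.
move=> jM; rewrite /invsqrt -invfM lef_pV2 ?posrE ?mulr_gt0 ?sqrtr_gt0 ?ltr0n//; [|lia|lia].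
have := sqr_sqrtr (ler0n R i.+1); have := sqr_sqrtr (ler0n R (M - j)).
set p := sqrt i.+1%:R; set q := sqrt (M - j)%N%:R => q2 p2.
have -> : (M + i - j)%N%:R = p ^+ 2 + q ^+ 2 - 1.
  by rewrite p2 q2 -natrD -(natrB _ (n := 1)); [congr (_%:R); lia|lia].
have h1 : 1 <= p ^+ 2 by rewrite p2 ler1n.
have h2 : 1 <= q ^+ 2 by rewrite q2 ler1n subn_gt0.
have := sqr_ge0 (p - q); nra.
Qed.

End PowerSums.

Section CrossMoment.
Context (R : realType) d (Omega : measurableType d) (P : probability Omega R).
Variables (M : nat) (s : R) (W1 W2 : nat -> Omega -> R) (f : R -> R -> R) (B C1 C2 : R).
Hypotheses (M0 : (0 < M)%N) (C1_ge0 : 0 <= C1) (C2_ge0 : 0 <= C2).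
Hypotheses (LW : lattice P (M + M) s W1 W2) (fB : bker f B).
Hypothesis f_kap : forall j k, (j < k)%N -> (k <= M + M)%N -> forall x0 y0,
  `|\int[P]_w f (x0 + (W1 k w - W1 j w)) (y0 + (W2 k w - W2 j w))| <= C1 * invpow34 R (k - j) ^+ 2.
Hypothesis f_lam : forall j k, (j < k)%N -> (k <= M + M)%N ->
  \int[P]_w `|f (W1 k w - W1 j w) (W2 k w - W2 j w)| <= C2 / (k - j)%:R.

Local Notation Y i j w := (f (W1 (M + i)%N w - W1 j w) (W2 (M + i)%N w - W2 j w)).
Local Notation lag i k := (invpow34 R (i - k) + invpow34 R (k - i)).
Let u (i j : nat) : R := invsqrt R i.+1 * invsqrt R (M - j).

Let lag_ge0 i k : 0 <= lag i k.
Proof. by rewrite addr_ge0 ?invpow34_ge0. Qed.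

Let u_ge0 i j : 0 <= u i j.
Proof. by rewrite mulr_ge0 ?invsqrt_ge0. Qed.

Let lag_ltn i k : (i < k)%N -> lag i k = invpow34 R (k - i).
Proof. by move=> ik; rewrite (_ : i - k = 0)%N ?invpow34_0 ?add0r//; lia. Qed.

Let lagC i k : lag i k = lag k i.
Proof. by rewrite addrC. Qed.

Let YY_right i j i' j' : (i < i')%N -> (i' < M)%N -> (j < M)%N -> (j' < M)%N ->
  `|\int[P]_w (Y i j w * Y i' j' w)| <= C1 * C2 * (lag i i' ^+ 2 * (u i j + u i' j')).
Proof.
move=> ii' iM jM jM'.
have := pair_right (j := j) (k := M + i) (j' := j') (k' := M + i') LW fB
  (kap := fun n => C1 * invpow34 R n ^+ 2) (lam := fun n => C2 / n%:R) f_kap f_lam.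
move=> h; apply: (le_trans (h _ _ _ _)); try lia.
rewrite (_ : (M + i' - (M + i)) = i' - i)%N; last by lia.
rewrite lag_ltn// mulrACA ler_wpM2l ?mulr_ge0// ler_wpM2l ?sqr_ge0//.
by rewrite (le_trans (lag_le R i jM))// lerDl.
Qed.

Let YY_left i j i' j' : (j < j')%N -> (i < M)%N -> (i' < M)%N -> (j' < M)%N ->
  `|\int[P]_w (Y i j w * Y i' j' w)| <= C1 * C2 * (lag j j' ^+ 2 * (u i j + u i' j')).
Proof.
move=> jj' iM iM' jM.
have := pair_left (j := j) (k := M + i) (j' := j') (k' := M + i') LW fB
  (kap := fun n => C1 * invpow34 R n ^+ 2) (lam := fun n => C2 / n%:R) f_kap f_lam.
move=> h; apply: (le_trans (h _ _ _ _ _)); try lia.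
rewrite lag_ltn// mulrACA ler_wpM2l ?mulr_ge0// ler_wpM2l ?sqr_ge0//.
by rewrite (le_trans (lag_le R i' jM))// lerDr.
Qed.

Let YYC i j i' j' : \int[P]_w (Y i j w * Y i' j' w) = \int[P]_w (Y i' j' w * Y i j w).
Proof. by apply: eq_Rintegral => w _; rewrite mulrC. Qed.

(** [YY_right] and [YY_left] bound the mixed moment by the square of either lag weight, hence by the
    product of the two, which separates the sums over [i], [i'] and over [j], [j']. When two indices
    agree their lag weight is 0, and the crude bound [B ^+ 2] takes over. *)
Let YY_bound i j i' j' : (i < M)%N -> (i' < M)%N -> (j < M)%N -> (j' < M)%N ->
  \int[P]_w (Y i j w * Y i' j' w) <=
  C1 * C2 * (lag i i' * lag j j' * (u i j + u i' j')) + B ^+ 2 * ((i == i')%:R + (j == j')%:R).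
Proof.
move=> iM iM' jM jM'; have bY i1 j1 : bmf (fun w => Y i1 j1 w) := bmf_increment0 LW fB j1 (M + i1).
have U0 : 0 <= u i j + u i' j' by rewrite addr_ge0.
have main0 : 0 <= C1 * C2 * (lag i i' * lag j j' * (u i j + u i' j')).
  by rewrite !mulr_ge0.
have triv : \int[P]_w (Y i j w * Y i' j' w) <= B ^+ 2.
  rewrite -(expect_cst P (B ^+ 2)); apply: expect_le; [exact: bmfM|exact: bmf_cst|move=> w].
  by rewrite (le_trans (ler_norm _))// normrM expr2 ler_pM// fB.2.
have B2 : 0 <= B ^+ 2 by exact: sqr_ge0.
have [E|ii'] := eqVneq i i'.
  by rewrite (le_trans triv)// -[leLHS]add0r lerD// ler_peMr//= lerDl.
have [E|jj'] := eqVneq j j'.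
  by rewrite (le_trans triv)// -[leLHS]add0r lerD//= add0r mulr1.
rewrite addr0 mulr0 addr0.
have hi : `|\int[P]_w (Y i j w * Y i' j' w)| <= C1 * C2 * (lag i i' ^+ 2 * (u i j + u i' j')).
  move: ii'; rewrite neq_ltn => /orP[ii'|ii']; first exact: YY_right.
  by rewrite YYC lagC [u i j + _]addrC; exact: YY_right.
have hj : `|\int[P]_w (Y i j w * Y i' j' w)| <= C1 * C2 * (lag j j' ^+ 2 * (u i j + u i' j')).
  move: jj'; rewrite neq_ltn => /orP[jj'|jj']; first exact: YY_left.
  by rewrite YYC lagC [u i j + _]addrC; exact: YY_left.
apply: (le_trans (ler_norm _)).
have [l|l] := leP (lag i i') (lag j j').
  apply: (le_trans hi); rewrite ler_wpM2l ?mulr_ge0// ler_wpM2r// expr2 ler_wpM2l//.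
apply: (le_trans hj); rewrite ler_wpM2l ?mulr_ge0// ler_wpM2r// expr2 ler_wpM2r// ltW//.
Qed.

Let sum4 (F G : nat -> nat -> R) :
  \sum_(i < M) \sum_(j < M) \sum_(i' < M) \sum_(j' < M) (F i i' * G j j') =
  (\sum_(i < M) \sum_(i' < M) F i i') * (\sum_(j < M) \sum_(j' < M) G j j').
Proof.
rewrite mulr_suml; apply: eq_bigr => i _; rewrite mulr_sumr; apply: eq_bigr => j _.
by rewrite mulr_suml; apply: eq_bigr => i' _; rewrite mulr_sumr.
Qed.

Let lag_sum (v : nat -> R) : (forall i, 0 <= v i) ->
  \sum_(i < M) \sum_(i' < M) (lag i i' * v i) <= 8 * Num.sqrt (Num.sqrt M%:R) * \sum_(i < M) v i.
Proof.
move=> v0; rewrite mulr_sumr; apply: ler_sum => i _; rewrite -mulr_suml ler_wpM2r//.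
exact: sum_invpow34.
Qed.

Let lag_sum' (v : nat -> R) : (forall i, 0 <= v i) ->
  \sum_(i < M) \sum_(i' < M) (lag i i' * v i') <= 8 * Num.sqrt (Num.sqrt M%:R) * \sum_(i < M) v i.
Proof.
move=> v0; rewrite exchange_big/=; under eq_bigr do under eq_bigr do rewrite lagC.
exact: lag_sum.
Qed.

(** Each of the four separated sums is at most 8 M^(1/4) times 2 M^(1/2); two products of two such
    sums give 2 * 16^2 = 512 times M^(3/2). Coincident indices contribute order M^3, negligible
    against the M^4 of the normalisation. *)
Lemma cross_second_moment :
  \int[P]_w (\sum_(i < M) \sum_(j < M) Y i j w) ^+ 2 <=
  512 * C1 * C2 * (M%:R * Num.sqrt M%:R) + 2 * B ^+ 2 * M%:R ^+ 3.
Proof.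
have bY i j : bmf (fun w => Y i j w) := bmf_increment0 LW fB j (M + i).
have -> : \int[P]_w (\sum_(i < M) \sum_(j < M) Y i j w) ^+ 2 =
  \sum_(i < M) \sum_(j < M) \sum_(i' < M) \sum_(j' < M) \int[P]_w (Y i j w * Y i' j' w).
  under eq_bigr => i _ do under eq_bigr => j _ do under eq_bigr => i' _ do
    (rewrite -expect_sum; last by move=> j'; exact: bmfM).
  under eq_bigr => i _ do under eq_bigr => j _ do
    (rewrite -expect_sum; last by move=> i'; apply: bmf_sum => j'; exact: bmfM).
  under eq_bigr => i _ do
    (rewrite -expect_sum; last by move=> j; apply: bmf_sum => i'; apply: bmf_sum => j'; exact: bmfM).
  rewrite -expect_sum; last by move=> i; apply: bmf_sum => j; apply: bmf_sum => i'; apply: bmf_sum => j'; exact: bmfM.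
  apply: eq_Rintegral => w _; rewrite expr2 mulr_suml; apply: eq_bigr => i _.
  rewrite mulr_suml; apply: eq_bigr => j _; rewrite mulr_sumr; apply: eq_bigr => i' _.
  by rewrite mulr_sumr.
pose v1 i := invsqrt R i.+1; pose v2 j := invsqrt R (M - j).
have v10 i : 0 <= v1 i by exact: invsqrt_ge0.
have v20 i : 0 <= v2 i by exact: invsqrt_ge0.
apply: (@le_trans _ _ (\sum_(i < M) \sum_(j < M) \sum_(i' < M) \sum_(j' < M)
   (C1 * C2 * ((lag i i' * v1 i) * (lag j j' * v2 j)) + C1 * C2 * ((lag i i' * v1 i') * (lag j j' * v2 j')) +
    (B ^+ 2 * ((i == i' :> nat)%:R * 1) + B ^+ 2 * (1 * (j == j' :> nat)%:R))))).
  apply: ler_sum => i _; apply: ler_sum => j _; apply: ler_sum => i' _; apply: ler_sum => j' _.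
  apply: (le_trans (YY_bound (ltn_ord i) (ltn_ord i') (ltn_ord j) (ltn_ord j'))).
  by rewrite le_eqVlt; apply/orP; left; apply/eqP; rewrite /u -/(v1 i) -/(v1 i') -/(v2 j) -/(v2 j'); ring.
have split4 (F G : nat -> nat -> nat -> nat -> R) :
  \sum_(i < M) \sum_(j < M) \sum_(i' < M) \sum_(j' < M) (F i j i' j' + G i j i' j') =
  \sum_(i < M) \sum_(j < M) \sum_(i' < M) \sum_(j' < M) F i j i' j' +
  \sum_(i < M) \sum_(j < M) \sum_(i' < M) \sum_(j' < M) G i j i' j'.
  rewrite -big_split; apply: eq_bigr => i _; rewrite -big_split; apply: eq_bigr => j _.
  by rewrite -big_split; apply: eq_bigr => i' _; rewrite -big_split.
have scale4 (c : R) (F : nat -> nat -> nat -> nat -> R) :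
  \sum_(i < M) \sum_(j < M) \sum_(i' < M) \sum_(j' < M) (c * F i j i' j') =
  c * (\sum_(i < M) \sum_(j < M) \sum_(i' < M) \sum_(j' < M) F i j i' j').
  rewrite mulr_sumr; apply: eq_bigr => i _; rewrite mulr_sumr; apply: eq_bigr => j _.
  by rewrite mulr_sumr; apply: eq_bigr => i' _; rewrite mulr_sumr.
rewrite (split4 (fun i j i' j' => C1 * C2 * ((lag i i' * v1 i) * (lag j j' * v2 j)) + C1 * C2 * ((lag i i' * v1 i') * (lag j j' * v2 j')))
  (fun i j i' j' => B ^+ 2 * ((i == i')%:R * 1) + B ^+ 2 * (1 * (j == j')%:R))).
rewrite (split4 (fun i j i' j' => C1 * C2 * ((lag i i' * v1 i) * (lag j j' * v2 j))) (fun i j i' j' => C1 * C2 * ((lag i i' * v1 i') * (lag j j' * v2 j')))).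
rewrite (split4 (fun i j i' j' => B ^+ 2 * ((i == i')%:R * 1)) (fun i j i' j' => B ^+ 2 * (1 * (j == j')%:R))).
rewrite (scale4 _ (fun i j i' j' => (lag i i' * v1 i) * (lag j j' * v2 j))).
rewrite (scale4 _ (fun i j i' j' => (lag i i' * v1 i') * (lag j j' * v2 j'))).
rewrite (scale4 _ (fun i j i' j' => (i == i')%:R * 1)) (scale4 _ (fun i j i' j' => 1 * (j == j')%:R)).
rewrite (sum4 (fun i i' => lag i i' * v1 i) (fun j j' => lag j j' * v2 j)).
rewrite (sum4 (fun i i' => lag i i' * v1 i') (fun j j' => lag j j' * v2 j')).
rewrite (sum4 (fun i i' => (i == i')%:R) (fun j j' => 1)) (sum4 (fun i i' => 1) (fun j j' => (j == j')%:R)).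
have diag : \sum_(i < M) \sum_(i' < M) (i == i' :> nat)%:R = M%:R :> R.
  rewrite -[RHS]mulr1 mulr_natl -[in RHS](card_ord M) -sumr_const; apply: eq_bigr => i _.
  rewrite (bigD1 i)//= eqxx big1 ?addr0// => j ji; case: eqP => // ij.
  by case/negP: ji; apply/eqP/val_inj.
have ones : \sum_(i < M) \sum_(i' < M) 1 = M%:R ^+ 2 :> R.
  rewrite (eq_bigr (fun=> M%:R)); last by move=> i _; rewrite sumr_const card_ord.
  by rewrite sumr_const card_ord -[LHS]mulr_natl expr2.
rewrite diag ones.
pose q : R := Num.sqrt (Num.sqrt M%:R); pose p : R := Num.sqrt M%:R; rewrite -/p.
have p0 : 0 <= p by exact: sqrtr_ge0.
have q0 : 0 <= q by exact: sqrtr_ge0.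
have p2 : p ^+ 2 = M%:R by rewrite sqr_sqrtr.
have q2 : q ^+ 2 = p by rewrite sqr_sqrtr.
have bnd v : (forall i, 0 <= v i) -> \sum_(i < M) v i <= 2 * p -> 8 * q * \sum_(i < M) v i <= 16 * (q * p).
  by move=> v0 vp; rewrite (le_trans (ler_wpM2l _ vp)) ?mulr_ge0//; lra.
have s1 := bnd v1 v10 (sum_invsqrt R M).
have s2 := bnd v2 v20 (sum_invsqrt_rev R M).
have prod_le a b : 0 <= a -> 0 <= b -> a <= 16 * (q * p) -> b <= 16 * (q * p) -> a * b <= 256 * (M%:R * p).
  move=> a0 b0 ha hb; rewrite (le_trans (ler_pM a0 b0 ha hb))// le_eqVlt -p2 -q2; apply/orP; left; apply/eqP; ring.
have nn (F : nat -> nat -> R) : (forall i j, 0 <= F i j) -> 0 <= \sum_(i < M) \sum_(j < M) F i j.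
  by move=> F0; rewrite sumr_ge0// => i _; rewrite sumr_ge0.
have t1 := prod_le _ _ (nn (fun i i' => lag i i' * v1 i) (fun i i' => mulr_ge0 (lag_ge0 i i') (v10 i)))
  (nn (fun j j' => lag j j' * v2 j) (fun i i' => mulr_ge0 (lag_ge0 i i') (v20 i)))
  (le_trans (lag_sum v10) s1) (le_trans (lag_sum v20) s2).
have t2 := prod_le _ _ (nn (fun i i' => lag i i' * v1 i') (fun i i' => mulr_ge0 (lag_ge0 i i') (v10 i')))
  (nn (fun j j' => lag j j' * v2 j') (fun i i' => mulr_ge0 (lag_ge0 i i') (v20 i')))
  (le_trans (lag_sum' v10) s1) (le_trans (lag_sum' v20) s2).
have C0 : 0 <= C1 * C2 by exact: mulr_ge0.
apply: (@le_trans _ _ (C1 * C2 * (256 * (M%:R * p)) + C1 * C2 * (256 * (M%:R * p)) + (B ^+ 2 * (M%:R * M%:R ^+ 2) + B ^+ 2 * (M%:R ^+ 2 * M%:R)))).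
  by rewrite lerD2r lerD// ler_wpM2l.
by rewrite le_eqVlt; apply/orP; left; apply/eqP; ring.
Qed.

End CrossMoment.

(** * Harmonic sums and the logarithm *)

Section Harmonic.
Context (R : realType).

Definition harmo (n : nat) : R := \sum_(i < n) i.+1%:R^-1.

Lemma harmoS n : harmo n.+1 = harmo n + n.+1%:R^-1.
Proof. by rewrite /harmo big_ord_recr. Qed.

Lemma sum_lag (g : nat -> R) n : \sum_(j < n) g (n - j)%N = \sum_(j < n) g j.+1.
Proof.
rewrite (reindex_inj rev_ord_inj); apply: eq_bigr => j _ /=; congr g.
by have := ltn_ord j; lia.
Qed.

Lemma tri_lag (g : nat -> R) N : tri N (fun i j => g (i - j)%N) = \sum_(i < N) \sum_(l < i) g l.+1.
Proof. by rewrite triE; apply: eq_bigr => i _; exact: sum_lag. Qed.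

Lemma tri_harmo N : tri N (fun i j => (i - j)%N%:R^-1) = N%:R * harmo N - N%:R.
Proof.
rewrite (tri_lag (fun l => l%:R^-1)); elim: N => [|N IH]; first by rewrite big_ord0 mul0r subr0.
rewrite big_ord_recr/= IH -/(harmo N) harmoS mulrDr divff// -natr1; ring.
Qed.

Lemma tri_ext N (F G : nat -> nat -> R) : (forall i j, (j < i)%N -> (i < N)%N -> F i j = G i j) ->
  tri N F = tri N G.
Proof.
by move=> FG; apply: eq_bigr => i _; apply: eq_bigr => j ji; exact: FG.
Qed.

(** The rectangles off the diagonal are the large triangle minus the small ones, so [tri_harmo] used
    twice gives their sum. *)
Lemma cross_harmo n M : \sum_(b < n) \sum_(i < M) \sum_(j < b * M) (b * M + i - j)%N%:R^-1 =
  (n * M)%:R * (harmo (n * M) - harmo M) :> R.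
Proof.
have := tri_block n M (fun i j => (i - j)%N%:R^-1 : R).
rewrite tri_harmo big_split/= (eq_bigr (fun=> tri M (fun i j => (i - j)%N%:R^-1))); last first.
  by move=> b _; apply: tri_ext => i j _ _; congr (_%:R^-1); lia.
rewrite sumr_const card_ord tri_harmo -mulr_natl => /esym/(canRL (addKr _)) ->.
by rewrite natrM; ring.
Qed.

Lemma ln_sub_ge (x y : R) : 0 < x -> 0 < y -> 1 - y / x <= ln x - ln y.
Proof.
move=> x0 y0; have := @le_ln1Dx R (y / x - 1).
have yx : 0 < y / x by exact: divr_gt0.
have -> : 1 + (y / x - 1) = y / x by ring.
by rewrite ltrBrDl subrr => /(_ yx); rewrite ln_div ?posrE//; lra.
Qed.

Lemma harmo_sub_le M K : (0 < M)%N -> (M <= K)%N -> harmo K - harmo M <= ln K%:R - ln M%:R.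
Proof.
move=> M0; elim: K => [|K IH] MK; first by lia.
have [e|MK'] := eqVneq M K.+1; first by rewrite e !subrr.
have {}MK' : (M <= K)%N by lia.
have K0 : 0 < K%:R :> R by rewrite ltr0n; lia.
have := ln_sub_ge (ltr0Sn R K) K0.
rewrite (_ : 1 - K%:R / K.+1%:R = K.+1%:R^-1).
  by move=> h; rewrite harmoS addrAC (le_trans (lerD (IH MK') h))// addrC addrA subrK.
by rewrite -natr1; field; rewrite natr1.
Qed.

Lemma harmo_sub_ge M K : (M <= K)%N -> ln K.+1%:R - ln M.+1%:R <= harmo K - harmo M.
Proof.
elim: K => [|K IH] MK; first by rewrite (_ : M = 0)%N ?subrr//; lia.
have [e|MK'] := eqVneq M K.+1; first by rewrite e !subrr.
have {}MK' : (M <= K)%N by lia.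
have := ln_sub_ge (ltr0Sn R K) (ltr0Sn R K.+1).
rewrite (_ : 1 - K.+2%:R / K.+1%:R = - K.+1%:R^-1).
  rewrite -lerN2 opprK opprB => h.
  by rewrite harmoS addrAC (le_trans _ (lerD (IH MK') h))// [leRHS]addrC addrA subrK.
by rewrite -[K.+2%:R]natr1; field.
Qed.

End Harmonic.

(** * Mean and second moment of the cross term *)

Section SplitMoments.
Context (R : realType) d (Omega : measurableType d) (P : probability Omega R) (X1 X2 : R -> Omega -> R).
Hypothesis BX : planar_BM P X1 X2.
Variables (f : R -> R -> R) (B : R) (A : Omega -> R).
Hypotheses (fB : bker f B) (SA : siltof f X1 X2 A).

(* [phi_eps] satisfies this with [c1 = c2 = 1]; for a difference of two families [c1] gains a factor [eps], by Lipschitz continuity of the heat kernel. *)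
Definition kernel_bound (c1 c2 : R) : Prop := forall u s : R, 0 <= u -> u < s -> s <= 1 ->
  (forall x0 y0, `|\int[P]_w f (x0 + (X1 s w - X1 u w)) (y0 + (X2 s w - X2 u w))| <=
     c1 / ((s - u) * Num.sqrt (s - u))) /\
  \int[P]_w `|f (X1 s w - X1 u w) (X2 s w - X2 u w)| <= c2 / (s - u).

Lemma siltof_mul n w : (0 < n)%N ->
  RS (n * M.+1) f (grid (n * M.+1) X1 w) (grid (n * M.+1) X2 w) @[M --> \oo] --> A w.
Proof.
move=> n0; have un m : (m <= (n * m.+1).-1)%N by case: n n0 => // n _; lia.
apply: cvg_trans (siltof_sub (w := w) SA un); apply: near_eq_cvg; apply: nearW => M.
by rewrite prednK// muln_gt0 n0.
Qed.

Let crossE n M w : (0 < n)%N -> (0 < M)%N ->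
  RS (n * M) f (grid (n * M) X1 w) (grid (n * M) X2 w) -
   n%:R^-1 ^+ 2 * (\sum_(b < n) RS M (rescale (Num.sqrt n%:R)^-1 f) (grid M (blk n b X1) w) (grid M (blk n b X2) w)) =
  (n * M)%:R^-1 ^+ 2 * (\sum_(b < n) \sum_(i < M) \sum_(j < b * M)
     f (grid (n * M) X1 w (b * M + i) - grid (n * M) X1 w j)
       (grid (n * M) X2 w (b * M + i) - grid (n * M) X2 w j)).
Proof.
move=> n0 M0; rewrite RS_block//.
rewrite (eq_bigr _ (fun (b : 'I_n) _ => RS_grid_blk X1 X2 f b w n0 M0)).
by rewrite addrAC subrr add0r.
Qed.

Let cross_cvg n (Ab : nat -> Omega -> R) w : (0 < n)%N ->
  (forall b, siltof (rescale (Num.sqrt n%:R)^-1 f) (blk n b X1) (blk n b X2) (Ab b)) ->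
  (n * M.+1)%:R^-1 ^+ 2 * (\sum_(b < n) \sum_(i < M.+1) \sum_(j < b * M.+1)
     f (grid (n * M.+1) X1 w (b * M.+1 + i) - grid (n * M.+1) X1 w j)
       (grid (n * M.+1) X2 w (b * M.+1 + i) - grid (n * M.+1) X2 w j)) @[M --> \oo] -->
  A w - n%:R^-1 ^+ 2 * (\sum_(b < n) Ab b w).
Proof.
move=> n0 SAb.
under eq_fun do rewrite -crossE//.
apply: cvgB; first exact: siltof_mul.
apply: cvgM; first exact: cvg_cst.
by apply: cvg_big => [|b _]; [exact: add_continuous|exact: SAb].
Qed.

Let crossM n M w := (n * M)%:R^-1 ^+ 2 * (\sum_(b < n) \sum_(i < M) \sum_(j < b * M)
     f (grid (n * M) X1 w (b * M + i) - grid (n * M) X1 w j)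
       (grid (n * M) X2 w (b * M + i) - grid (n * M) X2 w j)).

Let crossM_bmf n M : (0 < n)%N -> (0 < M)%N -> bmf (crossM n M).
Proof.
move=> n0 M0; have N0 : 0 < (n * M)%:R^-1 :> R by rewrite invr_gt0 ltr0n muln_gt0 n0.
apply: bmfZ; apply: bmf_sum => b; apply: bmf_sum => i; apply: bmf_sum => j.
exact: (bmf_increment0 (BM_lattice (n * M) BX N0) fB).
Qed.

Let crossM_bound n M w : (0 < n)%N -> (0 < M)%N -> `|crossM n M w| <= B + n%:R^-1 ^+ 2 * (n%:R * B).
Proof.
move=> n0 M0; rewrite /crossM -crossE// (le_trans (ler_normB _ _))// lerD//; first exact: RS_bound.
rewrite normrM ger0_norm ?exprn_ge0// ler_wpM2l ?exprn_ge0//.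
rewrite (le_trans (ler_norm_sum _ _ _))// (le_trans (ler_sum _ (fun b _ => RS_bound _ _ _ (bker_rescale _ fB))))//.
by rewrite sumr_const card_ord mulr_natl.
Qed.

Lemma split_expect_lim n (Ab : nat -> Omega -> R) (g : R -> R) : (0 < n)%N -> continuous g ->
  (forall b, siltof (rescale (Num.sqrt n%:R)^-1 f) (blk n b X1) (blk n b X2) (Ab b)) ->
  \int[P]_w g (crossM n M.+1 w) @[M --> \oo] --> \int[P]_w g (A w - n%:R^-1 ^+ 2 * (\sum_(b < n) Ab b w)).
Proof.
move=> n0 cg SAb; have [L gL] := continuous_bounded_itv (B + n%:R^-1 ^+ 2 * (n%:R * B)) cg.
apply: (@expect_lim _ _ _ P (fun M w => g (crossM n M.+1 w)) _ L).
- by move=> M; have [] := bmf_comp cg (crossM_bmf n0 (ltn0Sn M)).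
- have bA : bmf A := siltof_bmf BX fB SA.
  have bAb b : bmf (Ab b) := siltof_bmf (blk_BM b BX n0) (bker_rescale _ fB) (SAb b).
  have [] // : bmf (fun w => g (A w - n%:R^-1 ^+ 2 * (\sum_(b < n) Ab b w))).
  by apply: bmf_comp => //; apply: bmfB => //; apply: bmfZ; apply: bmf_sum => b.
- by move=> M w; apply: gL; exact: crossM_bound.
- by apply: aeW => w; apply: continuous_cvg; [exact: cg|exact: cross_cvg].
Qed.

(** On a grid of K points a pair at lag l has mean at most K / (2 pi l), and the harmonic sum over
    the rectangles is at most ln n after normalisation, whatever the mesh. *)
Lemma split_mean_le n (Ab : nat -> Omega -> R) : (0 < n)%N ->
  (forall u s, 0 <= u -> u < s -> s <= 1 ->
     \int[P]_w f (X1 s w - X1 u w) (X2 s w - X2 u w) <= (pi *+ 2 * (s - u))^-1) ->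
  (forall b, siltof (rescale (Num.sqrt n%:R)^-1 f) (blk n b X1) (blk n b X2) (Ab b)) ->
  \int[P]_w A w - n%:R^-1 ^+ 2 * (\sum_(b < n) \int[P]_w Ab b w) <= (pi *+ 2)^-1 * ln n%:R.
Proof.
move=> n0 fle SAb.
have bA : bmf A := siltof_bmf BX fB SA.
have bAb b : bmf (Ab b) := siltof_bmf (blk_BM b BX n0) (bker_rescale _ fB) (SAb b).
have -> : \int[P]_w A w - n%:R^-1 ^+ 2 * (\sum_(b < n) \int[P]_w Ab b w) =
    \int[P]_w (A w - n%:R^-1 ^+ 2 * (\sum_(b < n) Ab b w)).
  rewrite expectB//; last by apply: bmfZ; apply: bmf_sum.
  by rewrite expectZ ?expect_sum//; apply: bmf_sum.
apply: (cvgr_to_le (split_expect_lim n0 (g := id) (fun x => cvg_id) SAb)); apply: nearW => M.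
have N0 : (0 < n * M.+1)%N by rewrite muln_gt0 n0.
have N0' : 0 < (n * M.+1)%:R :> R by rewrite ltr0n.
have NV : 0 < (n * M.+1)%:R^-1 :> R by rewrite invr_gt0.
have bf j k : bmf (fun w => f (grid (n * M.+1) X1 w k - grid (n * M.+1) X1 w j) (grid (n * M.+1) X2 w k - grid (n * M.+1) X2 w j)).
  exact: (bmf_increment0 (BM_lattice (n * M.+1) BX NV) fB).
rewrite /crossM expectZ; last by apply: bmf_sum => b; apply: bmf_sum => i; apply: bmf_sum.
rewrite expect_sum; last by move=> b; apply: bmf_sum => i; apply: bmf_sum.
under eq_bigr => b _ do (rewrite expect_sum; last by move=> i; apply: bmf_sum).
under eq_bigr => b _ do under eq_bigr => i _ do rewrite expect_sum//.
have pi0 : 0 < pi *+ 2 :> R by rewrite mulrn_wgt0// pi_gt0.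
apply: (@le_trans _ _ ((n * M.+1)%:R^-1 ^+ 2 * ((pi *+ 2)^-1 * (n * M.+1)%:R * (\sum_(b < n) \sum_(i < M.+1) \sum_(j < b * M.+1) (b * M.+1 + i - j)%N%:R^-1)))).
  rewrite ler_wpM2l ?exprn_ge0 ?(ltW NV)// mulr_sumr; apply: ler_sum => b _; rewrite mulr_sumr; apply: ler_sum => i _.
  rewrite mulr_sumr; apply: ler_sum => j _.
  have ji : (j < b * M.+1 + i)%N by rewrite (leq_trans (ltn_ord j))// leq_addr.
  have iN : (b * M.+1 + i <= n * M.+1)%N.
    by have := leq_mul (ltn_ord b) (leqnn M.+1); have := ltn_ord i; lia.
  apply: (le_trans (fle _ _ _ _ _)).
  - by rewrite divr_ge0.
  - by rewrite ltr_pM2r// ltr_nat.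
  - by rewrite ler_pdivrMr// mul1r ler_nat.
  rewrite -mulrBl -natrB ?(ltnW ji)// !invfM invrK mulrA mulrAC.
  by [].
rewrite cross_harmo.
have -> : (n * M.+1)%:R^-1 ^+ 2 * ((pi *+ 2)^-1 * (n * M.+1)%:R * ((n * M.+1)%:R * (harmo R (n * M.+1) - harmo R M.+1)))
  = (pi *+ 2)^-1 * (harmo R (n * M.+1) - harmo R M.+1).
  set c : R := (n * M.+1)%:R in N0' *; set k : R := (pi *+ 2)^-1; set e := _ - _.
  have -> : k * c * (c * e) = c * (c * (k * e)) by ring.
  by rewrite expr2 -mulrA !mulKf ?gt_eqF.
rewrite ler_wpM2l ?invr_ge0 ?(ltW pi0)//.
rewrite (le_trans (harmo_sub_le _ _ _))//; first by rewrite leq_pmull.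
by rewrite natrM lnM ?posrE ?ltr0n// addrK.
Qed.

(** At mesh 1 / N with N = 2 M the kernel bounds hold with constants c1 N^(3/2) and c2 N. Against
    the prefactor N^-4 and the sum of order M^(3/2) all powers cancel. *)
Lemma split_second_moment (Ab : nat -> Omega -> R) (c1 c2 : R) : 0 <= c1 -> 0 <= c2 -> kernel_bound c1 c2 ->
  (forall b, siltof (rescale (Num.sqrt 2%:R)^-1 f) (blk 2 b X1) (blk 2 b X2) (Ab b)) ->
  \int[P]_w (A w - 2%:R^-1 ^+ 2 * (\sum_(b < 2) Ab b w)) ^+ 2 <= 512 * c1 * c2.
Proof.
move=> c10 c20 fk SAb.
have cg : continuous (fun x : R => x ^+ 2) by move=> x; exact: exprn_continuous.
have h := split_expect_lim (n := 2) (g := fun x => x ^+ 2) isT cg SAb.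
(* The coincident indices contribute the term with [M.+1%:R^-1], which disappears in the limit
   however large [B] is. *)
have h' : 512 * c1 * c2 + 2 * B ^+ 2 * M.+1%:R^-1 @[M --> \oo] --> 512 * c1 * c2 + 2 * B ^+ 2 * 0.
  apply: cvgD; first exact: cvg_cst.
  apply: cvgM; [exact: cvg_cst|exact: cvg_harmonic].
rewrite mulr0 addr0 in h'.
apply: (ler_cvg_to h h'); apply: nearW => M.
pose m := M.+1; rewrite -/m; have m0 : (0 < m)%N by [].
have mR : 0 < m%:R :> R by rewrite ltr0n.
pose N := (m + m)%N; have NE : (2 * m = N)%N by rewrite mul2n -addnn.
have NR : 0 < N%:R :> R by rewrite ltr0n /N; lia.
have NV : 0 < N%:R^-1 :> R by rewrite invr_gt0.
have LW := BM_lattice N BX NV.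
pose sN := Num.sqrt N%:R : R.
have sN0 : 0 < sN by rewrite sqrtr_gt0.
have sN2 : sN ^+ 2 = N%:R by rewrite sqr_sqrtr// ltW.
have c1N : 0 <= c1 * (N%:R * sN) by rewrite !mulr_ge0// ltW.
have c2N : 0 <= c2 * N%:R by rewrite !mulr_ge0// ltW.
have lagE j k : (j < k)%N -> k%:R / N%:R - j%:R / N%:R = (k - j)%N%:R / N%:R :> R.
  by move=> jk; rewrite -mulrBl natrB// ltnW.
have tb j k : (j < k)%N -> (k <= N)%N -> [/\ 0 <= j%:R / N%:R :> R, j%:R / N%:R < k%:R / N%:R :> R & k%:R / N%:R <= 1 :> R].
  move=> jk kN; split; first by rewrite divr_ge0.
    by rewrite ltr_pM2r// ltr_nat.
  by rewrite ler_pdivrMr// mul1r ler_nat.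
have f1 j k : (j < k)%N -> (k <= N)%N -> forall x0 y0,
  `|\int[P]_w f (x0 + (X1 (k%:R / N%:R) w - X1 (j%:R / N%:R) w)) (y0 + (X2 (k%:R / N%:R) w - X2 (j%:R / N%:R) w))|
   <= c1 * (N%:R * sN) * invpow34 R (k - j) ^+ 2.
  move=> jk kN x0 y0; have [t1 t2 t3] := tb _ _ jk kN.
  apply: (le_trans ((fk _ _ t1 t2 t3).1 x0 y0)); rewrite lagE//.
  have l0 : 0 < (k - j)%N%:R :> R by rewrite ltr0n subn_gt0.
  rewrite /invpow34; set l := (k - j)%N%:R in l0 *.
  have sl : 0 < Num.sqrt l by rewrite sqrtr_gt0.
  have sl2 : Num.sqrt l ^+ 2 = l by rewrite sqr_sqrtr// ltW.
  have sl4 : Num.sqrt (Num.sqrt l) ^+ 2 = Num.sqrt l by rewrite sqr_sqrtr// ltW.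
  rewrite exprVn exprMn sl2 sl4 sqrtrM ?(ltW l0)// sqrtrV ?(ltW NR)// -/sN.
  rewrite le_eqVlt; apply/orP; left; apply/eqP; field.
  by rewrite !gt_eqF.
have f2 j k : (j < k)%N -> (k <= N)%N ->
  \int[P]_w `|f (X1 (k%:R / N%:R) w - X1 (j%:R / N%:R) w) (X2 (k%:R / N%:R) w - X2 (j%:R / N%:R) w)|
   <= c2 * N%:R / (k - j)%N%:R.
  move=> jk kN; have [t1 t2 t3] := tb _ _ jk kN.
  apply: (le_trans (fk _ _ t1 t2 t3).2); rewrite lagE//.
  have l0 : 0 < (k - j)%N%:R :> R by rewrite ltr0n subn_gt0.
  rewrite le_eqVlt; apply/orP; left; apply/eqP; field.
  by rewrite !gt_eqF.
have key := cross_second_moment m0 c1N c2N LW fB f1 f2.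
have -> : \int[P]_w (crossM 2 m w) ^+ 2 = (N%:R^-1 ^+ 2) ^+ 2 * \int[P]_w (\sum_(i < m) \sum_(j < m)
   f (X1 ((m + i)%:R / N%:R) w - X1 (j%:R / N%:R) w) (X2 ((m + i)%:R / N%:R) w - X2 (j%:R / N%:R) w)) ^+ 2.
  rewrite -expectZ.
    apply: eq_Rintegral => w _; rewrite -exprMn /crossM NE; congr ((_ * _) ^+ 2).
    rewrite big_ord_recl big1 ?add0r; last by move=> i _; rewrite mul0n big_ord0.
    by rewrite big_ord1 mul1n.
  have b1 : bmf (fun w => \sum_(i < m) \sum_(j < m)
   f (X1 ((m + i)%:R / N%:R) w - X1 (j%:R / N%:R) w) (X2 ((m + i)%:R / N%:R) w - X2 (j%:R / N%:R) w)).
    by apply: bmf_sum => i; apply: bmf_sum => j; exact: (bmf_increment0 LW fB).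
  by under eq_fun do rewrite expr2; exact: bmfM.
apply: (le_trans (ler_wpM2l _ key)); first by rewrite exprn_ge0// exprn_ge0// ltW.
pose sm := Num.sqrt m%:R : R; rewrite -/sm.
have sm0 : 0 < sm by rewrite sqrtr_gt0.
have sm2 : sm ^+ 2 = m%:R by rewrite sqr_sqrtr// ltW.
have smN : sm <= sN by rewrite ler_sqrt// ?ler_nat ?leq_addr// ltW.
have c0 : 0 <= c1 * c2 by exact: mulr_ge0.
rewrite mulrDr lerD//.
  have -> : (N%:R^-1 ^+ 2) ^+ 2 * (512 * (c1 * (N%:R * sN)) * (c2 * N%:R) * (m%:R * sm)) =
     512 * c1 * c2 * (sm / sN) ^+ 3 .
    by rewrite -sN2 -sm2; field; rewrite gt_eqF.
  have cc : 0 <= 512 * c1 * c2 by rewrite -mulrA; exact: (mulr_ge0 (ler0n R 512) c0).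
  apply: (ler_piMr cc); apply: exprn_ile1.
    by rewrite divr_ge0 ?(ltW sm0) ?(ltW sN0).
  by rewrite ler_pdivrMr// mul1r.
have -> : (N%:R^-1 ^+ 2) ^+ 2 * (2 * B ^+ 2 * m%:R ^+ 3) = 2 * B ^+ 2 * ((m%:R / N%:R) ^+ 4 / m%:R).
  by field; rewrite !gt_eqF.
apply: ler_wpM2l; first by rewrite mulr_ge0 ?sqr_ge0.
apply: ler_piMl; first by rewrite invr_ge0 ltW.
apply: exprn_ile1; first by rewrite divr_ge0.
by rewrite ler_pdivrMr// mul1r ler_nat leq_addr.
Qed.

End SplitMoments.

(** * Lower bound by tilting *)

Section ExponentialTilt.
Context (R : realType) d (Omega : measurableType d) (P : probability Omega R) (X1 X2 : R -> Omega -> R).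
Hypothesis BX : planar_BM P X1 X2.

Lemma tilt_mass (v u s : R) : 0 <= u -> u <= s ->
  (\int[P]_w (expR (v * (X1 s w - X1 u w) - v ^+ 2 * (s - u) / 2))%:E = 1)%E.
Proof.
move=> u0; rewrite le_eqVlt => /orP[/eqP<-|us].
  under eq_integral do rewrite !subrr !mulr0 mul0r subrr expR0.
  by rewrite integral_cst//; rewrite mul1e; exact: probability_setT.
set a := s - u; have a0 : 0 < a by rewrite subr_gt0.
pose sg : R := Num.sqrt a; have sg0 : 0 < sg by rewrite sqrtr_gt0.
have sg2 : sg ^+ 2 = a by rewrite sqr_sqrtr// ltW.
pose Phi (z : R * R) := (expR (v * z.1 - v ^+ 2 * a / 2))%:E.
have mPhi : measurable_fun setT Phi.
  apply/measurable_EFinP; apply: measurableT_comp => //.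
  by apply: measurable_funB => //; apply: measurable_funM.
rewrite (BM_increment (Phi := Phi) BX u0 us mPhi); last by move=> z; rewrite lee_fin expR_ge0.
have E x y : (Phi (x, y) * (heat a x y)%:E = (normal_pdf (v * a) sg x)%:E * (normal_pdf 0 sg y)%:E)%E.
  rewrite -!EFinM -normal_pdf_heat// -/sg mulrA; congr ((_ * _)%:E).
  rewrite !normal_pdfE ?gt_eqF// mulrCA -expRD; congr (_ * expR _).
  by rewrite /= subr0 sg2; field; rewrite gt_eqF.
transitivity (\int[lebesgue_measure]_x (normal_pdf (v * a) sg x)%:E)%E; last exact: integral_normal_pdf.
apply: eq_integral => x _; under eq_integral do rewrite E.
rewrite ge0_integralZl ?integral_normal_pdf ?mule1//.
- by apply/measurable_EFinP; exact: measurable_normal_pdf.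
- by move=> y _; rewrite lee_fin normal_pdf_ge0.
- by rewrite lee_fin normal_pdf_ge0.
Qed.

Variables (f : R -> R -> R) (B : R).
Hypotheses (fB : bker f B) (f0 : forall x y, 0 <= f x y).
Variables (N : nat) (v : R).
Hypothesis N0 : (0 < N)%N.

Local Notation X1g k := (X1 (k%:R / N%:R)).
Local Notation X2g k := (X2 (k%:R / N%:R)).

(** The tilting density factorises over the increments. The factors after [k] and before [j] are
    independent of the kernel and have mean 1, so two decouplings remove them. *)
Lemma tilt_local j k : (j < k)%N -> (k <= N)%N ->
  (\int[P]_w (expR (v * X1g N w - v ^+ 2 / 2) * f (X1g k w - X1g j w) (X2g k w - X2g j w))%:E =
   \int[P]_w (expR (v * (X1g k w - X1g j w) - v ^+ 2 * (k%:R / N%:R - j%:R / N%:R) / 2) *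
      f (X1g k w - X1g j w) (X2g k w - X2g j w))%:E)%E.
Proof.
move=> jk kN; have mf := continuous_plane_measurable fB.1.
have NR : 0 < N%:R :> R by rewrite ltr0n.
have NV : 0 < N%:R^-1 :> R by rewrite invr_gt0.
have LW := BM_lattice N BX NV; have [_ X0 _] := LW.
have [mX _ _ _] := BX.
have NN : N%:R / N%:R = 1 :> R by rewrite divff// gt_eqF.
pose F (K : nat) (c : R) (x y : nat -> R) := expR (v * x K - c) * f (x k - x j) (y k - y j).
have F0 K c x y : 0 <= F K c x y by rewrite mulr_ge0 ?expR_ge0.
have cF K c : (K <= N)%N -> cylinder N (F K c).
  move=> KN; apply: cylinderM; last first.
    have := @cylinder_incr R N f 1 j k mf ltac:(lia) kN.
    by congr cylinder; apply/funext => x; apply/funext => y; rewrite !mul1r.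
  apply: (cylinder_comp (g := expR) (F := fun x y => v * x K - c)).
    exact: measurable_expR.
  split=> [x x' y y' E|d' T x y mxy]; first by have [->] := E _ KN.
  apply: measurable_funB => //; apply: measurable_funM => //; exact: (mxy K).1.
have mY : measurable_fun setT (fun w => f (X1g k w - X1g j w) (X2g k w - X2g j w)).
  exact: (bmf_increment0 LW fB j k).1.
have mE t : measurable_fun setT (fun w : Omega => expR (v * X1 t w)).
  by apply: measurableT_comp => //; apply: measurable_funM => //; exact: (mX t).1.
have mE2 t t' c : measurable_fun setT (fun w : Omega => expR (v * (X1 t w - X1 t' w) - c)).
  apply: measurableT_comp => //; apply: measurable_funB => //; apply: measurable_funM => //.
  by apply: measurable_funB; [exact: (mX t).1|exact: (mX t').1].
have t0 i : 0 <= i%:R / N%:R :> R by rewrite divr_ge0.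
have tle i i' : (i <= i')%N -> i%:R / N%:R <= i'%:R / N%:R :> R.
  by move=> ii; rewrite ler_pM2r// ler_nat.
transitivity (\int[P]_w (expR (v * X1g k w - v ^+ 2 * (k%:R / N%:R) / 2) * f (X1g k w - X1g j w) (X2g k w - X2g j w))%:E)%E.
  rewrite (lattice_decouple k LW (cF N (v ^+ 2 / 2) (leqnn N)) (F0 _ _)).
  apply: eq_integral => w _; rewrite /F.
  have E w' : (expR (v * splice k (fun i => X1g i) N (w, w') - v ^+ 2 / 2) *
     f (splice k (fun i => X1g i) k (w, w') - splice k (fun i => X1g i) j (w, w'))
       (splice k (fun i => X2g i) k (w, w') - splice k (fun i => X2g i) j (w, w')))%:E =
     ((expR (v * X1g k w - v ^+ 2 * (k%:R / N%:R) / 2) * f (X1g k w - X1g j w) (X2g k w - X2g j w))%:E *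
      (expR (v * (X1g N w' - X1g k w') - v ^+ 2 * (N%:R / N%:R - k%:R / N%:R) / 2))%:E)%E.
    rewrite !(splice_left _ _ (leqnn k)) !(splice_left _ _ (ltnW jk)) !(splice_right _ _ kN)/=.
    rewrite -EFinM [X in _ = X%:E]mulrAC -expRD NN; congr (expR _ * _)%:E; field.
    by rewrite gt_eqF.
  under eq_integral do rewrite E.
  rewrite ge0_integralZl//; last by rewrite lee_fin mulr_ge0 ?expR_ge0.
    by rewrite tilt_mass ?mule1//; exact: tle.
  by apply/measurable_EFinP; exact: mE2.
rewrite (lattice_decouple j LW (cF k (v ^+ 2 * (k%:R / N%:R) / 2) kN) (F0 _ _)).
rewrite /F.
set I := (X in _ = X).
have E w w' : (expR (v * splice j (fun i => X1g i) k (w, w') - v ^+ 2 * (k%:R / N%:R) / 2) *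
     f (splice j (fun i => X1g i) k (w, w') - splice j (fun i => X1g i) j (w, w'))
       (splice j (fun i => X2g i) k (w, w') - splice j (fun i => X2g i) j (w, w')))%:E =
     ((expR (v * (X1g j w - X1g 0%N w) - v ^+ 2 * (j%:R / N%:R - 0%:R / N%:R) / 2))%:E *
      (expR (v * (X1g k w' - X1g j w') - v ^+ 2 * (k%:R / N%:R - j%:R / N%:R) / 2) * f (X1g k w' - X1g j w') (X2g k w' - X2g j w'))%:E)%E.
  rewrite !(splice_sub_right _ _ (leqnn j) (ltnW jk)) !(splice_right _ _ (ltnW jk))/=.
  rewrite -EFinM [X in _ = X%:E]mulrA -expRD (X0 w).1; congr (expR _ * _)%:E; field.
  by rewrite gt_eqF.
transitivity (\int[P]_w ((expR (v * (X1g j w - X1g 0%N w) - v ^+ 2 * (j%:R / N%:R - 0%:R / N%:R) / 2))%:E * I))%E.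
  apply: eq_integral => w _; under eq_integral do rewrite E.
  rewrite ge0_integralZl//.
  - by apply/measurable_EFinP; apply: measurable_funM => //; exact: mE2.
  - by move=> w' _; rewrite lee_fin mulr_ge0 ?expR_ge0.
rewrite ge0_integralZr//.
- by rewrite tilt_mass ?mul1e//; exact: tle.
- by apply/measurable_EFinP; exact: mE2.
- by apply: integral_ge0 => w _; rewrite lee_fin mulr_ge0 ?expR_ge0.
Qed.

End ExponentialTilt.

(** * A Jensen bound under a change of measure *)

Section TiltJensen.
Context d (T : measurableType d) (R : realType) (P : probability T R).

Lemma tilt_integrable (D h : T -> R) : measurable_fun setT D -> (forall w, 0 <= D w) ->
  (\int[P]_w (D w)%:E = 1)%E -> bmf h -> P.-integrable setT (EFin \o (fun w => D w * h w)).
Proof.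
move=> mD D0 D1 [mh [K hK]].
have iD : P.-integrable setT (EFin \o D).
  apply/integrableP; split; first exact/measurable_EFinP.
  under eq_integral do rewrite /= ger0_norm//.
  by rewrite D1 ltry.
apply: (le_integrable _ (g := EFin \o (fun w => K * D w))) => //.
- by apply/measurable_EFinP; exact: measurable_funM.
- move=> w _ /=; rewrite lee_fin !normrM mulrC ler_wpM2r// (le_trans (hK w))//.
  exact: ler_norm.
- exact: (integrableZl measurableT K iD).
Qed.

(** Cauchy-Schwarz gives E e^Z >= (E D e^(Z/2))^2 / E D^2, and Jensen under [D] bounds E D e^(Z/2)
    below by e^c, with c half of the tilted mean. Both are done pointwise: a square is expanded, and
    the exponential is replaced by its tangent at [c]. *)
Lemma tilt_jensen (D Z : T -> R) (q : R) : measurable_fun setT D -> (forall w, 0 <= D w) ->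
  (\int[P]_w (D w)%:E = 1)%E -> (\int[P]_w (D w ^+ 2)%:E = (expR q)%:E)%E -> bmf Z ->
  expR (\int[P]_w (D w * Z w) - q) <= \int[P]_w expR (Z w).
Proof.
move=> mD D0 D1 D2 bZ; have [mZ [K ZK]] := bZ.
have iD : P.-integrable setT (EFin \o D).
  apply/integrableP; split; first exact/measurable_EFinP.
  under eq_integral do rewrite /= ger0_norm//.
  by rewrite D1 ltry.
have iD2 : P.-integrable setT (EFin \o (fun w => D w ^+ 2)).
  apply/integrableP; split; first by apply/measurable_EFinP; exact: measurable_funX.
  under eq_integral do rewrite /= ger0_norm ?sqr_ge0//.
  by rewrite D2 ltry.
have iDZ := tilt_integrable mD D0 D1 bZ.
have igZ k h : P.-integrable setT (EFin \o h) -> P.-integrable setT (EFin \o (fun w => k * h w)).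
  by move=> ih; exact: (integrableZl measurableT k ih).
(* [l] is the lower bound e^c for E D e^(Z/2) divided by E D^2 = e^q, the best multiple of [D] to
   subtract inside the square. *)
set c2 := \int[P]_w (D w * Z w); pose c := c2 / 2; pose l := expR (c - q).
pose G w := (2 * l * expR c * (1 - c) * D w + l * expR c * (D w * Z w)) - l ^+ 2 * D w ^+ 2.
have iG1 : P.-integrable setT (EFin \o (fun w => 2 * l * expR c * (1 - c) * D w + l * expR c * (D w * Z w))).
  exact: (integrableD measurableT (igZ _ _ iD) (igZ _ _ iDZ)).
have iG : P.-integrable setT (EFin \o G) := integrableB measurableT iG1 (igZ _ _ iD2).
have -> : expR (c2 - q) = \int[P]_w G w.
  rewrite RintegralB// ?RintegralD// ?RintegralZl//; try exact: igZ.
  rewrite -/c2 [\int[P]_w D w]/Rintegral D1 [\int[P]_w (D w ^+ 2)]/Rintegral D2 /=.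
  have -> : c2 - q = (c - q) + c by rewrite /c; lra.
  have lq : l * expR q = expR c by rewrite -expRD subrK.
  have -> : l ^+ 2 * expR q = l * expR c by rewrite expr2 -mulrA lq.
  have c2E : c2 = 2 * c by rewrite /c; lra.
  by rewrite expRD -/l c2E; ring.
apply: le_Rintegral => //; first by apply: bmf_integrable; exact: bmf_expR.
move=> w _; rewrite /G.
have h1 : expR c * (1 + (Z w / 2 - c)) <= expR (Z w / 2).
  have {2}-> : Z w / 2 = c + (Z w / 2 - c) by ring.
  by rewrite expRD ler_wpM2l ?expR_ge0// expR_ge1Dx.
have h2 := sqr_ge0 (expR (Z w / 2) - l * D w).
have h3 : expR (Z w) = expR (Z w / 2) ^+ 2 by rewrite expr2 -expRD -splitr.
have l0 : 0 <= l by exact: expR_ge0.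
have h4 : 2 * (l * D w) * (expR c * (1 + (Z w / 2 - c))) <= 2 * (l * D w) * expR (Z w / 2).
  by rewrite ler_wpM2l// !mulr_ge0.
rewrite h3; move: h2 h4; set E := expR (Z w / 2); set e := expR c; set D' := D w; set Z' := Z w => h2 h4.
have -> : 2 * l * e * (1 - c) * D' + l * e * (D' * Z') = 2 * (l * D') * (e * (1 + (Z' / 2 - c))) by field.
move: h2; rewrite sqrrB -mulr_natl exprMn; lra.
Qed.

Lemma tilt_sum (D : T -> R) I (r : seq I) (p : pred I) (F : I -> T -> R) : measurable_fun setT D -> (forall w, 0 <= D w) ->
  (\int[P]_w (D w)%:E = 1)%E -> (forall i, bmf (F i)) ->
  \int[P]_w (D w * \sum_(i <- r | p i) F i w) = \sum_(i <- r | p i) \int[P]_w (D w * F i w).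
Proof.
move=> mD D0 D1 bF; elim: r => [|i r IH].
  rewrite big_nil; under eq_Rintegral do rewrite big_nil mulr0; exact: expect_cst.
rewrite big_cons; under eq_Rintegral do rewrite big_cons; case: (p i) => //.
rewrite -IH -RintegralD//; [|exact: tilt_integrable|apply: tilt_integrable => //; exact: bmf_sum].
by apply: eq_Rintegral => w _; rewrite mulrDr.
Qed.

End TiltJensen.

Section TiltedSums.
Context (R : realType).
Variables (N : nat) (th : R).
Hypotheses (N0 : (0 < N)%N) (th1 : 1 <= th) (thN : th <= N%:R).
(** The number of grid lags within time 1 / th, the time after which a drift of size sqrt(th)
    dominates diffusion. *)
Let L0 := Num.truncn (N%:R / th).

Let th0 : 0 < th. Proof. exact: lt_le_trans ltr01 th1. Qed.

Lemma short_lagE l : (l.+1%:R * th <= N%:R) = (l < L0)%N.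
Proof. by rewrite -ler_pdivlMr// /L0 truncn_ge_nat// divr_ge0// ltW. Qed.

Lemma L0_le : L0%:R <= N%:R / th.
Proof. by rewrite truncn_le// divr_ge0// ltW. Qed.

Lemma L0_ge : N%:R / th <= L0.+1%:R.
Proof. by rewrite ltW// truncnS_gt// ltW. Qed.

Let L0N : (L0 <= N)%N.
Proof.
by rewrite -(ler_nat R) (le_trans L0_le)// ler_pdivrMr// ler_peMr.
Qed.

Lemma sum_short_invsqrt : \sum_(l < N) (if (l < L0)%N then invsqrt R l.+1 else 0) <= 2 * Num.sqrt (N%:R / th).
Proof.
rewrite -big_mkcond/= -(big_ord_widen N (fun l => invsqrt R l.+1) L0N).
rewrite (le_trans (sum_invsqrt R L0))// ler_wpM2l// ler_sqrt ?L0_le//.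
by rewrite divr_ge0// ltW.
Qed.

Lemma sum_long_inv2 : \sum_(l < N) (if (l < L0)%N then 0 else l.+1%:R^-1 ^+ 2) <= 2 * th / N%:R.
Proof.
(* Telescoping: 1 / l^2 <= 2 / l - 2 / (l + 1) + 1 / l^2 - 2 / (l (l + 1)), where the last two terms
   sum to at most 0; the first long lag is [L0.+1]. *)
have key n : \sum_(l < n) (if (l < L0)%N then 0 else l.+1%:R^-1 ^+ 2) + 2 * (maxn n L0).+1%:R^-1 <= 2 * L0.+1%:R^-1 :> R.
  elim: n => [|n IH]; first by rewrite big_ord0 add0r max0n.
  rewrite big_ord_recr/=; case: ltnP => nL.
    by rewrite addr0 (maxn_idPr nL); move: IH; rewrite (maxn_idPr (ltnW nL)).
  rewrite (maxn_idPl (leqW nL)); move: IH; rewrite (maxn_idPl nL).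
  move=> IH'; suff h : n.+1%:R^-1 ^+ 2 + 2 * n.+2%:R^-1 <= 2 * n.+1%:R^-1 :> R.
    by rewrite -addrA (le_trans _ IH')// lerD2l.
  have a0 : 0 < n.+1%:R :> R by [].
  have a1 : 1 <= n.+1%:R :> R by rewrite ler1n.
  rewrite -[n.+2%:R]natr1; set a := n.+1%:R in a0 a1 *.
  rewrite -subr_ge0 (_ : _ - _ = (a - 1) / (a ^+ 2 * (a + 1))).
    by rewrite divr_ge0 ?mulr_ge0 ?sqr_ge0//; lra.
  by field; rewrite !gt_eqF//; lra.
have := key N; have h0 : 0 <= 2 * (maxn N L0).+1%:R^-1 :> R by rewrite mulr_ge0.
have h1 : L0.+1%:R^-1 <= th / N%:R.
  by rewrite -[leRHS]invrK lef_pV2 ?posrE ?invr_gt0 ?divr_gt0 ?ltr0n// invf_div L0_ge.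
move=> K; rewrite -mulrA; apply: (@le_trans _ _ (2 * L0.+1%:R^-1)); last by rewrite ler_wpM2l.
by apply: le_trans K; rewrite lerDl.
Qed.

Lemma sum_long_inv : N%:R * (harmo R N - harmo R L0 - 1) <=
  \sum_(i < N) \sum_(l < i) (if (l < L0)%N then 0 else l.+1%:R^-1).
Proof.
have hle m n : (m <= n)%N -> harmo R m <= harmo R n.
  move=> mn; rewrite /harmo (big_ord_widen n (fun l => l.+1%:R^-1 : R) mn) big_mkcond/=.
  by apply: ler_sum => l _; case: ifP.
have inner i : harmo R i - harmo R L0 <= \sum_(l < i) (if (l < L0)%N then 0 else l.+1%:R^-1).
  elim: i => [|i IH].
    by rewrite big_ord0 subr_le0 hle.
  rewrite big_ord_recr/=; case: ltnP => iL; last by rewrite harmoS addrAC lerD2r.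
  rewrite addr0 (@le_trans _ _ 0)//; first by rewrite subr_le0 hle.
  by rewrite sumr_ge0// => l _; case: ifP.
apply: (@le_trans _ _ (\sum_(i < N) (harmo R i - harmo R L0))); last by apply: ler_sum => i _.
rewrite sumrB sumr_const card_ord -mulr_natl -/(harmo R _).
have <- := tri_lag (fun l => l%:R^-1 : R) N.
by rewrite tri_harmo le_eqVlt; apply/orP; left; apply/eqP; ring.
Qed.

Lemma harmo_long : ln th - 1 <= harmo R N - harmo R L0.
Proof.
have NR : 0 < N%:R :> R by rewrite ltr0n.
apply: le_trans (harmo_sub_ge R L0N).
have e1 : ln N%:R <= ln N.+1%:R :> R by rewrite ler_ln ?posrE// ler_nat.
have e2 : L0.+1%:R * th <= 2 * N%:R.
  rewrite -natr1 mulrDl mul1r (_ : 2 * N%:R = N%:R + N%:R); last by ring.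
  rewrite lerD//.
  by rewrite -ler_pdivlMr// L0_le.
have e3 : ln (L0.+1%:R * th) <= ln (2 * N%:R) by rewrite ler_ln ?posrE ?mulr_gt0.
rewrite !lnM ?posrE// in e3.
have e4 : ln 2 <= 1 :> R.
  have := @le_ln1Dx R 1; rewrite (_ : 1 + 1 = 2)//; apply.
  by rewrite (lt_trans _ ltr01)// oppr_lt0.
by move: e1 e3 e4; set a := ln th; set b := ln L0.+1%:R; set c := ln N.+1%:R; set e := ln N%:R; lra.
Qed.

(** Short lags keep their mean up to a bounded total error. Long lags lose it: the term - N / l sums
    to minus the logarithm of [th], while the quadratic correction is summable. *)
Lemma tilted_sum_le (c k1 : R) (b : nat -> R) : 0 <= c -> 0 <= k1 ->
  (forall l, (l.+1 <= N)%N -> l.+1%:R * th <= N%:R -> b l.+1 <= k1 * invsqrt R l.+1) ->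
  (forall l, (l.+1 <= N)%N -> N%:R < l.+1%:R * th ->
     b l.+1 <= (pi *+ 2)^-1 * (c * N%:R ^+ 2 * l.+1%:R^-1 ^+ 2 - N%:R * l.+1%:R^-1)) ->
  N%:R^-1 ^+ 2 * (\sum_(i < N) \sum_(l < i) b l.+1) <=
  N%:R^-1 * (k1 * (2 * Num.sqrt (N%:R / th))) + (pi *+ 2)^-1 * (c * (2 * th) - (ln th - 2)).
Proof.
move=> c0 k10 bs bl; have NR : 0 < N%:R :> R by rewrite ltr0n.
have pi0 : 0 < (pi *+ 2)^-1 :> R by rewrite invr_gt0 mulrn_wgt0// pi_gt0.
set q := (pi *+ 2)^-1 in pi0 bl *.
pose p1 l : R := if (l < L0)%N then invsqrt R l.+1 else 0.
pose p2 l : R := if (l < L0)%N then 0 else l.+1%:R^-1 ^+ 2.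
pose p3 l : R := if (l < L0)%N then 0 else l.+1%:R^-1.
have p10 l : 0 <= p1 l by rewrite /p1; case: ifP => // _; exact: invsqrt_ge0.
have p20 l : 0 <= p2 l by rewrite /p2; case: ifP => // _; exact: sqr_ge0.
have bp l : (l < N)%N -> b l.+1 <= k1 * p1 l + q * (c * N%:R ^+ 2) * p2 l - q * N%:R * p3 l.
  move=> lN; rewrite /p1 /p2 /p3; have := short_lagE l; case: ltnP => lL h.
    by rewrite !mulr0 addr0 subr0; apply: bs.
  rewrite mulr0 add0r -mulrA -[q * N%:R * _]mulrA -mulrBr; apply: bl => //.
  by rewrite ltNge h.
have S1 : \sum_(i < N) \sum_(l < i) b l.+1 <=
   \sum_(i < N) (k1 * (\sum_(l < N) p1 l) + q * (c * N%:R ^+ 2) * (\sum_(l < N) p2 l) - q * N%:R * (\sum_(l < i) p3 l)).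
  apply: ler_sum => i _.
  apply: (@le_trans _ _ (k1 * (\sum_(l < i) p1 l) + q * (c * N%:R ^+ 2) * (\sum_(l < i) p2 l) - q * N%:R * (\sum_(l < i) p3 l))).
    rewrite !mulr_sumr -big_split -sumrB/=; apply: ler_sum => l _; apply: bp.
    exact: ltn_trans (ltn_ord l) (ltn_ord i).
  have wid (p : nat -> R) : (forall l, 0 <= p l) -> \sum_(l < i) p l <= \sum_(l < N) p l.
    move=> p0; rewrite (big_ord_widen N p (ltnW (ltn_ord i))) big_mkcond/=.
    by apply: ler_sum => l _; case: ifP.
  rewrite lerD2r lerD//; first by rewrite ler_wpM2l// wid.
  by rewrite ler_wpM2l ?wid// mulr_ge0 ?(ltW pi0)// mulr_ge0 ?sqr_ge0.
apply: (le_trans (ler_wpM2l _ S1)); first by rewrite exprn_ge0// ltW// invr_gt0.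
rewrite sumrB sumr_const card_ord -mulr_sumr -[X in _ * (X - _)]mulr_natl.
have h1 : \sum_(l < N) p1 l <= _ := sum_short_invsqrt.
have h2 : \sum_(l < N) p2 l <= _ := sum_long_inv2.
have h3 : _ <= \sum_(i < N) \sum_(l < i) p3 l := sum_long_inv.
have h4 := harmo_long.
set s1 := \sum_(l < N) p1 l in h1 *; set s2 := \sum_(l < N) p2 l in h2 *; set s3 := \sum_(i < N) _ in h3 *.
have h5 : N%:R * (ln th - 2) <= s3.
  by rewrite (le_trans _ h3)// ler_wpM2l ?(ltW NR)//; lra.
set r := Num.sqrt _ in h1 *; set n : R := N%:R in NR h2 h5 *.
have -> : n^-1 ^+ 2 * (n * (k1 * s1 + q * (c * n ^+ 2) * s2) - q * n * s3) =
  n^-1 * (k1 * s1) + q * (c * (n * s2) - n^-1 * s3) by field; rewrite gt_eqF.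
have nV : 0 < n^-1 by rewrite invr_gt0.
rewrite lerD//; first by rewrite ler_wpM2l ?(ltW nV)// ler_wpM2l.
rewrite ler_wpM2l ?(ltW pi0)// lerB//.
  by rewrite ler_wpM2l// mulrC -ler_pdivlMr.
by rewrite mulrC ler_pdivlMr// mulrC.
Qed.

End TiltedSums.

Section TiltLowerBound.
Context (R : realType) d (Omega : measurableType d) (P : probability Omega R) (X1 X2 : R -> Omega -> R).
Hypothesis BX : planar_BM P X1 X2.
Variables (f : R -> R -> R) (m1 m2 B : R).
Hypotheses (df : dens f m1 m2) (fB : bker f B).
Variable th : R.
Hypothesis th1 : 1 <= th.
Let v := Num.sqrt th.
Let th0 : 0 < th. Proof. exact: lt_le_trans ltr01 th1. Qed.
Let v0 : 0 < v. Proof. by rewrite sqrtr_gt0. Qed.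
Let v2 : v ^+ 2 = th. Proof. by rewrite sqr_sqrtr// ltW. Qed.
Let f0 x y : 0 <= f x y. Proof. by have [_ [+ _] _ _ _] := df; apply. Qed.
Let m20 : 0 <= m2. Proof. by have [_ /andP[a b]] := dens_moment2 df; exact: le_trans a b. Qed.
(** Time 1 is written [N%:R / N%:R] so that the density is a function of the grid. *)
Let D (N : nat) w := expR (v * X1 (N%:R / N%:R) w - v ^+ 2 / 2).

Let D_measurable N : measurable_fun setT (D N).
Proof.
have [mX _ _ _] := BX; apply: measurableT_comp => //; apply: measurable_funB => //.
by apply: measurable_funM => //; exact: (mX _).1.
Qed.

Let D_mass N u : (0 < N)%N ->
  (\int[P]_w (expR (u * X1 (N%:R / N%:R) w - u ^+ 2 / 2))%:E = 1)%E.
Proof.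
move=> N0; have [_ X0 _ _] := BX; rewrite -[RHS](tilt_mass BX u (lexx 0) ler01).
apply: eq_integral => w _; rewrite (X0 w).1 !subr0 mulr1 divff// pnatr_eq0; lia.
Qed.

Let D_square N : (0 < N)%N -> (\int[P]_w (D N w ^+ 2)%:E = (expR th)%:E)%E.
Proof.
move=> N0; have E w : D N w ^+ 2 = expR th * expR ((2 * v) * X1 (N%:R / N%:R) w - (2 * v) ^+ 2 / 2).
  by rewrite /D expr2 -!expRD -v2; congr expR; field.
under eq_integral do rewrite E.
rewrite ge0_integralZl_real ?expR_ge0//; first by rewrite D_mass ?mule1.
by have [mX _ _ _] := BX; apply: measurableT_comp => //; apply: measurable_funB => //;
  apply: measurable_funM => //; exact: (mX _).1.
Qed.

Local Notation Y N i j w := (f (grid N X1 w i - grid N X1 w j) (grid N X2 w i - grid N X2 w j)).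

Lemma tilted_RS_le N : (0 < N)%N -> th <= N%:R ->
  \int[P]_w (D N w * RS N f (grid N X1 w) (grid N X2 w)) - \int[P]_w RS N f (grid N X1 w) (grid N X2 w)
   <= 6 + 5 * th * m2 - (pi *+ 2)^-1 * ln th.
Proof.
move=> N0 thN; have NR : 0 < N%:R :> R by rewrite ltr0n.
have NV : 0 < N%:R^-1 :> R by rewrite invr_gt0.
have D0 w : 0 <= D N w by exact: expR_ge0.
have mD := D_measurable N; have D1 := D_mass v N0.
have bY i j : bmf (fun w => Y N i j w) := bmf_increment0 (BM_lattice N BX NV) fB j i.
have bYs : bmf (fun w => \sum_(i < N) \sum_(j < N | (j < i)%N) Y N i j w).
  by apply: bmf_sum => i; apply: bmf_sum.
have -> : \int[P]_w (D N w * RS N f (grid N X1 w) (grid N X2 w)) =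
   N%:R^-1 ^+ 2 * (\sum_(i < N) \sum_(j < N | (j < i)%N) \int[P]_w (D N w * Y N i j w)).
  under eq_Rintegral do rewrite mulrCA.
  rewrite RintegralZl//; last exact: tilt_integrable.
  congr (_ * _); rewrite tilt_sum//; last by move=> i; exact: bmf_sum.
  by apply: eq_bigr => i _; rewrite tilt_sum.
have -> : \int[P]_w (RS N f (grid N X1 w) (grid N X2 w)) =
   N%:R^-1 ^+ 2 * (\sum_(i < N) \sum_(j < N | (j < i)%N) \int[P]_w Y N i j w).
  rewrite expectZ// expect_sum; last by move=> i; exact: bmf_sum.
  by congr (_ * _); apply: eq_bigr => i _; rewrite expect_sum.
rewrite -mulrBr -sumrB.
pose q : R := (pi *+ 2)^-1.
have pi0 : pi != 0 :> R by rewrite gt_eqF// pi_gt0.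
have thn : th != 0 by rewrite gt_eqF.
(* Insert a = l / N into [increment_tilt_decay] and subtract [increment_ge]: the terms of order 1 /
   a^2 collect into [c] and - 1 / a remains. [k1] below arises in the same way from
   [increment_tilt_lip]. *)
pose c := 8 * (1 + th * m2) / th + m2 / 2.
have c0 : 0 <= c by rewrite addr_ge0// divr_ge0// ?mulr_ge0 ?addr_ge0 ?mulr_ge0 ?(ltW th0).
pose sN : R := Num.sqrt N%:R.
have sN0 : 0 < sN by rewrite sqrtr_gt0.
have sN2 : sN ^+ 2 = N%:R by rewrite sqr_sqrtr// ltW.
pose k1 := v * sN / pi.
have k10 : 0 <= k1 by rewrite divr_ge0 ?mulr_ge0 ?pi_ge0 ?(ltW v0) ?(ltW sN0).
pose b l := if l%:R * th <= N%:R then k1 * invsqrt R l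
  else q * (c * N%:R ^+ 2 * l%:R^-1 ^+ 2 - N%:R * l%:R^-1).
have pair i j : (j < i)%N -> (i <= N)%N -> \int[P]_w (D N w * Y N i j w) - \int[P]_w Y N i j w <= b (i - j)%N.
  move=> ji iN.
  have t0 : 0 <= j%:R / N%:R :> R by rewrite divr_ge0.
  have ts : j%:R / N%:R < i%:R / N%:R :> R by rewrite ltr_pM2r// ltr_nat.
  have -> : \int[P]_w (D N w * Y N i j w) =
    \int[P]_w (expR (v * (X1 (i%:R / N%:R) w - X1 (j%:R / N%:R) w) - v ^+ 2 * (i%:R / N%:R - j%:R / N%:R) / 2) *
      f (X1 (i%:R / N%:R) w - X1 (j%:R / N%:R) w) (X2 (i%:R / N%:R) w - X2 (j%:R / N%:R) w)).
    rewrite /Rintegral; congr fine; exact: (tilt_local BX fB f0 v N0 ji iN).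
  have lag : i%:R / N%:R - j%:R / N%:R = (i - j)%N%:R / N%:R :> R by rewrite -mulrBl natrB// ltnW.
  have l0 : 0 < (i - j)%N%:R :> R by rewrite ltr0n subn_gt0.
  have sl : 0 < Num.sqrt (i - j)%N%:R :> R by rewrite sqrtr_gt0.
  have sl2 : Num.sqrt (i - j)%N%:R ^+ 2 = (i - j)%N%:R :> R by rewrite sqr_sqrtr// ltW.
  rewrite /b; case: ifP => short.
    apply: (le_trans (increment_tilt_lip BX t0 ts df (ltW v0))).
    rewrite lag sqrtrM ?(ltW l0)// sqrtrV ?(ltW NR)// -/sN /invsqrt /k1 -[pi *+ 2]mulr_natl.
    set r := Num.sqrt (i - j)%N%:R in sl sl2 *.
    rewrite -sl2 -sN2 le_eqVlt; apply/orP; left; apply/eqP.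
    by move: pi0; generalize (pi : R) => p pn; field; rewrite pn !gt_eqF.
  have long : 1 <= v ^+ 2 * (i%:R / N%:R - j%:R / N%:R).
    by rewrite v2 lag mulrA ler_pdivlMr// mul1r mulrC ltW// ltNge short.
  apply: (le_trans (lerB (increment_tilt_decay BX t0 ts df v0 long) (increment_ge BX t0 ts df))).
  rewrite lag v2 /q /c -[pi *+ 2]mulr_natl -[(_ / _) *+ 2]mulr_natl.
  set l : R := (i - j)%N%:R in l0 *.
  rewrite le_eqVlt; apply/orP; left; apply/eqP.
  by move: pi0; generalize (pi : R) => p pn; field; rewrite pn !gt_eqF.
have tot := tilted_sum_le N0 th1 thN (c := c) (k1 := k1) (b := b) c0 k10.
apply: (@le_trans _ _ (N%:R^-1 ^+ 2 * (\sum_(i < N) \sum_(l < i) b l.+1))).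
  rewrite ler_wpM2l ?exprn_ge0// -(tri_lag b); apply: ler_sum => i _.
  by rewrite -sumrB; apply: ler_sum => j ji; apply: pair => //; exact: ltnW.
apply: (le_trans (tot _ _)).
- by move=> l _ h; rewrite /b h.
- by move=> l _ h; rewrite /b ifF//; apply/negbTE; rewrite -ltNge.
have -> : N%:R^-1 * (k1 * (2 * Num.sqrt (N%:R / th))) = 2 / pi.
  rewrite sqrtrM ?(ltW NR)// sqrtrV ?(ltW th0)// -/v -/sN /k1 -sN2.
  by move: pi0; generalize (pi : R) => p pn; field; rewrite pn !gt_eqF.
have ip : pi^-1 <= 2^-1 :> R by rewrite lef_pV2 ?posrE ?pi_gt0// pi_ge2.
have -> : (pi *+ 2)^-1 * (c * (2 * th) - (ln th - 2)) = pi^-1 * (c * th + 1) - (pi *+ 2)^-1 * ln th.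
  by rewrite -[pi *+ 2]mulr_natl; move: pi0; generalize (pi : R) => p pn; field.
have -> : c * th = 8 + 17 / 2 * (th * m2) by rewrite /c; field.
(* What is left is (11 + 17/2 th m2) / pi with pi >= 2; the constants 6 and 5 are 11/2 and 17/4
   rounded up. *)
rewrite addrA lerD2r.
have tm : 0 <= th * m2 by rewrite mulr_ge0// ltW.
have ip0 : 0 <= pi^-1 :> R by rewrite invr_ge0 pi_ge0.
have : pi^-1 * (11 + 17 / 2 * (th * m2)) <= 2^-1 * (11 + 17 / 2 * (th * m2)).
  by rewrite ler_wpM2r// addr_ge0// mulr_ge0.
by rewrite -[5 * th * m2]mulrA; lra.
Qed.

Variable A : Omega -> R.
Hypothesis SA : siltof f X1 X2 A.

Lemma laplace_lower : expR (- th * (\int[P]_w A w + (6 + 5 * th * m2 - (pi *+ 2)^-1 * ln th)) - th) <=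
  \int[P]_w expR (- th * A w).
Proof.
have cg : continuous (fun x : R => expR (- th * x)).
  by move=> x; apply: continuous_comp; [apply: mulrl_continuous|exact: continuous_expR].
have h1 := siltof_expect_lim BX fB SA (u := id) cg (fun n => leqnn n).
have h2 := siltof_expect_lim BX fB SA (u := id) (g := id) (fun x => cvg_id) (fun n => leqnn n).
pose K := 6 + 5 * th * m2 - (pi *+ 2)^-1 * ln th; rewrite -/K.
have h3 : expR (- th * (\int[P]_w RS N.+1 f (grid N.+1 X1 w) (grid N.+1 X2 w) + K) - th) @[N --> \oo] -->
   expR (- th * (\int[P]_w A w + K) - th).
  apply: continuous_cvg; first exact: continuous_expR.
  by apply: cvgB; [apply: cvgM; [exact: cvg_cst|apply: cvgD; [exact: h2|exact: cvg_cst]]|exact: cvg_cst].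
apply: (ler_cvg_to h3 h1); near=> N.
have thN : th <= N.+1%:R.
  by near: N; exists (Num.truncn th).+1 => // N /= tN; rewrite ltW// (lt_le_trans (truncnS_gt th))// ler_nat ltnW.
have bRS : bmf (fun w => RS N.+1 f (grid N.+1 X1 w) (grid N.+1 X2 w)).
  by split; [exact: (RS_grid_measurable BX fB)|exists B => w; exact: RS_bound].
have J := tilt_jensen (D_measurable N.+1) (fun w => expR_ge0 _) (D_mass v (ltn0Sn N)) (D_square (ltn0Sn N)) (bmfZ (- th) bRS).
apply: le_trans J; rewrite ler_expR lerD2r.
have -> : \int[P]_w (D N.+1 w * (- th * RS N.+1 f (grid N.+1 X1 w) (grid N.+1 X2 w))) =
    - th * \int[P]_w (D N.+1 w * RS N.+1 f (grid N.+1 X1 w) (grid N.+1 X2 w)).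
  rewrite -RintegralZl//; first by apply: eq_Rintegral => w _; exact: mulrCA.
  exact: (tilt_integrable (D_measurable N.+1) (fun w => expR_ge0 _) (D_mass v (ltn0Sn N)) bRS).
rewrite ler_nM2l ?oppr_lt0// addrC -lerBlDr.
exact: tilted_RS_le.
Unshelve. all: by end_near. Qed.

End TiltLowerBound.

(** * Exponential moments *)

Section ExponentialMoments.
Context d (T : measurableType d) (R : realType) (P : probability T R).

Lemma expR_le_quad (x : R) : x <= 2^-1 -> expR x <= 1 + x + 2 * x ^+ 2.
Proof.
move=> x2; have h : 0 < 1 - x by lra.
have e : 1 - x <= expR (- x) by exact: expR_ge1Dx.
have -> : expR x = (expR (- x))^-1 by rewrite expRN invrK.
apply: (@le_trans _ _ (1 - x)^-1); first by rewrite lef_pV2 ?posrE ?expR_gt0.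
rewrite -[leLHS]mul1r ler_pdivrMr//.
have -> : (1 + x + 2 * x ^+ 2) * (1 - x) = 1 + x ^+ 2 * (1 - 2 * x) by ring.
by rewrite lerDl mulr_ge0 ?sqr_ge0//; lra.
Qed.

Lemma expR_convex (t a b : R) : 0 <= t <= 1 ->
  expR ((1 - t) * a + t * b) <= (1 - t) * expR a + t * expR b.
Proof.
move=> /andP[t0 t1]; have [z zE] : exists z, z = (1 - t) * a + t * b by eexists.
rewrite -zE.
have tang c : expR z * (1 + (c - z)) <= expR c.
  have {2}-> : c = z + (c - z) by ring.
  by rewrite [in leRHS]expRD ler_wpM2l ?expR_ge0// expR_ge1Dx.
have h : (1 - t) * (expR z * (1 + (a - z))) + t * (expR z * (1 + (b - z))) = expR z.
  transitivity (expR z * (1 + ((1 - t) * a + t * b - z))); first by ring.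
  by rewrite -zE subrr addr0 mulr1.
by rewrite -h lerD// ler_wpM2l//; lra.
Qed.

(** Hoelder with exponents 3/2 and 3: both exponentials are normalised to mean at most 1, and
    convexity of the exponential is applied pointwise. *)
Lemma expect_exp_holder (p q : T -> R) (la lb : R) : bmf p -> bmf q ->
  \int[P]_w expR (3 / 2 * p w) <= expR la -> \int[P]_w expR (3 * q w) <= expR lb ->
  \int[P]_w expR (p w + q w) <= expR (2 / 3 * la + 1 / 3 * lb).
Proof.
move=> bp bq hp hq; set c := 2 / 3 * la + _.
have bep : bmf (fun w => expR (3 / 2 * p w)) by apply: bmf_expR; exact: bmfZ.
have beq : bmf (fun w => expR (3 * q w)) by apply: bmf_expR; exact: bmfZ.
apply: (@le_trans _ _ (\int[P]_w (expR c * (2 / 3 * expR (- la) * expR (3 / 2 * p w) + 1 / 3 * expR (- lb) * expR (3 * q w))))).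
  apply: expect_le.
  - by apply: bmf_expR; exact: bmfD.
  - by apply: bmfZ; apply: bmfD; exact: bmfZ.
  move=> w; have := @expR_convex (1 / 3) (3 / 2 * p w - la) (3 * q w - lb).
  have -> : (0 <= 1 / 3 :> R) && (1 / 3 <= 1 :> R) by apply/andP; split; lra.
  move=> /(_ isT) h.
  have -> : p w + q w = c + ((1 - 1 / 3) * (3 / 2 * p w - la) + 1 / 3 * (3 * q w - lb)).
    by rewrite /c; field.
  rewrite expRD ler_wpM2l ?expR_ge0//; apply: (le_trans h).
  by rewrite !expRD le_eqVlt; apply/orP; left; apply/eqP; field.
rewrite expectZ; last by apply: bmfD; exact: bmfZ.
rewrite expectD ?expectZ//; [|exact: bmfZ|exact: bmfZ].
rewrite -[leRHS]mulr1 ler_wpM2l ?expR_ge0//.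
have ha : expR (- la) * \int[P]_w expR (3 / 2 * p w) <= 1.
  by rewrite (le_trans (ler_wpM2l (expR_ge0 _) hp))// -expRD addNr expR0.
have hb : expR (- lb) * \int[P]_w expR (3 * q w) <= 1.
  by rewrite (le_trans (ler_wpM2l (expR_ge0 _) hq))// -expRD addNr expR0.
by rewrite -!mulrA; lra.
Qed.

(* Only a lower bound on [h] makes [- s h] bounded above, which is all the quadratic bound on the exponential needs. *)
Lemma expect_exp_centered (h : T -> R) (s V c : R) : bmf h -> 0 <= s -> \int[P]_w h w = 0 ->
  (forall w, - c <= h w) -> s * c <= 2^-1 -> \int[P]_w (h w) ^+ 2 <= V ->
  \int[P]_w expR (- s * h w) <= expR (2 * V * s ^+ 2).
Proof.
move=> bh s0 h0 hc sc hV.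
have bh2 : bmf (fun w => h w ^+ 2) by under eq_fun do rewrite expr2; exact: bmfM.
apply: (@le_trans _ _ (\int[P]_w (1 + (- s * h w + 2 * s ^+ 2 * (h w) ^+ 2)))).
  apply: expect_le.
  - by apply: bmf_expR; exact: bmfZ.
  - by apply: bmfD; [exact: bmf_cst|apply: bmfD; exact: bmfZ].
  move=> w; have -> : 1 + (- s * h w + 2 * s ^+ 2 * h w ^+ 2) = 1 + (- s * h w) + 2 * (- s * h w) ^+ 2 by ring.
  apply: expR_le_quad; rewrite mulNr -mulrN (le_trans _ sc)// ler_wpM2l// lerNl; exact: hc.
rewrite expectD; [|exact: bmf_cst|by apply: bmfD; exact: bmfZ].
rewrite expectD ?expectZ ?expect_cst ?h0 ?mulr0 ?add0r//; [|exact: bmfZ|exact: bmfZ].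
apply: le_trans (expR_ge1Dx _); rewrite lerD2l [leRHS]mulrAC ler_wpM2l// mulr_ge0// exprn_ge0//.
Qed.

End ExponentialMoments.

(** * Kernel families and exponential moments uniform in the range *)

Section KernelFamily.
Context (R : realType).
Implicit Types (F : R -> R -> R -> R).

(* Brownian scaling by [n] turns [F eps] into [F (eps sqrt n)]; [m] controls the first two moments. *)
Definition kfam F (m B : R) : Prop := [/\ 0 <= m, 0 <= B &
  forall eps, 0 < eps ->
   [/\ dens (F eps) (eps * m) (eps ^+ 2 * m), (forall x y, F eps x y <= B / eps ^+ 2) &
    forall n, (0 < n)%N -> rescale (Num.sqrt n%:R)^-1 (F eps) = fun x y => n%:R * F (eps * Num.sqrt n%:R) x y]].

Lemma schwartz_kfam (phi : R -> R -> R) : schwartz2 phi -> (forall x y, 0 <= phi x y) ->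
  (\int[(lebesgue_measure \x lebesgue_measure)%E]_(p in [set: R * R]) (phi p.1 p.2)%:E)%E = 1%E ->
  exists m B, kfam (phi_eps phi) m B.
Proof.
move=> sp p0 p1; have [m [B [m0 B0 H]]] := schwartz_dens sp p0 p1.
exists m, B; split=> // eps e0; have [h1 h2] := H _ e0; split=> // n n0.
apply/funext => x; apply/funext => y; rewrite /rescale /phi_eps.
have sn : 0 < Num.sqrt n%:R :> R by rewrite sqrtr_gt0 ltr0n.
have sn2 : Num.sqrt n%:R ^+ 2 = n%:R :> R by rewrite sqr_sqrtr.
rewrite mulrA; congr (_ * phi _ _).
- by rewrite exprMn sn2; field; rewrite gt_eqF ?ltr0n// gt_eqF.
- by field; rewrite !gt_eqF.
- by field; rewrite !gt_eqF.
Qed.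

Lemma kfam_bker F m B eps : kfam F m B -> 0 < eps -> bker (F eps) (B / eps ^+ 2).
Proof.
move=> [_ _ H] e0; have [[cF [F0 _] _ _ _] FB _] := H _ e0; split=> // x y.
by rewrite ger0_norm.
Qed.

Lemma kfam_ge0 F m B eps : kfam F m B -> 0 < eps -> forall x y, 0 <= F eps x y.
Proof. by move=> [_ _ H] e0; have [[_ [F0 _] _ _ _] _ _] := H _ e0. Qed.

Definition silt d (Omega : measurableType d) (X1 X2 : R -> Omega -> R) (f : R -> R -> R) (w : Omega) : R :=
  fine (\int[lebesgue_measure]_(s in `[0%R, 1%R]%classic)
     \int[lebesgue_measure]_(u in `[0%R, s]%classic) (f (X1 s w - X1 u w) (X2 s w - X2 u w))%:E)%E.

Section OneFamily.
Context d (Omega : measurableType d) (P : probability Omega R) (X1 X2 : R -> Omega -> R).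
Hypothesis BX : planar_BM P X1 X2.
Variables (F : R -> R -> R -> R) (m B : R).
Hypothesis FF : kfam F m B.

Let blkBM n b : (0 < n)%N -> planar_BM P (blk n b X1) (blk n b X2).
Proof. exact: blk_BM. Qed.

Lemma silt_siltof Y1 Y2 eps : planar_BM P Y1 Y2 -> 0 < eps -> siltof (F eps) Y1 Y2 (silt Y1 Y2 (F eps)).
Proof. by move=> BY e0; apply: silt_exists BY (kfam_bker FF e0) (kfam_ge0 FF e0). Qed.

Lemma silt_bmf Y1 Y2 eps : planar_BM P Y1 Y2 -> 0 < eps -> bmf (silt Y1 Y2 (F eps)).
Proof. by move=> BY e0; exact: siltof_bmf BY (kfam_bker FF e0) (silt_siltof BY e0). Qed.

Lemma silt_ge0 Y1 Y2 eps w : planar_BM P Y1 Y2 -> 0 < eps -> 0 <= silt Y1 Y2 (F eps) w.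
Proof.
move=> BY e0; apply: fine_ge0; apply: integral_ge0 => s _; apply: integral_ge0 => u _.
by rewrite lee_fin (kfam_ge0 FF e0).
Qed.

Lemma silt_law Y1 Y2 eps g : planar_BM P Y1 Y2 -> 0 < eps -> continuous g ->
  \int[P]_w g (silt Y1 Y2 (F eps) w) = \int[P]_w g (silt X1 X2 (F eps) w).
Proof.
move=> BY e0 cg; exact: (siltof_law BY BX (kfam_bker FF e0) cg (silt_siltof BY e0) (silt_siltof BX e0)).
Qed.

Definition smean eps := \int[P]_w silt X1 X2 (F eps) w.
Definition lap eps th := \int[P]_w expR (- th * (silt X1 X2 (F eps) w - smean eps)).
Local Notation sblk n b eps := (silt (blk n b X1) (blk n b X2) (F eps)).

Lemma smean_blk n b eps : (0 < n)%N -> 0 < eps -> \int[P]_w sblk n b eps w = smean eps.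
Proof. by move=> n0 e0; exact: (silt_law (g := id) (blkBM b n0) e0 (fun x => cvg_id)). Qed.

Let sqrtn_gt0 n : (0 < n)%N -> 0 < Num.sqrt n%:R :> R.
Proof. by move=> n0; rewrite sqrtr_gt0 ltr0n. Qed.

Lemma sblk_siltof n b eps : (0 < n)%N -> 0 < eps ->
  siltof (rescale (Num.sqrt n%:R)^-1 (F eps)) (blk n b X1) (blk n b X2)
    (fun w => n%:R * sblk n b (eps * Num.sqrt n%:R) w).
Proof.
move=> n0 e0; have [_ _ H] := FF; have [_ _ ->//] := H _ e0.
by apply: siltofZ; apply: silt_siltof; [exact: blkBM|rewrite mulr_gt0// sqrtn_gt0].
Qed.

Let exp_cont (c e : R) : continuous (fun x : R => expR (c * (x - e))).
Proof.
move=> x; apply: continuous_comp; last exact: continuous_expR.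
by apply: cvgM; [exact: cvg_cst|apply: cvgB; [exact: cvg_id|exact: cvg_cst]].
Qed.

Lemma silt_ge_blocks n eps w : (0 < n)%N -> 0 < eps ->
  n%:R^-1 * (\sum_(b < n) sblk n b (eps * Num.sqrt n%:R) w) <= silt X1 X2 (F eps) w.
Proof.
move=> n0 e0.
have := siltof_split w n0 (kfam_ge0 FF e0) (silt_siltof BX e0) (fun b => @sblk_siltof n b eps n0 e0).
by rewrite -mulr_sumr expr2 mulrA mulfVK// pnatr_eq0 -lt0n.
Qed.

Lemma kfam_increment_le eps u s x0 y0 : 0 < eps -> 0 <= u -> u < s ->
  0 <= \int[P]_w F eps (x0 + (X1 s w - X1 u w)) (y0 + (X2 s w - X2 u w)) <= (pi *+ 2 * (s - u))^-1.
Proof. by move=> e0 u0 us; have [_ _ H] := FF; have [D _ _] := H _ e0; exact: (increment_le BX u0 us _ _ D). Qed.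

Lemma smean_scale n eps : (0 < n)%N -> 0 < eps ->
  smean eps - smean (eps * Num.sqrt n%:R) <= (pi *+ 2)^-1 * ln n%:R.
Proof.
move=> n0 e0; have nR : n%:R != 0 :> R by rewrite pnatr_eq0 -lt0n.
have := split_mean_le BX (kfam_bker FF e0) (silt_siltof BX e0) n0 _ (fun b => @sblk_siltof n b eps n0 e0).
have -> : n%:R^-1 ^+ 2 * (\sum_(b < n) \int[P]_w (n%:R * sblk n b (eps * Num.sqrt n%:R) w)) = smean (eps * Num.sqrt n%:R).
  rewrite (eq_bigr (fun=> n%:R * smean (eps * Num.sqrt n%:R))).
    rewrite sumr_const card_ord -[X in _ * X]mulr_natl.
    by move: (smean _) => s; field.
  have e0' : 0 < eps * Num.sqrt n%:R by rewrite mulr_gt0// sqrtn_gt0.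
  by move=> b _; rewrite expectZ ?smean_blk//; apply: silt_bmf => //; exact: blkBM.
apply => u s u0 us _; have /andP[_] := kfam_increment_le 0 0 e0 u0 us.
by under eq_Rintegral do rewrite !add0r.
Qed.

Lemma lap_blk n b eps th : (0 < n)%N -> 0 < eps ->
  \int[P]_w expR (- th * (sblk n b eps w - smean eps)) = lap eps th.
Proof.
move=> n0 e0; apply: (silt_law (g := fun x => expR (- th * (x - smean eps)))) => //.
exact: blkBM.
Qed.

Lemma lap_blocks n eps th : (0 < n)%N -> 0 < eps ->
  \int[P]_w (\prod_(b < n) expR (- th * (sblk n b eps w - smean eps))) = lap eps th ^+ n.
Proof.
move=> n0 e0.
rewrite (siltof_indep (A := fun b => sblk n b eps) (g := fun x => expR (- th * (x - smean eps))) BX n0 (kfam_bker FF e0)) //.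
  transitivity (\prod_(b < n) lap eps th); last by rewrite prodr_const card_ord.
  by apply: eq_bigr => b _; exact: lap_blk.
by move=> b; apply: silt_siltof => //; exact: blkBM.
Qed.

Lemma lap_superscale n eps th : (0 < n)%N -> 0 < eps -> 0 <= th ->
  lap eps (n%:R * th) <= lap (eps * Num.sqrt n%:R) th ^+ n * expR (n%:R * th * ((pi *+ 2)^-1 * ln n%:R)).
Proof.
move=> n0 e0 th0; have nR : 0 < n%:R :> R by rewrite ltr0n.
have e0' : 0 < eps * Num.sqrt n%:R by rewrite mulr_gt0// sqrtn_gt0.
set e' := eps * _ in e0' *.
rewrite -(lap_blocks th n0 e0') [leRHS]mulrC.
have bs b : bmf (sblk n b e') by apply: silt_bmf => //; exact: blkBM.
have bp : bmf (fun w => \prod_(b < n) expR (- th * (sblk n b e' w - smean e'))).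
  apply: bmf_prod => b; apply: bmf_expR; apply: bmfZ; apply: bmfB => //; exact: bmf_cst.
rewrite -expectZ//; apply: expect_le; last 1 first.
- move=> w; rewrite -expR_sum -expRD ler_expR -mulr_sumr sumrB sumr_const card_ord -[smean e' *+ n]mulr_natl.
  have h1 := silt_ge_blocks w n0 e0; have h2 := smean_scale n0 e0; rewrite -/e' in h1 h2.
  rewrite mulrC ler_pdivrMr// in h1.
  set S := \sum_(b < n) _ in h1 *; set A := silt _ _ _ _ in h1 *.
  set q := _ * ln _ in h2 *.
  have -> : n%:R * th * q + - th * (S - n%:R * smean e') = - th * (S - n%:R * smean e' - n%:R * q) by ring.
  have h3 := ler_wpM2l (ltW nR) h2.
  have h4 : S - n%:R * smean e' - n%:R * q <= n%:R * (A - smean eps).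
    by clear -h1 h3; move: h1 h3; clearbody S A q; move: (smean eps) (smean e') (n%:R : R) => a b c; lra.
  have -> : - (n%:R * th) * (A - smean eps) = - th * (n%:R * (A - smean eps)) by ring.
  by rewrite ler_wnM2l// oppr_le0.
- by apply: bmf_expR; apply: bmfZ; apply: bmfB; [exact: silt_bmf|exact: bmf_cst].
- exact: bmfZ.
Qed.

Lemma pi2_ge1 : 1 <= pi *+ 2 :> R.
Proof. by rewrite mulr2n; have := @pi_ge2 R; lra. Qed.

Lemma kfam_kernel_bound eps : 0 < eps -> kernel_bound P X1 X2 (F eps) 1 1.
Proof.
move=> e0 u s u0 us s1; set a := s - u; have a0 : 0 < a by rewrite subr_gt0.
have a1 : a <= 1 by rewrite /a; lra.
have k : (pi *+ 2 * a)^-1 <= a^-1.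
  by rewrite lef_pV2 ?posrE ?mulr_gt0 ?(lt_le_trans ltr01 pi2_ge1)// ler_peMl ?(ltW a0)// pi2_ge1.
split=> [x0 y0|].
  have /andP[h1 h2] := kfam_increment_le x0 y0 e0 u0 us; rewrite -/a in h2.
  rewrite ger0_norm// (le_trans h2)// (le_trans k)// div1r lef_pV2 ?posrE ?mulr_gt0 ?sqrtr_gt0//.
  by rewrite ler_piMr ?(ltW a0)// -[leRHS]sqrtr1 ler_sqrt.
have /andP[h1 h2] := kfam_increment_le 0 0 e0 u0 us; rewrite -/a in h2.
rewrite div1r (le_trans _ k)// (le_trans _ h2)//.
under eq_Rintegral do rewrite ger0_norm ?(kfam_ge0 FF e0)//.
by under [leRHS]eq_Rintegral do rewrite !add0r.
Qed.

Let e2 (eps : R) : R := eps * Num.sqrt 2%:R.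

Let e2_gt0 (eps : R) : 0 < eps -> 0 < e2 eps.
Proof. by move=> e0; rewrite mulr_gt0// sqrtn_gt0. Qed.

(** The interaction between the two halves of the path: by Brownian scaling each half contributes a
    multiple of a local time of range [e2 eps], and these are subtracted. *)
Definition overlap eps w := silt X1 X2 (F eps) w - 2%:R^-1 * (\sum_(b < 2) sblk 2 b (e2 eps) w).

Lemma overlap_bmf eps : 0 < eps -> bmf (overlap eps).
Proof.
move=> e0; apply: bmfB; first exact: silt_bmf.
by apply: bmfZ; apply: bmf_sum => b; apply: silt_bmf; [exact: blkBM|exact: e2_gt0].
Qed.

Lemma overlap_ge0 eps w : 0 < eps -> 0 <= overlap eps w.
Proof. by move=> e0; rewrite subr_ge0; exact: silt_ge_blocks. Qed.

Lemma overlap_mean eps : 0 < eps -> \int[P]_w overlap eps w = smean eps - smean (e2 eps).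
Proof.
move=> e0; have bs (b : 'I_2) : bmf (sblk 2 b (e2 eps)) by apply: silt_bmf; [exact: blkBM|exact: e2_gt0].
rewrite expectB; [|exact: silt_bmf|by apply: bmfZ; exact: bmf_sum].
rewrite expectZ ?expect_sum//; last exact: bmf_sum.
rewrite (eq_bigr (fun=> smean (e2 eps))); last by move=> b _; apply: smean_blk => //; exact: e2_gt0.
by rewrite sumr_const card_ord -[X in _ - _ * X]mulr_natl mulKf.
Qed.

Lemma overlap_mean_le1 eps : 0 < eps -> \int[P]_w overlap eps w <= 1.
Proof.
move=> e0; rewrite overlap_mean// (le_trans (smean_scale (isT : (0 < 2)%N) e0))//.
have l2 : ln 2%:R <= 1 :> R.
  have := @le_ln1Dx R 1; rewrite (_ : 1 + 1 = 2)//; apply.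
  by rewrite (lt_trans _ ltr01)// oppr_lt0.
have l0 : 0 <= ln 2%:R :> R by rewrite ln_ge0// ler1n.
have p1 : (pi *+ 2)^-1 <= 1 :> R by rewrite invf_le1 ?pi2_ge1// (lt_le_trans ltr01 pi2_ge1).
by rewrite (le_trans (ler_wpM2r l0 p1))// mul1r.
Qed.

Lemma overlap_second_moment eps : 0 < eps -> \int[P]_w (overlap eps w) ^+ 2 <= 512.
Proof.
move=> e0.
have := split_second_moment BX (kfam_bker FF e0) (silt_siltof BX e0) ler01 ler01 (kfam_kernel_bound e0)
  (fun b => @sblk_siltof 2 b eps isT e0).
rewrite !mulr1; apply: le_trans; rewrite le_eqVlt; apply/orP; left; apply/eqP.
apply: eq_Rintegral => w _; congr (_ ^+ 2); rewrite /overlap; congr (_ - _).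
by rewrite -mulr_sumr -/(e2 eps); move: (\sum_(b < 2) _) => t; field.
Qed.

Lemma smean_itv eps : 0 < eps -> 0 <= smean eps <= B / eps ^+ 2.
Proof.
move=> e0; apply/andP; split; first by apply: Rintegral_ge0 => w _; exact: silt_ge0.
rewrite -(expect_cst P (B / _)); apply: expect_le; [exact: silt_bmf|exact: bmf_cst|move=> w].
by rewrite (le_trans (ler_norm _))// (siltof_bound (kfam_bker FF e0) (silt_siltof BX e0)).
Qed.

Lemma centered_silt_bmf eps : 0 < eps -> bmf (fun w => silt X1 X2 (F eps) w - smean eps).
Proof. by move=> e0; apply: bmfB; [exact: silt_bmf|exact: bmf_cst]. Qed.

Lemma centered_silt_mean eps : 0 < eps -> \int[P]_w (silt X1 X2 (F eps) w - smean eps) = 0.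
Proof. by move=> e0; rewrite expectB ?expect_cst ?subrr//; [exact: silt_bmf|exact: bmf_cst]. Qed.

(** [K] must absorb the recursion K -> 3/4 K + 3072 of [lap_step], hence 4 * 3072 = 12288; the
    summand [2 * B ^+ 2] settles [eps >= 1]. For [th <= th0] one has 3 th <= 1/2 and th B <= 1/2,
    the smallness required by [expect_exp_centered]. *)
Let K := 12288 + 2 * B ^+ 2.
Let th0 := (6 + 2 * B)^-1.
Let B0 : 0 <= B. Proof. by have [] := FF. Qed.

Let K_fix : 3 / 4 * K + 3072 <= K.
Proof.
have K1 : 12288 <= K by rewrite /K lerDl; apply: mulr_ge0; [exact: ler0n|exact: sqr_ge0].
have -> : 3072 = 12288 / 4 :> R by apply/(canRL (mulfK _)); rewrite -?natrM// pnatr_eq0.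
rewrite -[leRHS]mul1r -lerBrDl -mulrBl.
have -> : 1 - 3 / 4 = 4^-1 :> R by field.
by rewrite mulrC ler_wpM2l// invr_ge0.
Qed.

Lemma lap_base eps th : 1 <= eps -> 0 <= th -> th <= th0 -> lap eps th <= expR (K * th ^+ 2).
Proof.
move=> e1 t0 tt; have e0 : 0 < eps by exact: lt_le_trans e1.
have BB : B / eps ^+ 2 <= B by rewrite ler_pdivrMr ?exprn_gt0// ler_peMr// exprn_ege1.
have /andP[m0 m1] := smean_itv e0.
have s1 w : 0 <= silt X1 X2 (F eps) w <= B.
  rewrite silt_ge0//= (le_trans _ BB)// (le_trans (ler_norm _))//.
  exact: (siltof_bound (kfam_bker FF e0) (silt_siltof BX e0)).
have bc := centered_silt_bmf e0.
have V : \int[P]_w (silt X1 X2 (F eps) w - smean eps) ^+ 2 <= B ^+ 2.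
  rewrite -(expect_cst P (B ^+ 2)); apply: expect_le; [|exact: bmf_cst|].
    by under eq_fun do rewrite expr2; exact: bmfM.
  move=> w; have /andP[a b] := s1 w; rewrite -(real_normK (num_real _)) lerXn2r ?nnegrE//.
  by rewrite ler_norml; apply/andP; split; lra.
have tB : th * B <= 2^-1.
  rewrite (le_trans (ler_wpM2r B0 tt))// /th0 mulrC ler_pdivrMr; last by rewrite ltr_wpDr// mulr_ge0.
  lra.
have lo w : - B <= silt X1 X2 (F eps) w - smean eps by have /andP[a b] := s1 w; lra.
apply: (le_trans (expect_exp_centered bc t0 (centered_silt_mean e0) lo tB V)).
rewrite ler_expR; apply: ler_wpM2r; first exact: sqr_ge0.
by rewrite /K lerDr; exact: ler0n.
Qed.

(** The centred local time is half of [S], the sum over both halves, plus the centred overlap [h].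
    Hoelder raises th / 2 on [S] to 3/4 th, where the induction hypothesis serves both independent
    halves, and 2/3 * 2 * (3/4)^2 = 3/4. On [h] the parameter is 3 th, and 1/3 * 2 * 512 * 9 =
    3072. *)
Lemma lap_step eps th : 0 < eps -> 0 <= th -> th <= th0 ->
  lap (e2 eps) (3 / 4 * th) <= expR (K * (3 / 4 * th) ^+ 2) -> lap eps th <= expR (K * th ^+ 2).
Proof.
move=> e0 t0 tt IH; have e0' := e2_gt0 e0.
have bs b : bmf (sblk 2 b (e2 eps)) by apply: silt_bmf => //; exact: blkBM.
have bc b : bmf (fun w => sblk 2 b (e2 eps) w - smean (e2 eps)) by apply: bmfB => //; exact: bmf_cst.
pose S w := \sum_(b < 2) (sblk 2 b (e2 eps) w - smean (e2 eps)).
have bS : bmf S by apply: bmf_sum.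
pose c := \int[P]_w overlap eps w.
have c1 : c <= 1 := overlap_mean_le1 e0.
pose h w := overlap eps w - c.
have bo := overlap_bmf e0.
have bh : bmf h by apply: bmfB => //; exact: bmf_cst.
have h0 : \int[P]_w h w = 0 by rewrite expectB ?expect_cst ?subrr//; exact: bmf_cst.
have hV : \int[P]_w (h w) ^+ 2 <= 512.
  apply: le_trans (overlap_second_moment e0).
  have bo2 : bmf (fun w => overlap eps w ^+ 2) by under eq_fun do rewrite expr2; exact: bmfM.
  have E w : h w ^+ 2 = overlap eps w ^+ 2 - (2 * c * overlap eps w - c ^+ 2) by rewrite /h; ring.
  under eq_Rintegral do rewrite E.
  rewrite expectB//; last by apply: bmfB; [exact: bmfZ|exact: bmf_cst].
  have -> : \int[P]_w (2 * c * overlap eps w - c ^+ 2) = 2 * c * c - c ^+ 2.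
    by rewrite (expectB P (bmfZ (2 * c) bo) (bmf_cst _ (c ^+ 2))) (expectZ P (2 * c) bo) expect_cst.
  rewrite lerBlDr lerDl; have := sqr_ge0 c; rewrite expr2; lra.
have hq : \int[P]_w expR (3 * (- th * h w)) <= expR (2 * 512 * (3 * th) ^+ 2).
  have t3 : 0 <= 3 * th by rewrite mulr_ge0.
  have -> : \int[P]_w expR (3 * (- th * h w)) = \int[P]_w expR (- (3 * th) * h w).
    by apply: eq_Rintegral => w _; congr expR; ring.
  apply: (expect_exp_centered bh t3 h0 (c := 1) _ _ hV).
    by move=> w; rewrite /h; have := overlap_ge0 w e0; lra.
  have : th0 <= 6^-1 by rewrite /th0 lef_pV2 ?posrE ?lerDl ?mulr_ge0// ltr_wpDr// mulr_ge0.
  rewrite mulr1; lra.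
have hp : \int[P]_w expR (3 / 2 * (- (th / 2) * S w)) <= expR (2 * (K * (3 / 4 * th) ^+ 2)).
  have -> : \int[P]_w expR (3 / 2 * (- (th / 2) * S w)) =
     \int[P]_w (\prod_(b < 2) expR (- (3 / 4 * th) * (sblk 2 b (e2 eps) w - smean (e2 eps)))).
    by apply: eq_Rintegral => w _; rewrite -expR_sum -mulr_sumr; congr expR; rewrite -/(S w); field.
  rewrite lap_blocks//; set X := K * _.
  have -> : 2 * X = X + X by ring.
  rewrite expRD -expr2 lerXn2r ?nnegrE ?expR_ge0//.
  by apply: Rintegral_ge0 => w _; exact: expR_ge0.
have := expect_exp_holder (bmfZ (- (th / 2)) bS) (bmfZ (- th) bh) hp hq.
have -> : \int[P]_w expR (- (th / 2) * S w + - th * h w) = lap eps th.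
  apply: eq_Rintegral => w _; congr expR; rewrite /h /c overlap_mean// /overlap /S sumrB sumr_const card_ord.
  rewrite -[smean (e2 eps) *+ 2]mulr_natl.
  by move: (\sum_(b < 2) _) (smean _) (smean _) (silt _ _ _ _) => t1 t2 t3 t4; field.
move=> H; apply: (le_trans H); rewrite ler_expR.
have -> : 2 / 3 * (2 * (K * (3 / 4 * th) ^+ 2)) + 1 / 3 * (2 * 512 * (3 * th) ^+ 2) = (3 / 4 * K + 3072) * th ^+ 2.
  by field.
by apply: ler_wpM2r; [exact: sqr_ge0|exact: K_fix].
Qed.

(** Each step doubles [eps ^+ 2], so range 1 is reached after finitely many steps. *)
Lemma scale_ind (Q : R -> Prop) : (forall eps, 1 <= eps -> Q eps) ->
  (forall eps, 0 < eps -> Q (eps * Num.sqrt 2%:R) -> Q eps) -> forall eps, 0 < eps -> Q eps.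
Proof.
move=> Q1 Q2.
suff H l : forall eps, 0 < eps -> 1 <= eps ^+ 2 * 2 ^+ l -> Q eps.
  move=> eps e0; apply: (H (Num.truncn (eps ^- 2)).+1) => //.
  rewrite mulrC -ler_pdivrMr ?exprn_gt0// div1r.
  rewrite (le_trans (ltW (truncnS_gt _)))// -natrX ler_nat ltnW// ltn_expl//.
elim: l => [|l IH] eps e0 h.
  by apply: Q1; rewrite mulr1 in h; rewrite -(ler_pXn2r (n := 2)) ?nnegrE ?expr1n ?(ltW e0).
apply: Q2 => //; apply: IH; first exact: e2_gt0.
by rewrite exprMn sqr_sqrtr// -mulrA -exprS.
Qed.

Lemma lap_small eps th : 0 < eps -> 0 <= th -> th <= th0 -> lap eps th <= expR (K * th ^+ 2).
Proof.
move=> e0; move: eps e0 th.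
apply: (scale_ind (Q := fun eps => forall th, 0 <= th -> th <= th0 -> lap eps th <= expR (K * th ^+ 2))).
  by move=> eps e1 th t0 tt; exact: lap_base.
move=> eps e0 IH th t0 tt; apply: lap_step => //; apply: IH; first by rewrite mulr_ge0// divr_ge0.
by rewrite (le_trans _ tt)// ler_piMl//; lra.
Qed.

(** [lap_small] covers only [th <= th0]. A larger [th] is divided by a suitable [n] through
    [lap_superscale], at the price of a bound that depends on [th] but not on [eps]. *)
Lemma lap_unif th : 0 <= th -> exists Q : R, forall eps, 0 < eps -> lap eps th <= Q.
Proof.
move=> t0; have th00 : 0 < th0 by rewrite invr_gt0 ltr_wpDr// mulr_ge0.
pose n := (Num.truncn (th / th0)).+1.
have nR : 0 < n%:R :> R by rewrite ltr0n.
pose t := th / n%:R.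
have tt : t <= th0.
  by rewrite ler_pdivrMr// -ler_pdivrMl// mulrC ltW// truncnS_gt.
have t00 : 0 <= t by rewrite divr_ge0// ltW.
exists (expR (K * t ^+ 2) ^+ n * expR (n%:R * t * ((pi *+ 2)^-1 * ln n%:R))) => eps e0.
have -> : th = n%:R * t by rewrite /t mulrC divfK// gt_eqF.
apply: (le_trans (lap_superscale (isT : (0 < n)%N) e0 t00)); rewrite ler_wpM2r ?expR_ge0//.
rewrite lerXn2r ?nnegrE ?expR_ge0//; first by apply: Rintegral_ge0 => w _; exact: expR_ge0.
by apply: lap_small => //; rewrite mulr_gt0// sqrtn_gt0.
Qed.

End OneFamily.
End KernelFamily.

Section SecondMomentSplit.
Context d (T : measurableType d) (R : realType) (P : probability T R).

(* The factor [5 / 8] is below [1 / sqrt 2], so a bound [K eps] survives one doubling of the time scale. *)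
Lemma second_moment_split (Y z0 z1 al : T -> R) (c V A : R) : bmf Y -> bmf z0 -> bmf z1 -> bmf al ->
  (forall w, Y w = 2^-1 * (z0 w + z1 w) + (al w - c)) -> \int[P]_w al w = c ->
  \int[P]_w (z0 w) ^+ 2 = V -> \int[P]_w (z1 w) ^+ 2 = V -> \int[P]_w (z0 w * z1 w) = 0 ->
  \int[P]_w (al w) ^+ 2 <= A -> \int[P]_w (Y w) ^+ 2 <= 5 / 8 * V + 5 * A.
Proof.
move=> bY b0 b1 bal YE alc V0 V1 V01 hA.
have sq (h : T -> R) : bmf h -> bmf (fun w => h w ^+ 2).
  by move=> bh; under eq_fun do rewrite expr2; exact: bmfM.
have q0 := sq _ b0; have q1 := sq _ b1; have qal := sq _ bal; have b01 := bmfM b0 b1.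
have r1 := bmfD q0 q1; have r2 := bmfZ 2 b01; have r3 := bmfD r1 r2.
have u1 := bmfZ (- (2 * c)) bal; have u2 := bmfD qal u1; have u3 := bmfD u2 (bmf_cst _ (c ^+ 2)).
have v1 := bmfZ (5 / 16) r3; have v2 := bmfZ 5 u3.
have := expect_le P (sq _ bY) (bmfD v1 v2) _.
rewrite (expectD P v1 v2) (expectZ P _ r3) (expectZ P _ u3) (expectD P r1 r2) (expectD P q0 q1) (expectZ P _ b01).
rewrite (expectD P u2 (bmf_cst _ (c ^+ 2))) (expectD P qal u1) (expectZ P _ bal) expect_cst.
rewrite V0 V1 V01 alc => H; apply: (le_trans (H _)); last by have := sqr_ge0 c; rewrite expr2; lra.
move=> w; rewrite YE; set x := z0 w; set y := z1 w; set q := al w.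
have := sqr_ge0 (4^-1 * (x + y) - 2 * (q - c)); nra.
Qed.

End SecondMomentSplit.

(** * Comparison of two kernel families *)

Section TwoFamilies.
Context (R : realType) d (Omega : measurableType d) (P : probability Omega R) (X1 X2 : R -> Omega -> R).
Hypothesis BX : planar_BM P X1 X2.
Variables (F G : R -> R -> R -> R) (m B m' B' : R).
Hypotheses (FF : kfam F m B) (GG : kfam G m' B').

Let g eps x y := F eps x y - G eps x y.
Let gA (Y1 Y2 : R -> Omega -> R) eps w := silt Y1 Y2 (F eps) w - silt Y1 Y2 (G eps) w.
Let gm eps := smean P X1 X2 F eps - smean P X1 X2 G eps.
Let M := m + m'.
Let m_ge0 : 0 <= m. Proof. by have [] := FF. Qed.
Let m'_ge0 : 0 <= m'. Proof. by have [] := GG. Qed.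
Let B_ge0 : 0 <= B. Proof. by have [] := FF. Qed.
Let B'_ge0 : 0 <= B'. Proof. by have [] := GG. Qed.
Let M_ge0 : 0 <= M. Proof. exact: addr_ge0. Qed.

Definition centered_diff eps w := (silt X1 X2 (F eps) w - smean P X1 X2 F eps) - (silt X1 X2 (G eps) w - smean P X1 X2 G eps).

Let g_bker eps : 0 < eps -> bker (g eps) (B / eps ^+ 2 + B' / eps ^+ 2).
Proof. by move=> e0; apply: bkerB; [exact: (kfam_bker FF e0)|exact: (kfam_bker GG e0)]. Qed.

Let gA_siltof Y1 Y2 eps : planar_BM P Y1 Y2 -> 0 < eps -> siltof (g eps) Y1 Y2 (gA Y1 Y2 eps).
Proof. by move=> BY e0; apply: siltofB; [exact: (silt_siltof FF BY e0)|exact: (silt_siltof GG BY e0)]. Qed.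

Let gA_bmf Y1 Y2 eps : planar_BM P Y1 Y2 -> 0 < eps -> bmf (gA Y1 Y2 eps).
Proof. by move=> BY e0; apply: bmfB; [exact: (silt_bmf FF BY e0)|exact: (silt_bmf GG BY e0)]. Qed.

Let gA_mean eps : 0 < eps -> \int[P]_w gA X1 X2 eps w = gm eps.
Proof. by move=> e0; rewrite expectB//; [exact: (silt_bmf FF BX e0)|exact: (silt_bmf GG BX e0)]. Qed.

(** Both kernels are close to the same point mass, so the heat kernel cancels in the difference and
    only the two Lipschitz errors remain. *)
Let g_kernel eps : 0 < eps -> kernel_bound P X1 X2 (g eps) (eps * M) 1.
Proof.
move=> e0 u s u0 us s1; set a := s - u; have a0 : 0 < a by rewrite subr_gt0.
have sa : 0 < Num.sqrt a by rewrite sqrtr_gt0.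
have NV : (0 : R) < 1 by [].
have [_ _ HF] := FF; have [DF _ _] := HF _ e0; have [_ _ HG] := GG; have [DG _ _] := HG _ e0.
have BXF x0 y0 : bmf (fun w => F eps (x0 + (X1 s w - X1 u w)) (y0 + (X2 s w - X2 u w))).
  have [mX _ _ _] := BX; have bF := kfam_bker FF e0; split; last by exists (B / eps ^+ 2) => w; exact: bF.2.
  apply: (measurable_plane_comp (continuous_plane_measurable bF.1)); apply: measurable_funD => //;
   apply: measurable_funB; solve [exact: (mX _).1 | exact: (mX _).2].
have BXG x0 y0 : bmf (fun w => G eps (x0 + (X1 s w - X1 u w)) (y0 + (X2 s w - X2 u w))).
  have [mX _ _ _] := BX; have bG := kfam_bker GG e0; split; last by exists (B' / eps ^+ 2) => w; exact: bG.2.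
  apply: (measurable_plane_comp (continuous_plane_measurable bG.1)); apply: measurable_funD => //;
   apply: measurable_funB; solve [exact: (mX _).1 | exact: (mX _).2].
have pi0 : 0 < pi :> R by exact: pi_gt0.
have p1 : pi^-1 <= 2^-1 :> R by rewrite lef_pV2 ?posrE// pi_ge2.
have p0 : 0 <= pi^-1 :> R by rewrite invr_ge0 ltW.
split=> [x0 y0|].
  rewrite /g expectB//.
  have hF := increment_lip BX u0 us x0 y0 DF; have hG := increment_lip BX u0 us x0 y0 DG.
  rewrite -/a in hF hG.
  have E q : (pi *+ 2 * a)^-1 * (2 / Num.sqrt a) * (eps * q) = pi^-1 * (eps * q / (a * Num.sqrt a)).
    rewrite -[pi *+ 2]mulr_natl; move: (gt_eqF pi0); generalize (pi : R) => p pn.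
    by field; rewrite pn !gt_eqF.
  rewrite !E in hF hG.
  set I := \int[P]_w F _ _ _ in hF *; set J := \int[P]_w G _ _ _ in hG *.
  have -> : I - J = (I - heat a x0 y0) - (J - heat a x0 y0) by ring.
  apply: (le_trans (ler_normB _ _)); apply: (le_trans (lerD hF hG)).
  rewrite -mulrDr -mulrDl -mulrDr -/M -[leRHS]mul1r ler_wpM2r ?divr_ge0 ?mulr_ge0 ?(ltW e0) ?(ltW a0) ?(ltW sa)//; lra.
have /andP[_ hF] := increment_le BX u0 us 0 0 DF; have /andP[_ hG] := increment_le BX u0 us 0 0 DG.
rewrite -/a in hF hG.
have F0 := kfam_ge0 FF e0; have G0 := kfam_ge0 GG e0.
have BF := BXF 0 0; have BG := BXG 0 0.
under eq_Rintegral do rewrite -[X1 s _ - _]add0r -[X2 s _ - _]add0r.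
apply: (@le_trans _ _ (\int[P]_w (F eps (0 + (X1 s w - X1 u w)) (0 + (X2 s w - X2 u w)) +
    G eps (0 + (X1 s w - X1 u w)) (0 + (X2 s w - X2 u w))))).
  apply: expect_le.
  - by apply: bmf_comp; [move=> x; exact: (@norm_continuous _ R^o)|exact: bmfB].
  - exact: bmfD.
  - by move=> w; rewrite (le_trans (ler_normB _ _))// !ger0_norm.
rewrite expectD//; apply: (le_trans (lerD hF hG)).
have -> : (pi *+ 2 * a)^-1 + (pi *+ 2 * a)^-1 = pi^-1 * a^-1.
  rewrite -[pi *+ 2]mulr_natl; move: (gt_eqF pi0); generalize (pi : R) => p pn.
  by field; rewrite pn !gt_eqF.
by rewrite ler_wpM2r ?invr_ge0 ?(ltW a0)//; lra.
Qed.

Let e2 (eps : R) : R := eps * Num.sqrt 2%:R.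
Let e2_gt0 (eps : R) : 0 < eps -> 0 < e2 eps.
Proof. by move=> e0; rewrite mulr_gt0// sqrtr_gt0. Qed.

(* Kept abstract: conversion would unfold the unary numeral [512]. *)
Variable C : R.
Hypothesis CE : C = 512.
Let C_ge0 : 0 <= C. Proof. by rewrite CE; exact: ler0n. Qed.
(** The factor 10 confines the cross term to a tenth of [K] in [diff_var_le]; the square settles
    [eps >= 1]. *)
Let K := 10 * (5 * (C * M)) + (B + B') ^+ 2.
Let CM_ge0 : 0 <= 10 * (5 * (C * M)). Proof. by do 3?apply: mulr_ge0. Qed.
Let K_ge0 : 0 <= K. Proof. by apply: addr_ge0 => //; exact: sqr_ge0. Qed.

Definition diff_var eps := \int[P]_w (centered_diff eps w) ^+ 2.

Let diffE eps w : centered_diff eps w = gA X1 X2 eps w - gm eps.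
Proof. rewrite /centered_diff /gA /gm.
by move: (silt _ _ _ w) (silt _ _ _ w) (smean _ _ _ _ _) (smean _ _ _ _ _) => a b c e; ring. Qed.

Lemma centered_diff_bmf eps : 0 < eps -> bmf (centered_diff eps).
Proof. by move=> e0; apply: bmfB; [exact: (centered_silt_bmf BX FF e0)|exact: (centered_silt_bmf BX GG e0)]. Qed.

Let sq_bmf (h : Omega -> R) : bmf h -> bmf (fun w => h w ^+ 2).
Proof. by move=> bh; under eq_fun do rewrite expr2; exact: bmfM. Qed.

Let diff_var_base eps : 1 <= eps -> diff_var eps <= K * eps.
Proof.
move=> e1; have e0 : 0 < eps by exact: lt_le_trans e1.
have bB (b : R) : 0 <= b -> b / eps ^+ 2 <= b.
  by move=> b0; rewrite ler_pdivrMr ?exprn_gt0// ler_peMr// exprn_ege1.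
have s1 (F' : R -> R -> R -> R) m1 B1 : kfam F' m1 B1 -> forall w, `|silt X1 X2 (F' eps) w - smean P X1 X2 F' eps| <= B1.
  move=> FF' w; have B10 : 0 <= B1 by have [] := FF'.
  have a0 := silt_ge0 FF' w BX e0; have a1 := siltof_bound (kfam_bker FF' e0) (silt_siltof FF' BX e0) w.
  have /andP[c0 c1] := smean_itv BX FF' e0; have := bB _ B10.
  by rewrite ger0_norm// in a1; rewrite ler_norml => h; apply/andP; split; lra.
apply: (@le_trans _ _ ((B + B') ^+ 2)).
  rewrite -(expect_cst P ((B + B') ^+ 2)); apply: expect_le; [|exact: bmf_cst|].
    by apply: sq_bmf; exact: centered_diff_bmf.
  move=> w; rewrite -(real_normK (num_real _)) lerXn2r ?nnegrE ?addr_ge0//.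
  by rewrite (le_trans (ler_normB _ _))// lerD//; [exact: (s1 _ _ _ FF)|exact: (s1 _ _ _ GG)].
apply: (@le_trans _ _ K); first by rewrite /K lerDr.
by rewrite ler_peMr.
Qed.

Let diff_var_step eps : 0 < eps -> diff_var eps <= 5 / 8 * diff_var (e2 eps) + 5 * (C * (eps * M)).
Proof.
move=> e0; have e0' := e2_gt0 e0.
have BB b : planar_BM P (blk 2 b X1) (blk 2 b X2) by exact: blk_BM.
pose Z b w := gA (blk 2 b X1) (blk 2 b X2) (e2 eps) w - gm (e2 eps).
have bZ b : bmf (Z b) by apply: bmfB; [exact: gA_bmf|exact: bmf_cst].
(* Powers 1 and 2 are used: for the mean and the independence of the halves, and for the
   variance. *)
have cZ (k : nat) : continuous (fun x : R => (x - gm (e2 eps)) ^+ k).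
  move=> x; apply: (continuous_comp (f := fun x => x - gm (e2 eps)) (g := fun x => x ^+ k)); last exact: exprn_continuous.
  by apply: cvgB; [exact: cvg_id|exact: cvg_cst].
have ZE (k : nat) b : \int[P]_w (Z b w) ^+ k = \int[P]_w (centered_diff (e2 eps) w) ^+ k.
  rewrite (siltof_law (BB b) BX (g_bker e0') (cZ k) (gA_siltof (BB b) e0') (gA_siltof BX e0')).
  by apply: eq_Rintegral => w _; rewrite diffE.
have Z1 b : \int[P]_w Z b w = 0.
  have := ZE 1%N b; rewrite -[LHS]/(\int[P]_w Z b w) => ->.
  under eq_Rintegral do rewrite expr1 diffE.
  by rewrite expectB ?expect_cst ?gA_mean ?subrr//; [exact: gA_bmf|exact: bmf_cst].
have Z2 b : \int[P]_w (Z b w) ^+ 2 = diff_var (e2 eps) := ZE 2%N b.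
have Z12 : \int[P]_w (Z 0%N w * Z 1%N w) = 0.
  have H : \int[P]_w (\prod_(b < 2) Z b w) = \prod_(b < 2) \int[P]_w Z b w :=
    siltof_indep (n := 2) (g := fun x => x - gm (e2 eps)) (A := fun b => gA (blk 2 b X1) (blk 2 b X2) (e2 eps))
     BX isT (g_bker e0') (cZ 1%N) (fun b => gA_siltof (BB b) e0').
  transitivity (\int[P]_w (\prod_(b < 2) Z b w)).
    by apply: eq_Rintegral => w _; rewrite big_ord_recl big_ord1.
  rewrite H big_ord_recl; apply: (etrans (congr1 (fun x => x * _) (Z1 _))); exact: mul0r.
pose al w := gA X1 X2 eps w - 2%:R^-1 * (\sum_(b < 2) gA (blk 2 b X1) (blk 2 b X2) (e2 eps) w).
have bal : bmf al.
  by apply: bmfB; [exact: gA_bmf|apply: bmfZ; apply: bmf_sum => b; exact: gA_bmf].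
have al2 : \int[P]_w (al w) ^+ 2 <= C * (eps * M).
  have SF b := @sblk_siltof _ _ _ _ _ _ BX _ _ _ FF 2 b eps isT e0.
  have SG b := @sblk_siltof _ _ _ _ _ _ BX _ _ _ GG 2 b eps isT e0.
  have := split_second_moment BX (g_bker e0) (gA_siltof BX e0) (mulr_ge0 (ltW e0) M_ge0) ler01 (g_kernel e0)
     (fun b => siltofB (SF b) (SG b)).
  rewrite mulr1 -CE; apply: le_trans; rewrite le_eqVlt; apply/orP; left; apply/eqP.
  apply: eq_Rintegral => w _; congr (_ ^+ 2); rewrite /al; congr (_ - _).
  rewrite -(eq_bigr _ (fun (b : 'I_2) _ => mulrBr _ _ _)) -mulr_sumr -/(e2 eps) -/(gA _ _ _ _).
  rewrite /gA; move: (\sum_(b < 2) _) => t; by field.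
pose c := \int[P]_w al w.
have cE : c = gm eps - gm (e2 eps).
  rewrite /c expectB; [|exact: gA_bmf|by apply: bmfZ; apply: bmf_sum => b; exact: gA_bmf].
  rewrite gA_mean// expectZ ?expect_sum; [|by move=> b; exact: gA_bmf|by apply: bmf_sum => b; exact: gA_bmf].
  rewrite (eq_bigr (fun=> gm (e2 eps))).
    by rewrite sumr_const card_ord -[X in _ - _ * X]mulr_natl mulKf.
  move=> b _; have := Z1 b; rewrite expectB ?expect_cst; [|exact: gA_bmf|exact: bmf_cst].
  by move=> /eqP; rewrite subr_eq0 => /eqP.
have dE w : centered_diff eps w = 2^-1 * (Z 0%N w + Z 1%N w) + (al w - c).
  rewrite diffE cE /al big_ord_recl big_ord1 /Z /= /bump /=.
  rewrite addn0; move: (gA X1 X2 eps w) => t1; move: (gA (blk 2 0 X1) _ _ w) => t2.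
  move: (gA _ _ _ w) => t3; move: (gm (e2 eps)) => t5; move: (gm eps) => t4.
  by field.
exact: (second_moment_split (centered_diff_bmf e0) (bZ 0%N) (bZ 1%N) bal dE (erefl c) (Z2 0%N) (Z2 1%N) Z12 al2).
Qed.

Lemma diff_var_le eps : 0 < eps -> diff_var eps <= K * eps.
Proof.
move=> e0; move: eps e0; apply: (@scale_ind R (fun eps => diff_var eps <= K * eps)); first exact: diff_var_base.
move=> eps e0 IH; apply: (le_trans (diff_var_step e0)).
(* The recursion closes because 5/8 * 71/50 + 1/10 < 1. *)
have s2 : Num.sqrt 2%:R <= 71 / 50 :> R.
  rewrite -(ler_pXn2r (n := 2)) ?nnegrE ?sqrtr_ge0 ?divr_ge0// sqr_sqrtr//; lra.
have hM : 5 * (C * M) <= K / 10.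
  by rewrite ler_pdivlMr// mulrC /K lerDl sqr_ge0.
have h1 : diff_var (e2 eps) <= K * eps * (71 / 50).
  by rewrite (le_trans IH)// mulrA ler_wpM2l// mulr_ge0// ltW.
have h2 : 5 * (C * (eps * M)) <= K / 10 * eps.
  have -> : 5 * (C * (eps * M)) = 5 * (C * M) * eps by ring.
  by rewrite ler_wpM2r// ltW.
have Ke : 0 <= K * eps by rewrite mulr_ge0// ltW.
rewrite (le_trans (lerD (ler_wpM2l _ h1) h2))//.
rewrite [K / 10 * eps]mulrAC; move: (K * eps) Ke => k; lra.
Qed.

End TwoFamilies.

Section TruncatedExponential.
Context (R : realType).

(** Bounded and Lipschitz for [th, K >= 0], so that almost sure convergence and small variance both
    pass through it; the truncation error is governed by the exponential moment at [2 * th]. *)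
Definition texp (th K x : R) : R := Num.min (expR (- th * x)) K.

Lemma texp_continuous th K : continuous (texp th K).
Proof.
move=> x; apply: (@continuous_min _ _ (fun x => expR (- th * x)) (cst K)); last exact: cvg_cst.
by apply: continuous_comp; [apply: mulrl_continuous|exact: continuous_expR].
Qed.

Lemma texp_itv th K x : 0 <= K -> 0 <= texp th K x <= K.
Proof. by move=> K0; rewrite le_min expR_ge0 K0 ge_min lexx orbT. Qed.

Lemma texp_le th K x : texp th K x <= expR (- th * x).
Proof. by rewrite ge_min lexx. Qed.

Lemma texp_gap th K x : 0 < K -> expR (- th * x) - texp th K x <= expR (- (2 * th) * x) / K.
Proof.
move=> K0; have -> : - (2 * th) * x = - th * x + - th * x by ring.
rewrite expRD /texp; set y := expR _; have y0 : 0 < y by exact: expR_gt0.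
rewrite ler_pdivlMr// /Num.min; case: ltP => yK; first by rewrite subrr mul0r mulr_ge0// ltW.
by rewrite mulrBl; have := sqr_ge0 K; nra.
Qed.

Lemma texp_lip th K x y : 0 <= th -> 0 <= K -> `|texp th K x - texp th K y| <= th * K * `|x - y|.
Proof.
move=> t0 K0; wlog xy : x y / x <= y.
  by move=> H; case: (leP x y) => [|/ltW]; [exact: H|rewrite distrC [`|x - y|]distrC; exact: H].
pose r := expR (- th * (y - x)).
have r1 : r <= 1 by rewrite -expR0 ler_expR mulNr oppr_le0 mulr_ge0// subr_ge0.
have rl : 1 - r <= th * (y - x).
  by have := expR_ge1Dx (- th * (y - x)); rewrite -/r mulNr; lra.
have r0 : 0 <= r by exact: expR_ge0.
have yE : expR (- th * y) = r * expR (- th * x) by rewrite -expRD; congr expR; ring.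
have ry : r * texp th K x <= texp th K y.
  rewrite /texp yE le_min ler_wpM2l ?ge_min ?lexx//=.
  by rewrite -[leRHS]mul1r ler_pM// ?ge_min ?lexx ?orbT// le_min expR_ge0 K0.
have yx : texp th K y <= texp th K x.
  rewrite /texp yE le_min [X in _ && X]ge_min lexx orbT andbT ge_min.
  by rewrite ler_piMl// expR_ge0.
have /andP[h0 hK] := texp_itv th x K0.
rewrite ger0_norm ?subr_ge0// ler0_norm ?subr_le0// opprB.
rewrite (@le_trans _ _ ((1 - r) * texp th K x))//; first by rewrite mulrBl mul1r lerD2l lerN2.
by rewrite mulrAC ler_pM// subr_ge0.
Qed.

(** An interchange of limits: [K] is chosen first to make [C / K] small, and for this fixed [K] the
    remainder vanishes. *)
Lemma squeeze_param (a : nat -> R) (l C : R) (r : R -> nat -> R) :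
  (forall K, 0 < K -> forall n, `|a n - l| <= C / K + r K n) ->
  (forall K, 0 < K -> r K n @[n --> \oo] --> (0 : R)) -> a n @[n --> \oo] --> l.
Proof.
move=> ar r0; apply/cvgrPdist_le => e e0.
pose K := 2 * (`|C| + 1) / e.
have C0 : 0 < `|C| + 1 by rewrite ltr_wpDl.
have K0 : 0 < K by rewrite divr_gt0// mulr_gt0.
have CK : C / K <= e / 2.
  rewrite /K invf_div mulrA ler_pdivrMr ?mulr_gt0//.
  have -> : e / 2 * (2 * (`|C| + 1)) = (`|C| + 1) * e by field.
  by rewrite ler_wpM2r ?(ltW e0)// (le_trans (ler_norm _))// lerDl.
near=> n; rewrite distrC (le_trans (ar K K0 n))//.
have : r K n <= e / 2 by near: n; have /cvgr_le := r0 K K0; apply; rewrite divr_gt0.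
lra.
Unshelve. all: by end_near. Qed.

End TruncatedExponential.

(** * The limit of vanishing range *)

Section Limit.
Context (R : realType) d (Omega : measurableType d) (P : probability Omega R) (X1 X2 : R -> Omega -> R).
Hypothesis BX : planar_BM P X1 X2.
Variables (F : R -> R -> R -> R) (m B : R) (beta : Omega -> R).
Hypotheses (FF : kfam F m B) (mbeta : measurable_fun setT beta).
Let bt eps w := silt X1 X2 (F eps) w - smean P X1 X2 F eps.
Hypothesis btc : {ae P, forall w, (fun eps => bt eps w) @ 0^'+ --> beta w}.

Let bt_seq (u : nat -> R) : (forall n, 0 < u n) -> u n @[n --> \oo] --> (0 : R) ->
  {ae P, forall w, bt (u n) w @[n --> \oo] --> beta w}.
Proof.
move=> u0 uc; apply: filterS btc => w H.
apply: (cvg_comp _ _ _ H) => S /= SS.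
have [N _ HN] := uc _ SS; exists N => // n /= Nn; apply: HN => //; exact: u0.
Qed.

Let tbmf th K (f : Omega -> R) : 0 <= K -> measurable_fun setT f -> bmf (fun w => texp th K (f w)).
Proof.
move=> K0 mf; split; last by exists K => w; have /andP[a b] := texp_itv th (f w) K0; rewrite ger0_norm.
apply: (measurableT_comp _ mf); exact: continuous_measurable_fun (@texp_continuous _ _ _).
Qed.

Lemma texp_lim th K (u : nat -> R) : 0 <= K -> (forall n, 0 < u n) -> u n @[n --> \oo] --> (0 : R) ->
  \int[P]_w texp th K (bt (u n) w) @[n --> \oo] --> \int[P]_w texp th K (beta w).
Proof.
move=> K0 u0 uc.
apply: (@expect_lim _ _ _ P (fun n w => texp th K (bt (u n) w)) (fun w => texp th K (beta w)) K).
- by move=> n; exact: (tbmf _ K0 (centered_silt_bmf BX FF (u0 n)).1).1.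
- exact: (tbmf _ K0 mbeta).1.
- by move=> n w; have /andP[a b] := texp_itv th (bt (u n) w) K0; rewrite ger0_norm.
- by apply: filterS (bt_seq u0 uc) => w H; apply: continuous_cvg; [exact: texp_continuous|exact: H].
Qed.

Let ebmf th eps : 0 < eps -> bmf (fun w => expR (- th * bt eps w)).
Proof. by move=> e0; apply: bmf_expR; apply: bmfZ; exact: (centered_silt_bmf BX FF e0). Qed.

Let inv_pos n : 0 < n.+1%:R^-1 :> R. Proof. by rewrite invr_gt0. Qed.

Lemma beta_texp_le th K Q : 0 <= K -> (forall eps, 0 < eps -> lap P X1 X2 F eps th <= Q) ->
  \int[P]_w texp th K (beta w) <= Q.
Proof.
move=> K0 hQ; have h := texp_lim (th := th) (u := fun n => n.+1%:R^-1) K0 inv_pos (@cvg_harmonic R).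
apply: (cvgr_to_le h); apply: nearW => n.
apply: le_trans (hQ _ (inv_pos n)); apply: expect_le; [|exact: ebmf|].
  exact: tbmf K0 (centered_silt_bmf BX FF (inv_pos n)).1.
by move=> w; exact: texp_le.
Qed.

(** Bounded convergence gives the bound at each truncation level, and monotone convergence removes
    the truncation. *)
Lemma beta_exp_le th Q : (forall eps, 0 < eps -> lap P X1 X2 F eps th <= Q) ->
  (\int[P]_w (expR (- th * beta w))%:E <= Q%:E)%E.
Proof.
move=> hQ.
have me : measurable_fun setT (fun w => expR (- th * beta w)).
  by apply: measurableT_comp => //; apply: measurable_funM.
have mt n : measurable_fun setT (fun w => texp th n%:R (beta w)) := (tbmf th (ler0n R n) mbeta).1.
have h : (\int[P]_w (texp th n%:R (beta w))%:E)%E @[n --> \oo] -->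
    (\int[P]_w limn (fun n => (texp th n%:R (beta w))%:E))%E.
  apply: cvg_monotone_convergence => //.
  - by move=> n; apply/measurable_EFinP; exact: mt.
  - by move=> n w _; rewrite lee_fin; have /andP[] := texp_itv th (beta w) (ler0n R n).
  - by move=> w _ k l kl; rewrite lee_fin /texp le_min !ge_min lexx ler_nat kl orbT.
have fE w : limn (fun n => (texp th n%:R (beta w))%:E) = (expR (- th * beta w))%:E.
  apply: cvg_lim => //; apply: cvg_near_cst; near=> n; congr EFin.
  apply: min_l; near: n; exists (Num.truncn (expR (- th * beta w))).+1 => // n /= tn.
  by rewrite ltW// (lt_le_trans (truncnS_gt _))// ler_nat.
under eq_integral do rewrite -fE.
rewrite -(cvg_lim _ h)//; apply: lime_le; first by apply/cvg_ex; eexists; exact: h.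
apply: nearW => n; have := beta_texp_le (ler0n R n) hQ.
by rewrite -lee_fin /Rintegral fineK//; apply: integrable_fin_num => //;
  exact: (bmf_integrable P (tbmf th (ler0n R n) mbeta)).
Unshelve. all: by end_near. Qed.

Definition mgf (f : Omega -> R) th := \int[P]_w expR (- th * f w).

Lemma beta_exp_integrable th : 0 <= th -> P.-integrable setT (EFin \o (fun w => expR (- th * beta w))).
Proof.
move=> t0; have [Q hQ] := lap_unif BX FF t0.
apply/integrableP; split.
  by apply/measurable_EFinP; apply: measurableT_comp => //; apply: measurable_funM.
under eq_integral do rewrite /= ger0_norm ?expR_ge0//.
by apply: le_lt_trans (beta_exp_le hQ) _; rewrite ltry.
Qed.

(** Almost sure convergence alone does not carry over to expectations of unbounded exponentials; the
    uniform bound at [2 * th] makes them uniformly integrable. *)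
Lemma lap_cvg th (u : nat -> R) : 0 <= th -> (forall n, 0 < u n) -> u n @[n --> \oo] --> (0 : R) ->
  lap P X1 X2 F (u n) th @[n --> \oo] --> mgf beta th.
Proof.
move=> t0 u0 uc; have t20 : 0 <= 2 * th by rewrite mulr_ge0.
have [Q hQ] := lap_unif BX FF t20.
have mQ : mgf beta (2 * th) <= Q.
  rewrite -lee_fin (le_trans _ (beta_exp_le hQ))// /mgf /Rintegral fineK//.
  by apply: integrable_fin_num => //; exact: beta_exp_integrable.
have gap (f : Omega -> R) K : 0 < K -> measurable_fun setT f ->
    P.-integrable setT (EFin \o (fun w => expR (- th * f w))) ->
    P.-integrable setT (EFin \o (fun w => expR (- (2 * th) * f w))) ->
    `|mgf f th - \int[P]_w texp th K (f w)| <= mgf f (2 * th) / K.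
  move=> K0 mf i1 i2; have it := bmf_integrable P (tbmf th (ltW K0) mf).
  rewrite -RintegralB// ger0_norm; last by apply: Rintegral_ge0 => w _; rewrite subr_ge0 texp_le.
  rewrite mulrC -RintegralZl//; apply: le_Rintegral => //.
  - exact: (integrableB measurableT i1 it).
  - exact: (integrableZl measurableT K^-1 i2).
  - by move=> w _; rewrite [leRHS]mulrC; exact: texp_gap.
apply: (@squeeze_param _ _ _ (2 * Q) (fun K n => `|\int[P]_w texp th K (bt (u n) w) - \int[P]_w texp th K (beta w)|)).
  move=> K K0 n.
  have g1 := gap (bt (u n)) K K0 (centered_silt_bmf BX FF (u0 n)).1
     (bmf_integrable P (ebmf th (u0 n))) (bmf_integrable P (ebmf (2 * th) (u0 n))).
  have g2 := gap beta K K0 mbeta (beta_exp_integrable t0) (beta_exp_integrable t20).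
  have h1 : mgf (bt (u n)) (2 * th) / K <= Q / K by rewrite ler_wpM2r ?invr_ge0 ?(ltW K0)//; exact: hQ.
  have h2 : mgf beta (2 * th) / K <= Q / K by rewrite ler_wpM2r ?invr_ge0 ?(ltW K0).
  rewrite -[lap _ _ _ _ _ _]/(mgf (bt (u n)) th).
  set a := mgf _ th in g1 *; set b := \int[P]_w _ in g1 *; set c := \int[P]_w _ in g2 *; set e := mgf beta th in g2 *.
  have -> : a - e = (a - b) + (b - c) - (e - c) by ring.
  rewrite (le_trans (ler_normB _ _))// (le_trans (lerD (ler_normD _ _) (lexx _)))//.
  have -> : 2 * Q / K = Q / K + Q / K by field; rewrite gt_eqF.
  by rewrite addrAC lerD2r lerD ?(le_trans g1 h1) ?(le_trans g2 h2).
move=> K K0; rewrite -(normr0 R) -(subrr (\int[P]_w texp th K (beta w))).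
apply: cvg_norm; apply: cvgB; last exact: cvg_cst.
exact: texp_lim (ltW K0) u0 uc.
Qed.

End Limit.

Section FamilyIndependence.
Context (R : realType) d (Omega : measurableType d) (P : probability Omega R) (X1 X2 : R -> Omega -> R).
Hypothesis BX : planar_BM P X1 X2.
Variables (F G : R -> R -> R -> R) (m B m' B' : R).
Hypotheses (FF : kfam F m B) (GG : kfam G m' B').

(** The centred difference has variance of order [u n] and [texp] is Lipschitz, so the truncated
    expectations merge; the truncation error is uniform by [lap_unif]. *)
Lemma lap_family_cvg th (u : nat -> R) : 0 <= th -> (forall n, 0 < u n) -> u n @[n --> \oo] --> (0 : R) ->
  lap P X1 X2 F (u n) th - lap P X1 X2 G (u n) th @[n --> \oo] --> (0 : R).
Proof.
move=> t0 u0 uc; have t20 : 0 <= 2 * th by rewrite mulr_ge0.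
have [QF hF] := lap_unif BX FF t20; have [QG hG] := lap_unif BX GG t20.
pose bt (F : R -> R -> R -> R) eps w := silt X1 X2 (F eps) w - smean P X1 X2 F eps.
pose tx F K n := \int[P]_w texp th K (bt F (u n) w).
have tb F' m1 B1 K n : kfam F' m1 B1 -> 0 < K -> bmf (fun w => texp th K (bt F' (u n) w)).
  move=> FF' K0; apply: bmf_comp; first exact: texp_continuous.
  exact: (centered_silt_bmf BX FF' (u0 n)).
have eb F' m1 B1 t n : kfam F' m1 B1 -> bmf (fun w => expR (- t * bt F' (u n) w)).
  by move=> FF'; apply: bmf_expR; apply: bmfZ; exact: (centered_silt_bmf BX FF' (u0 n)).
have gap F' m1 B1 Q K n : kfam F' m1 B1 -> (forall eps, 0 < eps -> lap P X1 X2 F' eps (2 * th) <= Q) -> 0 < K ->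
    `|lap P X1 X2 F' (u n) th - tx F' K n| <= Q / K.
  move=> FF' hQ K0; have b1 := eb _ _ _ th n FF'; have b2 := eb _ _ _ (2 * th) n FF'; have b3 := tb _ _ _ K n FF' K0.
  rewrite -[lap _ _ _ _ _ _]/(\int[P]_w expR (- th * bt F' (u n) w)) -(expectB P b1 b3).
  rewrite ger0_norm; last by apply: Rintegral_ge0 => w _; rewrite subr_ge0 texp_le.
  apply: (@le_trans _ _ (K^-1 * lap P X1 X2 F' (u n) (2 * th))); last first.
    by rewrite [leRHS]mulrC ler_wpM2l ?invr_ge0 ?(ltW K0)// hQ.
  rewrite -(expectZ P _ b2); apply: expect_le; [exact: bmfB|exact: bmfZ|].
  by move=> w; rewrite [leRHS]mulrC; exact: texp_gap.
pose C := 10 * (5 * ((512 : R) * (m + m'))) + (B + B') ^+ 2.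
have dv n : diff_var P X1 X2 F G (u n) <= C * u n by exact: (diff_var_le BX FF GG (erefl _) (u0 n)).
have txc K : 0 < K -> tx F K n - tx G K n @[n --> \oo] --> (0 : R).
  move=> K0; apply: (@squeeze_param _ _ _ (th * K / 2) (fun L n => th * K * (L * (C * u n)))).
    move=> L L0 n; have b1 := tb _ _ _ K n FF K0; have b2 := tb _ _ _ K n GG K0.
    have bd := centered_diff_bmf BX FF GG (u0 n).
    have bd2 : bmf (fun w => centered_diff P X1 X2 F G (u n) w ^+ 2).
      by under eq_fun do rewrite expr2; exact: bmfM.
    have tK : 0 <= th * K by rewrite mulr_ge0// ltW.
    rewrite subr0 /tx -(expectB P b1 b2).
    (* The inequality |x| <= 1 / (2 L) + L x^2 trades the first absolute moment for the variance,
       with [L] free. *)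
    apply: (@le_trans _ _ (\int[P]_w (th * K * (2^-1 / L + L * (centered_diff P X1 X2 F G (u n) w) ^+ 2)))).
      apply: le_trans (le_normr_Rintegral measurableT (bmf_integrable P (bmfB b1 b2))) _.
      apply: expect_le.
      - by apply: bmf_comp; [move=> x; exact: (@norm_continuous _ R^o)|exact: bmfB].
      - by apply: bmfZ; apply: bmfD; [exact: bmf_cst|exact: bmfZ].
      move=> w; apply: (le_trans (texp_lip _ _ t0 (ltW K0))); rewrite ler_wpM2l//.
      rewrite -/(centered_diff P X1 X2 F G (u n) w); set x := centered_diff _ _ _ _ _ _ _.
      rewrite -(real_normK (num_real x)); set y := `|x|.
      have -> : 2^-1 / L + L * y ^+ 2 = y + (2^-1 + (L * y - 2^-1) ^+ 2 + 4^-1 - 2^-1) / L by field; rewrite gt_eqF.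
      by rewrite lerDl divr_ge0 ?(ltW L0)//; have := sqr_ge0 (L * y - 2^-1); lra.
    have b3 := bmfD (bmf_cst Omega (2^-1 / L)) (bmfZ L bd2).
    rewrite (expectZ P _ b3) (expectD P (bmf_cst Omega (2^-1 / L)) (bmfZ L bd2)) expect_cst (expectZ P _ bd2).
    rewrite mulrDr lerD//; first by rewrite mulrA.
    by apply: ler_wpM2l => //; apply: ler_wpM2l; [exact: ltW|exact: dv].
  move=> L L0; rewrite (_ : (0 : R) = th * K * (L * (C * 0))); last by rewrite !mulr0.
  by apply: cvgM; [exact: cvg_cst|apply: cvgM; [exact: cvg_cst|apply: cvgM; [exact: cvg_cst|exact: uc]]].
apply: (@squeeze_param _ _ _ (QF + QG) (fun K n => `|tx F K n - tx G K n|)).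
  move=> K K0 n; have g1 := gap _ _ _ _ K n FF hF K0; have g2 := gap _ _ _ _ K n GG hG K0.
  set a := lap P X1 X2 F _ _ in g1 *; set b := lap P X1 X2 G _ _ in g2 *.
  rewrite subr0; set x := tx F K n in g1 *; set y := tx G K n in g2 *.
  have -> : a - b = (a - x) + (x - y) - (b - y) by ring.
  rewrite (le_trans (ler_normB _ _))// (le_trans (lerD (ler_normD _ _) (lexx _)))// mulrDl.
  by rewrite addrAC lerD2r lerD.
move=> K K0; rewrite -(normr0 R); apply: cvg_norm; exact: txc.
Qed.

End FamilyIndependence.

(** * Laplace transform of the limit *)

Section MgfProperties.
Context (R : realType).
Local Notation q := ((pi *+ 2)^-1 : R).

Let u (n : nat) : R := n.+1%:R^-1.
Let u0 n : 0 < u n. Proof. by rewrite invr_gt0. Qed.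
Let uc : u n @[n --> \oo] --> (0 : R). Proof. exact: cvg_harmonic. Qed.

Section OneSetup.
Context d (Omega : measurableType d) (P : probability Omega R) (X1 X2 : R -> Omega -> R).
Hypothesis BX : planar_BM P X1 X2.
Variables (F : R -> R -> R -> R) (m B : R) (beta : Omega -> R).
Hypotheses (FF : kfam F m B) (mbeta : measurable_fun setT beta).
Hypothesis btc : {ae P, forall w, (fun eps => silt X1 X2 (F eps) w - smean P X1 X2 F eps) @ 0^'+ --> beta w}.

(** Two null sequences are used, [u k] on the left and its multiple by the root of [n] on the right;
    both lead to the same [beta]. *)
Lemma mgf_superscale n th : (0 < n)%N -> 0 <= th ->
  mgf P beta (n%:R * th) <= mgf P beta th ^+ n * expR (n%:R * th * (q * ln n%:R)).
Proof.
move=> n0 t0; have sn : 0 < Num.sqrt n%:R :> R by rewrite sqrtr_gt0 ltr0n.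
have v0 k : 0 < u k * Num.sqrt n%:R by rewrite mulr_gt0.
have vc : u k * Num.sqrt n%:R @[k --> \oo] --> (0 : R).
  by rewrite -(mul0r (Num.sqrt n%:R)); apply: cvgM; [exact: uc|exact: cvg_cst].
have h1 := lap_cvg BX FF mbeta btc (mulr_ge0 (ler0n R n) t0) u0 uc.
have h2 := lap_cvg BX FF mbeta btc t0 v0 vc.
have h3 : lap P X1 X2 F (u k * Num.sqrt n%:R) th ^+ n * expR (n%:R * th * (q * ln n%:R)) @[k --> \oo] -->
   mgf P beta th ^+ n * expR (n%:R * th * (q * ln n%:R)).
  apply: cvgM; last exact: cvg_cst.
  exact: (cvg_comp _ (fun x : R => x ^+ n) h2 (@exprn_continuous R n _)).
by apply: (ler_cvg_to h1 h3); apply: nearW => k; exact: (lap_superscale BX FF n0 (u0 k) t0).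
Qed.

(** The 7 is the 6 of [laplace_lower] plus 1 for the cost of the tilt; the second moment of the
    kernel disappears with the range. *)
Lemma mgf_lower th : 1 <= th -> expR (th * (q * ln th - 7)) <= mgf P beta th.
Proof.
move=> t1; have t0 : 0 <= th by exact: le_trans t1.
have h1 := lap_cvg BX FF mbeta btc t0 u0 uc.
have h2 : expR (- th * (6 + 5 * th * (u k ^+ 2 * m) - q * ln th) - th) @[k --> \oo] -->
    expR (- th * (6 + 5 * th * (0 ^+ 2 * m) - q * ln th) - th).
  apply: continuous_cvg; first exact: continuous_expR.
  apply: cvgB; last exact: cvg_cst.
  apply: cvgM; first exact: cvg_cst.
  apply: cvgB; last exact: cvg_cst.
  apply: cvgD; first exact: cvg_cst.
  apply: cvgM; first exact: cvg_cst.
  apply: cvgM; last exact: cvg_cst.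
  exact: (cvg_comp _ (fun x : R => x ^+ 2) uc (@exprn_continuous R 2 _)).
have -> : th * (q * ln th - 7) = - th * (6 + 5 * th * (0 ^+ 2 * m) - q * ln th) - th by rewrite expr0n/=; ring.
apply: (ler_cvg_to h2 h1); apply: nearW => k.
have [_ _ H] := FF; have [D _ _] := H _ (u0 k).
have bs := silt_bmf FF BX (u0 k).
have L := laplace_lower BX D (kfam_bker FF (u0 k)) t1 (silt_siltof FF BX (u0 k)).
have -> : lap P X1 X2 F (u k) th = expR (th * smean P X1 X2 F (u k)) * \int[P]_w expR (- th * silt X1 X2 (F (u k)) w).
  rewrite -expectZ; last by apply: bmf_expR; exact: bmfZ.
  by apply: eq_Rintegral => w _; rewrite -expRD; congr expR; ring.
apply: le_trans (ler_wpM2l (expR_ge0 _) L); rewrite -expRD ler_expR -/(smean P X1 X2 F (u k)).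
by rewrite le_eqVlt; apply/orP; left; apply/eqP; ring.
Qed.

Lemma mgf_interp th t : 0 <= th -> 0 <= t -> t <= 1 ->
  mgf P beta ((1 + t) * th) <= (1 - t) * mgf P beta th + t * mgf P beta (2 * th).
Proof.
move=> t0 s0 s1; have i1 := beta_exp_integrable BX FF mbeta btc t0.
have i2 := beta_exp_integrable BX FF mbeta btc (mulr_ge0 (ler0n R 2) t0).
have i3 := beta_exp_integrable BX FF mbeta btc (mulr_ge0 (addr_ge0 ler01 s0) t0).
have z1 := integrableZl measurableT (1 - t) i1; have z2 := integrableZl measurableT t i2.
rewrite -!RintegralZl// -RintegralD//; apply: le_Rintegral => //; first exact: (integrableD measurableT z1 z2).
move=> w _; have := @expR_convex R t (- th * beta w) (- (2 * th) * beta w).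
have -> : (1 - t) * (- th * beta w) + t * (- (2 * th) * beta w) = - ((1 + t) * th) * beta w by ring.
by apply; apply/andP.
Qed.

Let ind_bmf (A : set Omega) : measurable A -> bmf (\1_A : Omega -> R).
Proof.
move=> mA; split; first exact: measurable_indic.
by exists 1 => w; rewrite indicE; case: (w \in A); rewrite ?normr0 ?normr1.
Qed.

Let ind_expect (A : set Omega) : measurable A -> \int[P]_w (\1_A w : R) = fine (P A).
Proof. by move=> mA; rewrite /Rintegral integral_indic// setIT. Qed.

Let tail_measurable x : measurable [set w | x <= - beta w].
Proof.
rewrite -[X in measurable X]setTI.
have -> : [set w | x <= - beta w] = (fun w => - beta w) @^-1` `[x, +oo[%classic.
  by apply/seteqP; split => w /=; rewrite in_itv/= andbT.
have mN : measurable_fun setT (fun w => - beta w) by exact: measurableT_comp.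
by apply: mN.
Qed.

Lemma tail_chernoff th x : 0 <= th -> fine (P [set w | x <= - beta w]) <= expR (- th * x) * mgf P beta th.
Proof.
move=> t0; have i1 := beta_exp_integrable BX FF mbeta btc t0.
have mA := tail_measurable x.
rewrite -(ind_expect mA) -RintegralZl//; apply: le_Rintegral => //.
- exact: (bmf_integrable P (ind_bmf mA)).
- exact: (integrableZl measurableT _ i1).
move=> w _; rewrite indicE; case: (boolP (w \in _)) => [|_]; last by rewrite mulr_ge0 ?expR_ge0.
rewrite inE/= => xw; rewrite -expRD -[leLHS]expR0 ler_expR.
have -> : - th * x + - th * beta w = th * (- beta w - x) by ring.
by rewrite mulr_ge0// subr_ge0.
Qed.

(** Splits into - beta < x, x <= - beta <= y and - beta > y. On the outer pieces exp(- th beta) is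
    compared with the weights at (1 - k) th and (1 + k) th, which are negligible once the tilted
    mass sits between [x] and [y]. *)
Lemma tail_window th k x y : 0 <= th -> 0 <= k -> k <= 1 ->
  mgf P beta th <= expR (th * y) * fine (P [set w | x <= - beta w]) +
    expR (- (k * th * y)) * mgf P beta ((1 + k) * th) + expR (k * th * x) * mgf P beta ((1 - k) * th).
Proof.
move=> t0 k0 k1; have i1 := beta_exp_integrable BX FF mbeta btc t0.
have k1' : 0 <= 1 - k by rewrite subr_ge0.
have i2 := beta_exp_integrable BX FF mbeta btc (mulr_ge0 (addr_ge0 ler01 k0) t0).
have i3 := beta_exp_integrable BX FF mbeta btc (mulr_ge0 k1' t0).
have mA := tail_measurable x; have iA := bmf_integrable P (ind_bmf mA).
have z1 := integrableZl measurableT (expR (th * y)) iA.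
have z2 := integrableZl measurableT (expR (- (k * th * y))) i2.
have z3 := integrableZl measurableT (expR (k * th * x)) i3.
have z12 := integrableD measurableT z1 z2.
rewrite -(ind_expect mA) /mgf -!RintegralZl// -RintegralD// -RintegralD//.
apply: le_Rintegral => //; first exact: (integrableD measurableT z12 z3).
move=> w _; rewrite -!expRD; set b := beta w.
have e0 z : 0 <= expR z :> R by exact: expR_ge0.
have mid (a c e : R) : 0 <= a -> 0 <= e -> c <= a + c + e by lra.
have ind0 : 0 <= \1_([set w | x <= - beta w]) w :> R by rewrite indicE.
have [bx|bx] := ltP (- b) x.
  apply: (@le_trans _ _ (expR (k * th * x + - ((1 - k) * th) * b))); last by rewrite lerDr addr_ge0 ?mulr_ge0.
  rewrite ler_expR -subr_ge0.
  have -> : k * th * x + - ((1 - k) * th) * b - - th * b = k * th * (x - - b) by ring.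
  by rewrite !mulr_ge0// subr_ge0 ltW.
have [yb|by_] := ltP y (- b).
  apply: (@le_trans _ _ (expR (- (k * th * y) + - ((1 + k) * th) * b))); last first.
    by apply: mid => //; exact: mulr_ge0.
  rewrite ler_expR -subr_ge0.
  have -> : - (k * th * y) + - ((1 + k) * th) * b - - th * b = k * th * (- b - y) by ring.
  by rewrite !mulr_ge0// subr_ge0 ltW.
rewrite indicE mem_set// mulr1 (@le_trans _ _ (expR (th * y)))//; last by rewrite -addrA lerDl addr_ge0.
by rewrite ler_expR mulNr -mulrN ler_wpM2l.
Qed.

(** [mgf_lower] needs [1 <= th]; for smaller [th] positivity is pulled back from [n%:R * th] by
    [mgf_superscale]. *)
Lemma mgf_gt0 th : 0 < th -> 0 < mgf P beta th.
Proof.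
move=> t0; have m0 : 0 <= mgf P beta th by apply: Rintegral_ge0 => w _; exact: expR_ge0.
rewrite lt_neqAle m0 andbT eq_sym; apply/eqP => mz.
pose n := (Num.truncn th^-1).+1.
have n1 : 1 <= n%:R * th by rewrite -ler_pdivrMr// mul1r ltW// truncnS_gt.
have := le_trans (mgf_lower n1) (mgf_superscale (ltn0Sn _) (ltW t0)).
by rewrite mz expr0n/= mul0r leNgt expR_gt0.
Qed.

End OneSetup.

(** The same family gives the same law on both spaces; on the second space the two families are then
    compared. *)
Lemma mgf_unique d (Omega : measurableType d) (P : probability Omega R) (X1 X2 : R -> Omega -> R) F m B (beta : Omega -> R)
    d' (Omega' : measurableType d') (P' : probability Omega' R) (X1' X2' : R -> Omega' -> R) F' m' B' (beta' : Omega' -> R) th :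
  planar_BM P X1 X2 -> kfam F m B -> measurable_fun setT beta ->
  {ae P, forall w, (fun eps => silt X1 X2 (F eps) w - smean P X1 X2 F eps) @ 0^'+ --> beta w} ->
  planar_BM P' X1' X2' -> kfam F' m' B' -> measurable_fun setT beta' ->
  {ae P', forall w, (fun eps => silt X1' X2' (F' eps) w - smean P' X1' X2' F' eps) @ 0^'+ --> beta' w} ->
  0 <= th -> mgf P beta th = mgf P' beta' th.
Proof.
move=> BX FF mb bc BX' FF' mb' bc' t0.
have h1 := lap_cvg BX FF mb bc t0 u0 uc; have h2 := lap_cvg BX' FF' mb' bc' t0 u0 uc.
have h3 := lap_family_cvg BX' FF FF' t0 u0 uc.
have E k : lap P X1 X2 F (u k) th = lap P' X1' X2' F (u k) th.
  have bk := kfam_bker FF (u0 k).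
  have sm : smean P X1 X2 F (u k) = smean P' X1' X2' F (u k).
    exact: (siltof_law BX BX' bk (fun x => cvg_id) (silt_siltof FF BX (u0 k)) (silt_siltof FF BX' (u0 k))).
  rewrite /lap sm.
  apply: (siltof_law (g := fun x => expR (- th * (x - smean P' X1' X2' F (u k)))) BX BX' bk _ (silt_siltof FF BX (u0 k)) (silt_siltof FF BX' (u0 k))).
  move=> x; apply: continuous_comp; last exact: continuous_expR.
  by apply: cvgM; [exact: cvg_cst|apply: cvgB; [exact: cvg_id|exact: cvg_cst]].
have h4 : lap P X1 X2 F (u k) th @[k --> \oo] --> mgf P' beta' th.
  rewrite -[mgf P' _ _]add0r; apply: cvg_trans (cvgD h3 h2); apply: near_eq_cvg; apply: nearW => k.
  by rewrite /= E -[RHS]/(lap P' X1' X2' F (u k) th); exact: subrK.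
exact: (cvg_unique _ h1 h4).
Qed.

End MgfProperties.

(** * The Tauberian argument *)

Section Tauberian.
Context (R : realType).
Variable q : R.
Hypothesis q_gt0 : 0 < q.

Definition rate (M : R -> R) th := ln (M th) / th - q * ln th.

Lemma rateE (M : R -> R) th : 0 < th -> 0 < M th -> M th = expR (th * (q * ln th + rate M th)).
Proof.
move=> t0 M0; rewrite /rate addrC subrK mulrC divfK ?gt_eqF// lnK//.
Qed.

(* The rate at [n th] is at most the rate at [th]; continuity from the right at a near-minimiser covers the gaps between its multiples. *)
Lemma rate_cvg (M : R -> R) : (forall th, 0 < th -> 0 < M th) ->
  (forall n th, (0 < n)%N -> 0 <= th -> M (n%:R * th) <= M th ^+ n * expR (n%:R * th * (q * ln n%:R))) ->
  (forall th, 1 <= th -> expR (th * (q * ln th - 7)) <= M th) ->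
  (forall th t, 0 <= th -> 0 <= t -> t <= 1 -> M ((1 + t) * th) <= (1 - t) * M th + t * M (2 * th)) ->
  exists C : R, forall e, 0 < e -> exists2 T, 1 <= T & forall th, T <= th -> `|rate M th - C| <= e.
Proof.
move=> M0 Msc Mlo Mint.
have r_sc n th : (0 < n)%N -> 0 < th -> rate M (n%:R * th) <= rate M th.
  move=> n0 t0; have nR : 0 < n%:R :> R by rewrite ltr0n.
  have nt : 0 < n%:R * th by rewrite mulr_gt0.
  have := Msc n th n0 (ltW t0).
  rewrite -ler_ln ?posrE ?mulr_gt0 ?exprn_gt0 ?expR_gt0 ?M0//.
  rewrite lnM ?posrE ?exprn_gt0 ?expR_gt0 ?M0// expRK lnXn ?M0// => h.
  rewrite /rate lnM ?posrE// mulrDr opprD addrA lerD2r lerBlDr ler_pdivrMr//.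
  rewrite (le_trans h)// -mulr_natl le_eqVlt; apply/orP; left; apply/eqP; field.
  by rewrite !gt_eqF.
have r_lo th : 1 <= th -> - 7 <= rate M th.
  move=> t1; have t0 : 0 < th by exact: lt_le_trans t1.
  have := Mlo th t1; rewrite (rateE t0 (M0 _ t0)) ler_expR ler_pM2l//; lra.
pose S := [set rate M th | th in [set th | 1 <= th]].
have S0 : S !=set0 by exists (rate M 1), 1 => /=.
have Slb : has_lbound S by exists (- 7) => _ [th t1 <-]; exact: r_lo.
exists (inf S) => e e0.
have [_ [th0 t01 <-] rt0] : exists2 x, S x & x < inf S + e / 2.
  have e2 : 0 < e / 2 by rewrite divr_gt0.
  by have [x Sx xi] := inf_adherent e2 (conj S0 Slb); exists x.
have t00 : 0 < th0 by exact: lt_le_trans t01.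
(* An upper bound for the rate at (1 + t) th0, from convexity of [M]; it is continuous at t = 0,
   where it equals the rate at [th0]. *)
pose f t := ln ((1 - t) * M th0 + t * M (2 * th0)) / ((1 + t) * th0) - q * ln ((1 + t) * th0).
have g0 : (1 - 0) * M th0 + 0 * M (2 * th0) = M th0 by rewrite subr0 mul1r mul0r addr0.
have h0 : (1 + 0) * th0 = th0 by rewrite addr0 mul1r.
have cid : (fun t : R => t) t @[t --> (0 : R)] --> (0 : R) by exact: cvg_id.
have gc : (1 - t) * M th0 + t * M (2 * th0) @[t --> (0 : R)] --> (1 - 0) * M th0 + 0 * M (2 * th0).
  apply: cvgD; apply: cvgM; [apply: cvgB; [exact: cvg_cst|exact: cid]|exact: cvg_cst|exact: cid|exact: cvg_cst].
have hc : (1 + t) * th0 @[t --> (0 : R)] --> (1 + 0) * th0.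
  by apply: cvgM; [apply: cvgD; [exact: cvg_cst|exact: cid]|exact: cvg_cst].
have fc : f t @[t --> (0 : R)] --> rate M th0.
  rewrite /rate; apply: cvgB.
    apply: cvgM; last by apply: cvgV; rewrite ?gt_eqF// -[X in _ --> X]h0.
    apply: (cvg_comp _ (@ln R) gc); rewrite g0; apply: continuous_ln; exact: M0.
  apply: cvgM; first exact: cvg_cst.
  by apply: (cvg_comp _ (@ln R) hc); rewrite h0; exact: continuous_ln.
have [d d0 fd] : exists2 d : R, 0 < d & forall t, 0 <= t -> t < d -> f t <= rate M th0 + e / 2.
  have e2 : rate M th0 < rate M th0 + e / 2 by rewrite ltrDl divr_gt0.
  have : \forall t \near (0 : R), f t <= rate M th0 + e / 2 by have /cvgr_le := fc; apply.
  move=> /nbhs_ballP[d /= d0 H]; exists d => // t t0 td.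
  by apply: H; rewrite /ball/= sub0r normrN ger0_norm.
have r_near t : 0 <= t -> t <= 1 -> rate M ((1 + t) * th0) <= f t.
  move=> t0 t1; have s0 : 0 < (1 + t) * th0 by rewrite mulr_gt0// ltr_wpDr.
  rewrite /rate /f lerD2r ler_wpM2r ?invr_ge0 ?(ltW s0)//.
  have Ms := M0 _ s0; have le := Mint th0 t (ltW t00) t0 t1.
  by rewrite ler_ln ?posrE// (lt_le_trans Ms le).
pose N := (Num.truncn d^-1).+1.
have NR : 0 < N%:R :> R by rewrite ltr0n.
have Nd : N%:R^-1 < d by rewrite -[ltRHS]invrK ltf_pV2 ?posrE ?invr_gt0// truncnS_gt.
exists (N%:R * th0); first by rewrite -[leLHS]mul1r ler_pM// ler1n.
move=> th tht; have tp : 0 < th by rewrite (lt_le_trans _ tht)// mulr_gt0.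
have th1 : 1 <= th by rewrite (le_trans _ tht)// -[leLHS]mul1r ler_pM// ler1n.
pose n := Num.truncn (th / th0).
have /andP[n1 n2] := truncn_itv (divr_ge0 (ltW tp) (ltW t00)); rewrite -/n in n1 n2.
have nN : (N <= n)%N by rewrite /n truncn_ge_nat ?divr_ge0 ?(ltW tp) ?(ltW t00)// ler_pdivlMr.
have nR : 0 < n%:R :> R by rewrite ltr0n (leq_trans _ nN).
(* Thus th = n (1 + t) th0 with t < 1 / n <= 1 / N < d. *)
pose t := th / (n%:R * th0) - 1.
have tE : th / (n%:R * th0) = (th / th0) / n%:R by field; rewrite !gt_eqF.
have t0' : 0 <= t by rewrite subr_ge0 tE ler_pdivlMr// mul1r.
have tn : t < n%:R^-1.
  by rewrite ltrBlDr tE ltr_pdivrMr// mulrDl mulVf ?gt_eqF// mul1r addrC natr1.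
have nV : n%:R^-1 <= N%:R^-1 :> R by rewrite lef_pV2 ?posrE// ler_nat.
have td : t < d by rewrite (lt_trans tn)// (le_lt_trans nV).
have t1' : t <= 1 by rewrite (le_trans (ltW tn))// invf_le1// ler1n (leq_trans _ nN).
have thE : th = n%:R * ((1 + t) * th0) by rewrite /t addrC subrK; field; rewrite !gt_eqF.
have lo : inf S <= rate M th by apply: ge_inf => //; exists th.
have hi : rate M th <= inf S + e.
  rewrite thE (le_trans (r_sc n _ _ _))//.
  - exact: (leq_trans _ nN).
  - by rewrite mulr_gt0// ltr_wpDr.
  rewrite (le_trans (r_near t t0' t1'))// (le_trans (fd t t0' td))//; lra.
rewrite ler_norml; apply/andP; split; lra.
Qed.

(** With M th = exp(th (q ln th + C + o(1))), the exponent - th x + th (q ln th + C) is least at th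
    = tau exp(x / q), where it equals - q th = - L exp(x / q). Chernoff at this point gives the
    upper bound; the lower bound tilts slightly beyond it. *)
Lemma rate_tail_limit (M p : R -> R) (C : R) :
  (forall th, 0 < th -> 0 < M th) ->
  (forall e, 0 < e -> exists2 T, 1 <= T & forall th, T <= th -> `|rate M th - C| <= e) ->
  (forall th x, 0 <= th -> p x <= expR (- th * x) * M th) ->
  (forall th k x y, 0 <= th -> 0 <= k -> k <= 1 ->
     M th <= expR (th * y) * p x + expR (- (k * th * y)) * M ((1 + k) * th) + expR (k * th * x) * M ((1 - k) * th)) ->
  let L := expR (- C / q - 1) * q in
  forall e, 0 < e -> exists X0 : R, forall x, X0 <= x -> `|expR (- x / q) * ln (p x) + L| <= e.
Proof.
move=> M0 rC up win L e e0.
pose tau := expR (- C / q - 1).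
have tau0 : 0 < tau by exact: expR_gt0.
have lnth c x : q * ln (tau * expR (c / q) * expR (x / q)) = x + c - C - q.
  by rewrite !lnM ?posrE ?mulr_gt0 ?expR_gt0// !expRK; field; rewrite gt_eqF.
(* The window from x to x + 2 del costs more than [L], but by continuity at del = 0 the excess is at
   most e / 2. *)
have [del [del0 delq hdel]] : exists del, [/\ 0 < del, del <= q & tau * expR (del / q) * (q + 2 * del) <= L + e / 2].
  have cid : (fun t : R => t) t @[t --> (0 : R)] --> (0 : R) by exact: cvg_id.
  have c1 : tau * expR (t / q) * (q + 2 * t) @[t --> (0 : R)] --> tau * expR (0 / q) * (q + 2 * 0).
    apply: cvgM; last by apply: cvgD; [exact: cvg_cst|apply: cvgM; [exact: cvg_cst|exact: cid]].
    apply: cvgM; first exact: cvg_cst.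
    apply: continuous_cvg; first exact: continuous_expR.
    by apply: cvgM; [exact: cid|exact: cvg_cst].
  rewrite mul0r expR0 mulr1 mulr0 addr0 -/L in c1.
  have Le : L < L + e / 2 by rewrite ltrDl divr_gt0.
  have : \forall t \near (0 : R), tau * expR (t / q) * (q + 2 * t) <= L + e / 2 by have /cvgr_le := c1; apply.
  move=> /nbhs_ballP[d /= d0 H]; exists (Num.min (d / 2) q); split.
  - by rewrite lt_min divr_gt0.
  - by rewrite ge_min lexx orbT.
  apply: H; rewrite /ball/= sub0r normrN ger0_norm; last by rewrite le_min (ltW q_gt0) divr_ge0 ?ltW.
  by rewrite gt_min; apply/orP; left; lra.
(* This [k] minimises q k^2 - k del, the exponent of the mass that leaks out of the window. The
   minimum is - 2 r, and half of it is left for the errors [e1]. *)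
pose k := del / (2 * q).
have k0 : 0 < k by rewrite divr_gt0// mulr_gt0.
have k2 : k <= 2^-1.
  rewrite /k ler_pdivrMr ?mulr_gt0//; lra.
pose r := del ^+ 2 / (8 * q).
have r0 : 0 < r by rewrite divr_gt0 ?exprn_gt0 ?mulr_gt0.
have krE : q * k ^+ 2 - k * del = - (2 * r) by rewrite /k /r; field; rewrite gt_eqF.
pose e1 := Num.min (e / tau) (Num.min del (r / 3)).
have e10 : 0 < e1.
  have r3 : 0 < r / 3 by lra.
  by rewrite /e1 !lt_min del0 r3 divr_gt0.
have e1e : tau * e1 <= e by rewrite mulrC -ler_pdivlMr// ge_min lexx.
have e1d : e1 <= del by rewrite /e1 !ge_min lexx /= ?orbT.
have e1r : 3 * e1 <= r by rewrite mulrC -ler_pdivlMr// /e1 !ge_min lexx !orbT.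
have [T T1 rT] := rC e1 e10.
have T0 : 0 < T by exact: lt_le_trans T1.
have lnM_ th : T <= th -> exists g : R, [/\ M th = expR (th * (q * ln th + C + g)), - e1 <= g & g <= e1].
  move=> tT; have t0 : 0 < th by exact: lt_le_trans tT.
  exists (rate M th - C); have := rT th tT; rewrite ler_norml => /andP[a b]; split=> //.
  by rewrite {1}(rateE t0 (M0 _ t0)); congr (expR (_ * _)); ring.
(* Thresholds for [expR (x / q)]: all tilts used exceed [T], th r >= 2, and the additive constant 1
   costs at most e / 2. *)
pose Y := Num.max (2 * T / tau) (Num.max (2 / r / tau) (2 / e)).
have Y0 : 0 < Y by rewrite !lt_max !divr_gt0// mulr_gt0.
exists (q * ln Y) => x xX.
pose E := expR (x / q).
have E0 : 0 < E by exact: expR_gt0.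
have YE : Y <= E by rewrite -[Y]lnK ?posrE// ler_expR ler_pdivlMr// mulrC.
have E1 : 2 * T <= tau * E by rewrite [leRHS]mulrC -ler_pdivrMr// (le_trans _ YE)// /Y le_max lexx.
have E2 : 2 / r <= tau * E by rewrite [leRHS]mulrC -ler_pdivrMr// (le_trans _ YE)// /Y !le_max lexx !orbT.
have E3 : 2 / e <= E by rewrite (le_trans _ YE)// /Y !le_max lexx !orbT.
have EV : expR (- x / q) = E^-1 by rewrite mulNr expRN.
(* Tilting at [th] concentrates [- beta] near [x + del]. *)
pose th := tau * expR (del / q) * E.
have ed : 1 <= expR (del / q) by rewrite -expR0 ler_expR divr_ge0 ?ltW.
have thE : tau * E <= th by rewrite /th mulrAC ler_peMr// ltW// mulr_gt0.
have th2T : 2 * T <= th by exact: le_trans thE.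
have th0 : 0 < th by rewrite (lt_le_trans _ th2T)// mulr_gt0.
have thr : 2 <= th * r by rewrite -ler_pdivrMr// (le_trans E2).
have qth : q * ln th + C = x + del - q by rewrite /th lnth; ring.
have [g [gE g1 g2]] := lnM_ th ltac:(lra).
have [gp [gpE gp1 gp2]] : exists gp : R, [/\ M ((1 + k) * th) = expR ((1 + k) * th * (q * ln ((1 + k) * th) + C + gp)), - e1 <= gp & gp <= e1].
  by apply: lnM_; rewrite mulrDl mul1r; have := mulr_ge0 (ltW k0) (ltW th0); lra.
have [gm [gmE gm1 gm2]] : exists gm : R, [/\ M ((1 - k) * th) = expR ((1 - k) * th * (q * ln ((1 - k) * th) + C + gm)), - e1 <= gm & gm <= e1].
  by apply: lnM_; have : 2^-1 * th <= (1 - k) * th; [rewrite ler_wpM2r ?(ltW th0)//; lra|lra].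
have lp : ln (1 + k) <= k by apply: le_ln1Dx; lra.
have lm : ln (1 - k) <= - k by apply: le_ln1Dx; lra.
have lnp : ln ((1 + k) * th) = ln (1 + k) + ln th by rewrite lnM ?posrE//; lra.
have lnm : ln ((1 - k) * th) = ln (1 - k) + ln th by rewrite lnM ?posrE//; lra.
have e4 : expR (- 2) <= 4^-1 :> R.
  rewrite expRN lef_pV2 ?posrE ?expR_gt0//.
  have -> : 2 = 1 + 1 :> R by [].
  have h2 : 2 <= expR 1 :> R by have := @expR_ge1Dx R 1.
  rewrite expRD (le_trans _ (ler_pM _ _ h2 h2))//; lra.
have quarter a : a <= th * (q * ln th + C + g) - 2 -> expR a <= M th / 4.
  move=> ha; apply: (@le_trans _ _ (expR (th * (q * ln th + C + g) - 2))); first by rewrite ler_expR.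
  by rewrite gE expRD ler_wpM2l// expR_ge0.
have k1p : 0 <= 1 + k by lra.
have k1m : 0 <= 1 - k by lra.
have close z : z <= - r -> th * z <= - 2.
  by move=> zr; rewrite (le_trans (ler_wpM2l (ltW th0) zr))// mulrN lerN2.
have t1 : expR (- (k * th * (x + 2 * del))) * M ((1 + k) * th) <= M th / 4.
  rewrite gpE -expRD; apply: quarter; rewrite lnp -lerBlDl.
  set w := - k * (x + 2 * del) + (1 + k) * (q * (ln (1 + k) + ln th) + C + gp) - (q * ln th + C + g).
  have -> : - (k * th * (x + 2 * del)) + (1 + k) * th * (q * (ln (1 + k) + ln th) + C + gp) -
     th * (q * ln th + C + g) = th * w by rewrite /w; ring.
  apply: close.
  have a1 := ler_wpM2l (mulr_ge0 k1p (ltW q_gt0)) lp.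
  have a2 := ler_wpM2l k1p gp2.
  have a3 : k * e1 <= 2^-1 * e1 by rewrite ler_wpM2r// ltW.
  have -> : w = (1 + k) * q * ln (1 + k) + (1 + k) * gp - k * q - k * del - g + k * (q * ln th + C - (x + del - q)).
    by rewrite /w; ring.
  by move: krE; rewrite qth; lra.
have t2 : expR (k * th * x) * M ((1 - k) * th) <= M th / 4.
  rewrite gmE -expRD; apply: quarter; rewrite lnm -lerBlDl.
  set w := k * x + (1 - k) * (q * (ln (1 - k) + ln th) + C + gm) - (q * ln th + C + g).
  have -> : k * th * x + (1 - k) * th * (q * (ln (1 - k) + ln th) + C + gm) -
     th * (q * ln th + C + g) = th * w by rewrite /w; ring.
  apply: close.
  have a1 := ler_wpM2l (mulr_ge0 k1m (ltW q_gt0)) lm.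
  have a2 := ler_wpM2l k1m gm2.
  have a3 : 0 <= k * e1 by rewrite mulr_ge0 ?ltW.
  have -> : w = (1 - k) * q * ln (1 - k) + (1 - k) * gm + k * q - k * del - g - k * (q * ln th + C - (x + del - q)).
    by rewrite /w; ring.
  by move: krE; rewrite qth; lra.
(* Each leak is at most a quarter of [M th], so at least half of the tilted mass lies in the
   window. *)
have W := win th k x (x + 2 * del) (ltW th0) (ltW k0) ltac:(lra).
have plow : expR (- (th * (q + e1 + del)) - 1) <= p x.
  have h : M th / 2 <= expR (th * (x + 2 * del)) * p x.
    by move: W t1 t2; set A := _ * p x; set B := expR _ * M _; set D := expR _ * M _; lra.
  have -> : p x = expR (- (th * (x + 2 * del))) * (expR (th * (x + 2 * del)) * p x).
    by rewrite mulrA -expRD addNr expR0 mul1r.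
  apply: le_trans (ler_wpM2l (expR_ge0 _) h).
  have h2 : expR (- 1) <= 2^-1 :> R.
    by rewrite expRN lef_pV2 ?posrE ?expR_gt0//; have := @expR_ge1Dx R 1.
  rewrite gE mulrA -expRD [leLHS]expRD; apply: ler_pM; rewrite ?expR_ge0// ler_expR.
  have -> : - (th * (x + 2 * del)) + th * (q * ln th + C + g) = - (th * ((x + 2 * del) - (q * ln th + C) - g)) by ring.
  rewrite lerN2 ler_wpM2l ?(ltW th0)// qth; lra.
have p0 : 0 < p x by apply: lt_le_trans plow; exact: expR_gt0.
have EV0 : 0 <= E^-1 by rewrite invr_ge0 ltW.
rewrite EV ler_norml; apply/andP; split.
  have h : - (th * (q + e1 + del)) - 1 <= ln (p x) by rewrite -ler_expR lnK.
  have := ler_wpM2l EV0 h.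
  have -> : E^-1 * (- (th * (q + e1 + del)) - 1) = - (tau * expR (del / q) * (q + e1 + del)) - E^-1.
    by rewrite /th; field; rewrite gt_eqF.
  have Ee : E^-1 <= e / 2.
    by rewrite -[leRHS]invrK lef_pV2 ?posrE ?invr_gt0 ?divr_gt0// invf_div.
  have h3 : tau * expR (del / q) * (q + e1 + del) <= tau * expR (del / q) * (q + 2 * del).
    by rewrite ler_wpM2l ?mulr_ge0 ?expR_ge0 ?(ltW tau0)//; lra.
  move: h3 Ee hdel; move: (E^-1 * ln (p x)) (tau * _ * (q + e1 + del)) (tau * _ * (q + 2 * del)) => a b c.
  by lra.
have tE0 : 0 < tau * E by rewrite mulr_gt0.
have [h [hE h1 h2]] := lnM_ (tau * E) ltac:(lra).
have lE : q * ln (tau * E) = x - C - q.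
  by have := lnth 0 x; rewrite mul0r expR0 mulr1 addr0.
have : ln (p x) <= tau * E * (h - q).
  rewrite -ler_expR lnK ?posrE// (le_trans (up _ x (ltW tE0)))// hE -expRD ler_expR lE.
  by rewrite le_eqVlt; apply/orP; left; apply/eqP; ring.
move=> /(ler_wpM2l EV0).
have -> : E^-1 * (tau * E * (h - q)) = tau * h - L by rewrite /L -/tau; field; rewrite gt_eqF.
have := ler_wpM2l (ltW tau0) h2.
move: e1e; move: (E^-1 * ln (p x)) (tau * h) (tau * e1) => a b c.
by lra.
Qed.

End Tauberian.

Theorem theorem1p3 (R : realType) :
  exists L : R, 0 < L /\
  forall (d : measure_display) (Omega : measurableType d)
         (P : probability Omega R) (X1 X2 : R -> Omega -> R)
         (phi : R -> R -> R) (beta1 : Omega -> R),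
    planar_BM P X1 X2 ->
    schwartz2 phi ->
    (forall x y, 0 <= phi x y) ->
    (\int[(lebesgue_measure \x lebesgue_measure)%E]_(p in [set: R * R])
        (phi p.1 p.2)%:E)%E = 1%E ->
    measurable_fun setT beta1 ->
    {ae P, forall w,
       (fun eps => approx_SILT X1 X2 phi eps w - approx_SILT_mean P X1 X2 phi eps)
         @ 0^'+ --> beta1 w} ->
    (fun t : R => t `^ (- (2 * pi)) * ln (fine (P [set w | ln t <= - beta1 w])))
      @ +oo --> - L.
Proof.
pose q := (pi *+ 2)^-1 : R.
have q0 : 0 < q by rewrite invr_gt0 mulrn_wgt0// pi_gt0.
(* One function [M] must serve every setup at once, because [L] is fixed before the probability
   space and the kernel. *)
pose good (M : R -> R) := forall (d : measure_display) (Omega : measurableType d) (P : probability Omega R)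
  (X1 X2 : R -> Omega -> R) F m B (beta : Omega -> R), planar_BM P X1 X2 -> kfam F m B -> measurable_fun setT beta ->
  {ae P, forall w, (fun eps => silt X1 X2 (F eps) w - smean P X1 X2 F eps) @ 0^'+ --> beta w} ->
  forall th, 0 <= th -> mgf P beta th = M th.
have [M [C [M0 rC MG]]] : exists (M : R -> R) C, [/\ forall th, 0 < th -> 0 < M th,
   forall e, 0 < e -> exists2 T, 1 <= T & forall th, T <= th -> `|rate q M th - C| <= e & good M].
  (* If no setup exists, the claim is vacuous and exp(th q ln th) with C = 0 is a placeholder. *)
  have [[d [Om [P [X1 [X2 [F [m [B [beta [BX FF mb bc]]]]]]]]]]|none] := EM (exists (d : measure_display)
      (Omega : measurableType d) (P : probability Omega R) (X1 X2 : R -> Omega -> R) F m B (beta : Omega -> R),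
      [/\ planar_BM P X1 X2, kfam F m B, measurable_fun setT beta &
      {ae P, forall w, (fun eps => silt X1 X2 (F eps) w - smean P X1 X2 F eps) @ 0^'+ --> beta w}]); last first.
    exists (fun th => expR (th * (q * ln th))), 0; split=> [th _|e e0|].
    - exact: expR_gt0.
    - exists 1 => // th t1; have t0 : 0 < th by exact: lt_le_trans t1.
      by rewrite /rate expRK mulrC mulKf ?gt_eqF// !subrr normr0 ltW.
    - move=> d Omega P X1 X2 F m B beta BX FF mb bc; exfalso; apply: none.
      by exists d, Omega, P, X1, X2, F, m, B, beta.
  have M0 th : 0 < th -> 0 < mgf P beta th by exact: (mgf_gt0 BX FF mb bc).
  have [C rC] := rate_cvg (q := q) M0 (mgf_superscale BX FF mb bc) (mgf_lower BX FF mb bc) (mgf_interp BX FF mb bc).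
  exists (mgf P beta), C; split=> // d' Omega' P' X1' X2' F' m' B' beta' BX' FF' mb' bc' th t0.
  exact: (mgf_unique BX' FF' mb' bc' BX FF mb bc t0).
exists (expR (- C / q - 1) * q); split; first by rewrite mulr_gt0// expR_gt0.
move=> d Omega P X1 X2 phi beta BX sp p0 p1 mb bc.
have [m [B FF]] := schwartz_kfam sp p0 p1.
have E th : 0 <= th -> mgf P beta th = M th by exact: (MG _ _ _ _ _ _ _ _ _ BX FF mb bc).
have up th x : 0 <= th -> fine (P [set w | x <= - beta w]) <= expR (- th * x) * M th.
  by move=> t0; rewrite -E//; exact: (tail_chernoff BX FF mb bc).
have win th k x y : 0 <= th -> 0 <= k -> k <= 1 ->
   M th <= expR (th * y) * fine (P [set w | x <= - beta w]) + expR (- (k * th * y)) * M ((1 + k) * th) +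
     expR (k * th * x) * M ((1 - k) * th).
  move=> t0 k0 k1; have k1' : 0 <= 1 - k by rewrite subr_ge0.
  have k2 : 0 <= 1 + k by rewrite addr_ge0.
  rewrite -!E ?mulr_ge0//.
  exact: (tail_window BX FF mb bc).
apply/cvgrPdist_le => e e0.
have [X0 H] := rate_tail_limit q0 M0 rC up win e0.
near=> t.
have t0 : 0 < t by near: t; exact: nbhs_pinfty_gt.
have tX : X0 <= ln t.
  suff : expR X0 <= t by move=> h; rewrite -ler_expR lnK ?posrE.
  by near: t; exact: nbhs_pinfty_ge.
rewrite distrC opprK /powR (gt_eqF t0).
(* With q = 1 / (2 pi) the factor t^(- 2 pi) is exp(- ln t / q), so the tail estimate is used at x =
   ln t. *)
have -> : - (2 * pi) * ln t = - ln t / q by rewrite /q invrK mulr2n; move: (pi : R) (ln t) => a b; ring.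
exact: H.
Unshelve. all: by end_near.
Qed.
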